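(* Let $\Omega$ be a Bunimovich stadium with rectangular part $R=[-B_0,0]\times[0,L_0]$, let $W=\Omega\setminus R$, and let $$\Sigma=\left\{\frac{k^2\pi^2}{L_0^2}+\frac{l^2\pi^2}{B_0^2}\ :\ k,l\in\mathbb{N}\right\}$$ be the Dirichlet spectrum of $R$. For any $\varepsilon\ge 0$ there exist $E_0$ and $C$ such that, if $u$ is an eigenfunction of the Dirichlet Laplacian on $\Omega$ of energy $E$ with $E>E_0$ and $\mathrm{dist}(E,\Sigma)>E^{-\varepsilon}$, then $$\|u\|_{L^2(\Omega)}\le C\,E^{\frac{5+8\varepsilon}{6}}\,\|u\|_{L^2(W)}.$$
   Context: Fix $B_0,L_0>0$. The Bunimovich stadium is taken to be the planar domain $\Omega=\{(x,y): -B_0\le x\le B_1,\ 0\le y\le L(x)\}$ with $B_1=L_0$, $L(x)=L_0$ for $-B_0\le x\le 0$ and $L(x)=\sqrt{L_0^2-x^2}$ for $0\le x\le L_0$. Here $\mathbb{N}=\{1,2,3,\dots\}$. An eigenfunction of energy $E$ is a nonzero $u\in H^1_0(\Omega)$ with $-(\partial_x^2+\partial_y^2)u=Eu$ in $\Omega$. *)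

(* Defs.v *)
From HB Require Import structures.
From mathcomp Require Import all_boot all_order all_algebra.
From mathcomp Require Import all_classical all_reals all_analysis.
From mathcomp Require Import complex.

Set Implicit Arguments.
Unset Strict Implicit.
Unset Printing Implicit Defensive.

Import Order.TTheory GRing.Theory Num.Theory.
Import numFieldNormedType.Exports.

Local Open Scope classical_set_scope.
Local Open Scope ring_scope.

Definition lebesgue2 {R : realType} :
    {measure set (measurableTypeR R * measurableTypeR R) -> \bar R} :=
  (@lebesgue_measure R \x @lebesgue_measure R)%E.

Definition dx {R : realType} (f : R * R -> R) : R * R -> R :=
  fun p => 'D_((1, 0) : R * R) (f : R * R -> R^o) p.
Definition dy {R : realType} (f : R * R -> R) : R * R -> R :=
  fun p => 'D_((0, 1) : R * R) (f : R * R -> R^o) p.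

Fixpoint Cn {R : realType} (n : nat) (f : R * R -> R) : Prop :=
  if n is m.+1 then
    (forall p, derivable (f : R * R -> R^o) p (1, 0)
            /\ derivable (f : R * R -> R^o) p (0, 1))
    /\ Cn m (dx f) /\ Cn m (dy f)
  else continuous f.

(* C_c^oo(D°): here and below a "domain" may be given by its closure, so that
   supports are required to be compact in the interior of D. *)
Definition test_function {R : realType} (D : set (R * R)) (phi : R * R -> R) :=
  [/\ forall n, Cn n phi,
      compact (closure [set p | phi p != 0])
    & closure [set p | phi p != 0] `<=` interior D].

(* Functions are defined on the whole plane, but only their values on D matter.
   They are Borel measurable; any class in L^2 has such a representative. *)
Definition L2 {R : realType} (D : set (R * R)) (f : R * R -> R) : Prop :=
  f \_ D \in Lfun lebesgue2 2%:E.

Definition L2norm {R : realType} (D : set (R * R)) (f : R * R -> R) : \bar R :=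
  Lnorm lebesgue2 2%:E (EFin \o (f \_ D)).

(* gx and gy are the weak partial derivatives of f in the interior of D. *)
Definition weak_gradient {R : realType} (D : set (R * R))
    (f gx gy : R * R -> R) : Prop :=
  forall phi, test_function D phi ->
    (\int[lebesgue2]_(p in D) (f p * dx phi p))
      = - (\int[lebesgue2]_(p in D) (gx p * phi p))
    /\ (\int[lebesgue2]_(p in D) (f p * dy phi p))
      = - (\int[lebesgue2]_(p in D) (gy p * phi p)).

(* H^1_0(D): the closure of C_c^oo(D°) in H^1(D°). *)
Definition H10 {R : realType} (D : set (R * R)) (f : R * R -> R) : Prop :=
  L2 D f /\
  exists gx gy : R * R -> R,
    [/\ L2 D gx, L2 D gy, weak_gradient D f gx gy
      & exists phi : nat -> R * R -> R,
        [/\ forall n, test_function D (phi n),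
            (fun n => L2norm D (phi n \- f)) @ \oo --> 0%E,
            (fun n => L2norm D (dx (phi n) \- gx)) @ \oo --> 0%E
          & (fun n => L2norm D (dy (phi n) \- gy)) @ \oo --> 0%E]].

(* - (dx^2 + dy^2) f = E f in the sense of distributions in the interior
   of D. *)
Definition helmholtz {R : realType} (D : set (R * R)) (E : R)
    (f : R * R -> R) : Prop :=
  forall phi, test_function D phi ->
    (\int[lebesgue2]_(p in D) (f p * - (dx (dx phi) p + dy (dy phi) p)))
      = E * (\int[lebesgue2]_(p in D) (f p * phi p)).

(* Eigenfunctions may be complex valued; membership in H^1_0 and the equation
   (whose energy is real) are understood for real and imaginary parts. *)
Definition dirichlet_eigenfunction {R : realType} (D : set (R * R)) (E : R)
    (u : R * R -> R[i]) : Prop :=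
  [/\ H10 D (fun p => complex.Re (u p)), H10 D (fun p => complex.Im (u p)),
      helmholtz D E (fun p => complex.Re (u p)),
      helmholtz D E (fun p => complex.Im (u p))
    & ~ {ae lebesgue2, forall p, D p -> u p = 0}].

(* The modulus `|u p| lives in R[i]; it is real. *)
Definition cL2norm {R : realType} (D : set (R * R)) (u : R * R -> R[i]) :
  \bar R := L2norm D (fun p => complex.Re `|u p|).

Definition stadium_height {R : realType} (L0 x : R) : R :=
  if x <= 0 then L0 else Num.sqrt (L0 ^+ 2 - x ^+ 2).

Definition stadium {R : realType} (B0 L0 : R) : set (R * R) :=
  [set p | - B0 <= p.1 <= L0 /\ 0 <= p.2 <= stadium_height L0 p.1].

Definition rectangle {R : realType} (B0 L0 : R) : set (R * R) :=
  [set p | - B0 <= p.1 <= 0 /\ 0 <= p.2 <= L0].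

Definition wing {R : realType} (B0 L0 : R) : set (R * R) :=
  stadium B0 L0 `\` rectangle B0 L0.

Definition rectangle_spectrum {R : realType} (B0 L0 : R) : set R :=
  [set s | exists k l : nat, [/\ (0 < k)%N, (0 < l)%N
    & s = k%:R ^+ 2 * pi ^+ 2 / L0 ^+ 2 + l%:R ^+ 2 * pi ^+ 2 / B0 ^+ 2]].

(* Main.v *)
(* Real and imaginary parts are treated separately; let [E = s^2] and write [L] for the height
   of the stadium. By Poincare's inequality in [y], the norm of [u] on the rectangle is controlled
   by its Fourier coefficients [G_k] on [sin (kappa_k y)], [kappa_k = (k + 1) pi / L0], with
   [kappa_k <= 4 s]: the remaining modes cost at most a quarter of the norm, because the gradient
   of [u] has norm [s |u|].

   For such a mode, [psi'' + (E - kappa_k^2) psi = G_k], [psi (- B0) = 0] has a solution of size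
   comparable to [G_k], with no exponential loss. Cut it
   off at [x = 1 / s] into [P], and extend the sine to the wing as [sin (kappa_k L0 y / L(x))],
   which vanishes on the curved boundary. Testing the equation with
   [P(x) sin (kappa_k L0 y / L(x))] expresses the integral of [u G_k sin (kappa_k y)] over the
   rectangle as minus that of [u Phi_k] over the wing, where [Phi_k] is the image of the test
   function under [Laplacian + E]. On every vertical fibre of the wing the sum of the [Phi_k] is a
   combination of sines and cosines which are still orthogonal there, so its square norm is at most
   [C s^3 |u|^2]. Summing over [k] gives [|u| <= C s^(3/2) |u|_W], that is [C E^(3/4) |u|_W],
   and [3 / 4 <= 5 / 6]. *)

Require Import Defs.
From mathcomp Require Import all_boot all_order all_algebra.
From mathcomp Require Import all_classical all_reals all_analysis.
From mathcomp Require Import complex.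
From mathcomp Require Import measurable_realfun ring lra.
Import Order.TTheory GRing.Theory Num.Theory.
Import numFieldNormedType.Exports.

Set Implicit Arguments.
Unset Strict Implicit.
Unset Printing Implicit Defensive.

Local Open Scope classical_set_scope.
Local Open Scope ring_scope.

(** * Smooth functions *)

(** The power [s^3] is the price of the cutoff of length [1 / s]: two derivatives falling on it cost
    [s^2], hence [s^4] in the squared norm, and the length of the region where the correction lives
    gives back one factor [s]. The same length keeps the correction in [x < L0 / 2], away from the
    end [x = L0] where the dilation of the fibres blows up; hence the condition [2 / L0 < s].

    Frequencies between [s] and [4 s] belong to evanescent modes, whose equation has exponentially
    growing solutions; this is the obstacle behind the choice of [psi].

    The function [P(x) sin (kappa_k L0 y / L(x))] is not an admissible test function for two
    reasons: the dilation [L0 / L(x)] is only C^{1,1} across [x = 0], and the function vanishes on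
    the boundary but not near it. A smoothing [dil n] and a cutoff [cut n] repair this and are
    removed together by dominated convergence.

    The [G_k] are taken from a test function [w] close to [u], which makes them smooth and gives
    pointwise boundary values; [w] tends to [u] only at the end, in an inequality between norms. *)

Definition der {R : realType} (f g : R -> R) := forall x : R, is_derive x 1 f (g x).

Definition smooth1 {R : realType} (f : R -> R) :=
  forall n (x : R), derivable (derive1n n f) x 1.

Section Der.
Context {R : realType}.
Implicit Types f g : R -> R.

Lemma derE f g : der f g -> derive1 f = g.
Proof. by move=> fg; apply/funext => x; rewrite derive1E; case: (fg x). Qed.

Lemma der_eq f g g' : der f g -> g =1 g' -> der f g'.
Proof. by move=> h e x; rewrite -e. Qed.

Lemma der_eql f f' g : der f g -> f =1 f' -> der f' g.
Proof. by move=> h /funext <-. Qed.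

Lemma der_derivable f g : der f g -> forall x, derivable f x 1.
Proof. by move=> fg x; case: (fg x). Qed.

Lemma der_continuous f g : der f g -> continuous f.
Proof.
by move=> fg x; apply/differentiable_continuous/derivable1_diffP/(der_derivable fg).
Qed.

Lemma der_cst (c : R) : der (fun=> c) (fun=> 0).
Proof. by move=> x; exact: is_derive_cst. Qed.

Lemma der_id : der (fun x : R => x) (fun=> 1).
Proof. by move=> x; exact: is_derive_id. Qed.

Lemma derD f g f' g' : der f f' -> der g g' ->
  der (fun x => f x + g x) (fun x => f' x + g' x).
Proof. by move=> h1 h2 x; exact: is_deriveD. Qed.

Lemma derN f f' : der f f' -> der (fun x => - f x) (fun x => - f' x).
Proof. by move=> h1 x; exact: is_deriveN. Qed.

Lemma derB f g f' g' : der f f' -> der g g' ->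
  der (fun x => f x - g x) (fun x => f' x - g' x).
Proof. by move=> h1 h2 x; exact: is_deriveB. Qed.

Lemma derM f g f' g' : der f f' -> der g g' ->
  der (fun x => f x * g x) (fun x => f' x * g x + f x * g' x).
Proof.
move=> h1 h2 x; have /= := @is_deriveM _ _ f g x 1 _ _ (h1 x) (h2 x).
by rewrite addrC ![_ *: _]mulrC /GRing.scale /= [g' x * _]mulrC.
Qed.

Lemma derZ (c : R) f f' : der f f' -> der (fun x => c * f x) (fun x => c * f' x).
Proof.
move=> h; apply: der_eq (derM (der_cst c) h) _ => x.
by rewrite mul0r add0r.
Qed.

Lemma der_sum n (f g : 'I_n -> R -> R) : (forall i, der (f i) (g i)) ->
  der (fun x => \sum_i f i x) (fun x => \sum_i g i x).
Proof.
elim: n f g => [|n IH] f g fg.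
  by apply: der_eql (der_eq (der_cst 0) _) _ => x; rewrite big_ord0.
have H := derD (IH _ _ (fun i => fg (widen_ord (leqnSn n) i))) (fg ord_max).
by apply: der_eql (der_eq H _) _ => x; rewrite big_ord_recr.
Qed.

Lemma der_comp f g f' g' : der f f' -> der g g' ->
  der (fun x => f (g x)) (fun x => f' (g x) * g' x).
Proof. by move=> h1 h2 x; exact: is_derive1_comp. Qed.

Lemma der_sin : der (@sin R) (@cos R). Proof. by move=> x; exact: is_derive_sin. Qed.
Lemma der_cos : der (@cos R) (fun x => - sin x).
Proof. by move=> x; exact: is_derive_cos. Qed.
Lemma der_exp : der (@expR R) (@expR R).
Proof. by move=> x; exact: is_derive_expR. Qed.

Lemma derV f f' : der f f' -> (forall x, f x != 0) ->
  der (fun x => (f x)^-1) (fun x => - f' x * ((f x)^-1 * (f x)^-1)).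
Proof.
move=> h n0 x; have := @is_deriveV R f x _ 1 (n0 x) (h x).
by rewrite /GRing.scale /= => h'; apply: is_derive_eq h' _; rewrite -expr2 exprVn mulrC mulrN mulNr mulrC.
Qed.

(** The derivative is a product of [f'] and copies of [(Num.sqrt f)^-1] alone, so that [sm1] is
    visibly stable under differentiation. *)
Lemma der_rsqrt f f' : der f f' -> (forall x, 0 < f x) ->
  der (fun x => (Num.sqrt (f x))^-1)
      (fun x => - 2^-1 * f' x * ((Num.sqrt (f x))^-1 * ((Num.sqrt (f x))^-1 * (Num.sqrt (f x))^-1))).
Proof.
move=> h p x.
have s0 y : 0 < Num.sqrt (f y) by rewrite sqrtr_gt0.
have ds : der (fun x => Num.sqrt (f x)) (fun x => (2 * Num.sqrt (f x))^-1 * f' x).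
  by move=> y; apply: is_derive1_comp (is_derive1_sqrt (p y)) (h y).
have := derV ds (fun y => lt0r_neq0 (s0 y)).
move=> /(_ x) h'; apply: is_derive_eq h' _.
have /lt0r_neq0 := s0 x; move: (Num.sqrt _) => s sn; field; exact: sn.
Qed.

(** By induction every iterated derivative stays in [P]. Instead of computing derivatives of order
    [n], one exhibits a class stable under a single differentiation. *)
Lemma smooth1_coind (P : (R -> R) -> Prop) :
  (forall f, P f -> exists2 g, P g & der f g) -> forall f, P f -> smooth1 f.
Proof.
move=> H f Pf n.
suff Pn : P (derive1n n f) by have [g _ /der_derivable] := H _ Pn.
elim: n => [|n /H[g Pg /derE]] //; rewrite derive1nS.
by move=> ->.
Qed.

Lemma smooth1_der f : smooth1 f -> exists2 g, smooth1 g & der f g.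
Proof.
move=> sf; exists (derive1 f).
  by move=> n x; rewrite -derive1Sn; exact: (sf n.+1).
by move=> x; apply: DeriveDef; [exact: (sf 0)|rewrite derive1E].
Qed.

(* Closed under differentiation, hence smooth by coinduction. *)
Inductive sm1 : (R -> R) -> Prop :=
| sm1_incl f : smooth1 f -> sm1 f
| sm1_add f g : sm1 f -> sm1 g -> sm1 (fun x => f x + g x)
| sm1_mul f g : sm1 f -> sm1 g -> sm1 (fun x => f x * g x)
| sm1_comp f g : sm1 f -> sm1 g -> sm1 (fun x => f (g x))
| sm1_inv f : sm1 f -> (forall x, f x != 0) -> sm1 (fun x => (f x)^-1)
| sm1_rsqrt f : sm1 f -> (forall x, 0 < f x) -> sm1 (fun x => (Num.sqrt (f x))^-1)
| sm1_prim f F : sm1 f -> der F f -> sm1 F.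

Lemma smooth1_cst (c : R) : smooth1 (fun=> c).
Proof.
apply: (@smooth1_coind (fun f : R -> R => exists c, f = (fun=> c))); last by exists c.
by move=> _ [d ->]; exists (fun=> 0); [exists 0|exact: der_cst].
Qed.

Lemma sm1_cst (c : R) : sm1 (fun=> c).
Proof. exact/sm1_incl/smooth1_cst. Qed.

Lemma sm1_smooth1 f : sm1 f -> smooth1 f.
Proof.
apply: smooth1_coind => {}f; elim => {f}.
- by move=> f /smooth1_der [g sg fg]; exists g => //; exact: sm1_incl.
- move=> f g _ [f' sf hf] _ [g' sg hg].
  by exists (fun x => f' x + g' x); [exact: sm1_add|exact: derD].
- move=> f g pf [f' sf hf] pg [g' sg hg].
  by exists (fun x => f' x * g x + f x * g' x); [apply: sm1_add; exact: sm1_mul|exact: derM].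
- move=> f g pf [f' sf hf] pg [g' sg hg].
  exists (fun x => f' (g x) * g' x); [apply: sm1_mul => //; exact: sm1_comp|exact: der_comp].
- move=> f pf [f' sf hf] f0; eexists; last exact: derV.
  apply: sm1_mul; last by apply: sm1_mul; exact: sm1_inv.
  apply: (@sm1_comp (fun x => - x)) => //.
  apply: (@sm1_prim (fun=> -1)); first exact: sm1_cst.
  exact: derN der_id.
- move=> f pf [f' sf hf] f0; eexists; last exact: der_rsqrt.
  apply: sm1_mul.
    by apply: (@sm1_mul (fun=> - 2^-1)) => //; exact: sm1_cst.
  by apply: sm1_mul; last apply: sm1_mul; exact: sm1_rsqrt.
- by move=> f F sf _ hF; exists f.
Qed.

Lemma smooth1_id : smooth1 (fun x : R => x).
Proof. by apply: sm1_smooth1; apply: sm1_prim der_id; exact: sm1_cst. Qed.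

Lemma smooth1D f g : smooth1 f -> smooth1 g -> smooth1 (fun x => f x + g x).
Proof. by move=> *; apply: sm1_smooth1; apply: sm1_add; apply: sm1_incl. Qed.
Lemma smooth1M f g : smooth1 f -> smooth1 g -> smooth1 (fun x => f x * g x).
Proof. by move=> *; apply: sm1_smooth1; apply: sm1_mul; apply: sm1_incl. Qed.
Lemma smooth1_comp f g : smooth1 f -> smooth1 g -> smooth1 (fun x => f (g x)).
Proof. by move=> *; apply: sm1_smooth1; apply: sm1_comp; apply: sm1_incl. Qed.
Lemma smooth1V f : smooth1 f -> (forall x, f x != 0) -> smooth1 (fun x => (f x)^-1).
Proof. by move=> *; apply: sm1_smooth1; apply: sm1_inv => //; apply: sm1_incl. Qed.
Lemma smooth1_rsqrt f : smooth1 f -> (forall x, 0 < f x) ->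
  smooth1 (fun x => (Num.sqrt (f x))^-1).
Proof. by move=> *; apply: sm1_smooth1; apply: sm1_rsqrt => //; apply: sm1_incl. Qed.
Lemma smooth1_prim f F : smooth1 f -> der F f -> smooth1 F.
Proof. by move=> ? h; apply: sm1_smooth1; apply: sm1_prim h; apply: sm1_incl. Qed.
Lemma smooth1N f : smooth1 f -> smooth1 (fun x => - f x).
Proof.
move=> h; rewrite (_ : (fun x => _) = (fun x => -1 * f x)).
  exact: (smooth1M (@smooth1_cst (-1)) h).
by apply/funext => x; rewrite mulN1r.
Qed.
Lemma smooth1B f g : smooth1 f -> smooth1 g -> smooth1 (fun x => f x - g x).
Proof. by move=> h1 h2; exact: (smooth1D h1 (smooth1N h2)). Qed.

Lemma smooth1_exp : smooth1 (@expR R).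
Proof.
apply: (@smooth1_coind (fun f : R -> R => f = expR)) => // _ ->.
by exists expR => //; exact: der_exp.
Qed.

Lemma smooth1_trig (f : R -> R) :
  f = sin \/ f = cos -> smooth1 f.
Proof.
move=> h.
apply: (@smooth1_coind (fun f : R -> R => [\/ f = sin, f = cos, f = (fun x => - sin x) | f = (fun x => - cos x)])).
  move=> _ [] ->.
  - by exists cos; [apply: Or42|exact: der_sin].
  - by exists (fun x => - sin x); [apply: Or43|exact: der_cos].
  - by exists (fun x => - cos x); [apply: Or44|exact: derN der_sin].
  - exists (fun x => sin x); first exact: Or41.
    by apply: der_eq (derN der_cos) _ => x; rewrite opprK.
by case: h => ->; [apply: Or41|apply: Or42].
Qed.

Lemma smooth1_sin : smooth1 (@sin R). Proof. by apply: smooth1_trig; left. Qed.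
Lemma smooth1_cos : smooth1 (@cos R). Proof. by apply: smooth1_trig; right. Qed.

Lemma smooth1_continuous f : smooth1 f -> continuous f.
Proof. by case/smooth1_der => g _ /der_continuous. Qed.

End Der.

(** * Smooth functions and test functions in the plane *)

Definition smooth2 {R : realType} (f : R * R -> R) := forall n, Cn n f.

Definition derx {R : realType} (f g : R * R -> R) :=
  forall y, der (fun x => f (x, y)) (fun x => g (x, y)).
Definition dery {R : realType} (f g : R * R -> R) :=
  forall x, der (fun y => f (x, y)) (fun y => g (x, y)).

Section Smooth2.
Context {R : realType}.
Implicit Types f g : R * R -> R.

(** The difference quotient of [f] in the direction [(1, 0)] is that of its horizontal slice, so the
    one-variable rules compute [dx]. *)
Lemma derxP f g : derx f g <->
  (forall p : R * R, derivable (f : R * R -> R^o) p (1, 0)) /\ dx f = g.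
Proof.
have E (x y h : R) : h *: ((1, 0) : R * R) + (x, y) = (h *: (1 : R^o) + x, y).
  by apply: injective_projections; rewrite //= scaler0 add0r.
have EF (x y : R) : (fun h : R => h^-1 *: (((f : R * R -> R^o) \o shift (x, y)) (h *: (1, 0)) - f (x, y)))
   = (fun h : R => h^-1 *: (((fun x => f (x, y) : R^o) \o shift x) (h *: (1 : R^o)) - f (x, y))).
  by apply/funext => h /=; rewrite E.
split.
  move=> H; split.
    by case=> x y; have [+ _] := H y x; rewrite /derivable EF.
  by apply/funext => -[x y]; have [_] := H y x; rewrite /dx /derive EF.
move=> [H <-] y x; split.
  by have := H (x, y); rewrite /derivable EF.
by rewrite /dx /derive EF.
Qed.

Lemma deryP f g : dery f g <->
  (forall p : R * R, derivable (f : R * R -> R^o) p (0, 1)) /\ dy f = g.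
Proof.
have E (x y h : R) : h *: ((0, 1) : R * R) + (x, y) = (x, h *: (1 : R^o) + y).
  by apply: injective_projections; rewrite //= scaler0 add0r.
have EF (x y : R) : (fun h : R => h^-1 *: (((f : R * R -> R^o) \o shift (x, y)) (h *: (0, 1)) - f (x, y)))
   = (fun h : R => h^-1 *: (((fun y => f (x, y) : R^o) \o shift y) (h *: (1 : R^o)) - f (x, y))).
  by apply/funext => h /=; rewrite E.
split.
  move=> H; split.
    by case=> x y; have [+ _] := H x y; rewrite /derivable EF.
  by apply/funext => -[x y]; have [_] := H x y; rewrite /dy /derive EF.
move=> [H <-] x y; split.
  by have := H (x, y); rewrite /derivable EF.
by rewrite /dy /derive EF.
Qed.

Lemma derxE f g : derx f g -> dx f = g. Proof. by case/derxP. Qed.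
Lemma deryE f g : dery f g -> dy f = g. Proof. by case/deryP. Qed.

(** Joint continuity is carried along in the class, since derivatives along the slices do not imply
    it. *)
Lemma smooth2_coind (P : (R * R -> R) -> Prop) :
  (forall f, P f -> continuous f /\ exists fx fy,
     [/\ P fx, P fy, derx f fx & dery f fy]) -> forall f, P f -> smooth2 f.
Proof.
move=> H f Pf n; elim: n f Pf => [|n IH] f /H[cf [fx [fy [Px Py dX dY]]]] //=.
split; last by rewrite (derxE dX) (deryE dY); split; exact: IH.
by move=> p; split; [case/derxP : dX|case/deryP : dY].
Qed.

Lemma smooth2_dx f : smooth2 f -> smooth2 (dx f).
Proof. by move=> h n; have [_ []] := h n.+1. Qed.
Lemma smooth2_dy f : smooth2 f -> smooth2 (dy f).
Proof. by move=> h n; have [_ []] := h n.+1. Qed.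
Lemma smooth2_derx f : smooth2 f -> derx f (dx f).
Proof. by move=> h; apply/derxP; split => // p; have [/(_ p)[]] := h 1. Qed.
Lemma smooth2_dery f : smooth2 f -> dery f (dy f).
Proof. by move=> h; apply/deryP; split => // p; have [/(_ p)[]] := h 1. Qed.
Lemma smooth2_continuous f : smooth2 f -> continuous f.
Proof. by move=> h; exact: (h 0). Qed.

Inductive sm2 : (R * R -> R) -> Prop :=
| sm2_incl f : smooth2 f -> sm2 f
| sm2_fst h : smooth1 h -> sm2 (fun p => h p.1)
| sm2_snd h : smooth1 h -> sm2 (fun p => h p.2)
| sm2_add f g : sm2 f -> sm2 g -> sm2 (fun p => f p + g p)
| sm2_mul f g : sm2 f -> sm2 g -> sm2 (fun p => f p * g p)
| sm2_comp h g : smooth1 h -> sm2 g -> sm2 (fun p => h (g p)).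

Lemma sm2_cst (c : R) : sm2 (fun=> c).
Proof. by apply: (@sm2_fst (fun=> c)); exact: smooth1_cst. Qed.

Lemma sm2_smooth2 f : sm2 f -> smooth2 f.
Proof.
apply: smooth2_coind => {}f; elim => {f}.
- move=> f sf; split; first exact: smooth2_continuous.
  exists (dx f), (dy f); split.
  + exact/sm2_incl/smooth2_dx.
  + exact/sm2_incl/smooth2_dy.
  + exact: smooth2_derx.
  + exact: smooth2_dery.
- move=> h sh; have [h' sh' dh] := smooth1_der sh; split.
    by move=> p; apply: continuous_comp; [exact: cvg_fst|exact: smooth1_continuous].
  exists (fun p => h' p.1), (fun=> 0); split.
  + exact: sm2_fst.
  + exact: sm2_cst.
  + by move=> y; exact: dh.
  + by move=> x; exact: (der_cst (h x)).
- move=> h sh; have [h' sh' dh] := smooth1_der sh; split.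
    by move=> p; apply: continuous_comp; [exact: cvg_snd|exact: smooth1_continuous].
  exists (fun=> 0), (fun p => h' p.2); split.
  + exact: sm2_cst.
  + exact: sm2_snd.
  + by move=> y; exact: (der_cst (h y)).
  + by move=> x; exact: dh.
- move=> f g _ [cf [fx [fy [Px Py dX dY]]]] _ [cg [gx [gy [Qx Qy eX eY]]]]; split.
    by move=> p; apply: cvgD; [exact: cf|exact: cg].
  exists (fun p => fx p + gx p), (fun p => fy p + gy p); split.
  + exact: sm2_add.
  + exact: sm2_add.
  + by move=> y; exact: derD.
  + by move=> x; exact: derD.
- move=> f g Pf [cf [fx [fy [Px Py dX dY]]]] Pg [cg [gx [gy [Qx Qy eX eY]]]]; split.
    by move=> p; apply: cvgM; [exact: cf|exact: cg].
  exists (fun p => fx p * g p + f p * gx p), (fun p => fy p * g p + f p * gy p); split.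
  + by apply: sm2_add; exact: sm2_mul.
  + by apply: sm2_add; exact: sm2_mul.
  + by move=> y; exact: derM.
  + by move=> x; exact: derM.
- move=> h g sh Pg [cg [gx [gy [Qx Qy eX eY]]]].
  have [h' sh' dh] := smooth1_der sh; split.
    move=> p; apply: continuous_comp; [exact: cg|exact: smooth1_continuous].
  exists (fun p => h' (g p) * gx p), (fun p => h' (g p) * gy p); split.
  + by apply: sm2_mul => //; exact: sm2_comp.
  + by apply: sm2_mul => //; exact: sm2_comp.
  + by move=> y; exact: der_comp.
  + by move=> x; exact: der_comp.
Qed.

Lemma smooth2_fst (h : R -> R) : smooth1 h -> smooth2 (fun p => h p.1).
Proof. by move=> ?; apply/sm2_smooth2/sm2_fst. Qed.
Lemma smooth2_snd (h : R -> R) : smooth1 h -> smooth2 (fun p => h p.2).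
Proof. by move=> ?; apply/sm2_smooth2/sm2_snd. Qed.
Lemma smooth2D f g : smooth2 f -> smooth2 g -> smooth2 (fun p => f p + g p).
Proof. by move=> *; apply/sm2_smooth2/sm2_add; exact/sm2_incl. Qed.
Lemma smooth2M f g : smooth2 f -> smooth2 g -> smooth2 (fun p => f p * g p).
Proof. by move=> *; apply/sm2_smooth2/sm2_mul; exact/sm2_incl. Qed.
Lemma smooth2_comp (h : R -> R) g : smooth1 h -> smooth2 g -> smooth2 (fun p => h (g p)).
Proof. by move=> *; apply/sm2_smooth2/sm2_comp => //; exact/sm2_incl. Qed.

Lemma derxM f g f' g' : derx f f' -> derx g g' ->
  derx (fun p => f p * g p) (fun p => f' p * g p + f p * g' p).
Proof. by move=> h1 h2 y; exact: derM. Qed.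
Lemma deryM f g f' g' : dery f f' -> dery g g' ->
  dery (fun p => f p * g p) (fun p => f' p * g p + f p * g' p).
Proof. by move=> h1 h2 y; exact: derM. Qed.

Lemma dx_eq0 f p : (\near p, f p = 0) -> dx f p = 0.
Proof.
move=> h; rewrite /dx (@near_eq_derive _ _ _ (f : R * R -> R^o) (cst 0)) ?derive_cst//.
Qed.

Lemma dy_eq0 f p : (\near p, f p = 0) -> dy f p = 0.
Proof.
move=> h; rewrite /dy (@near_eq_derive _ _ _ (f : R * R -> R^o) (cst 0)) ?derive_cst//.
Qed.

Lemma supp_dx f : [set p | dx f p != 0] `<=` closure [set p | f p != 0].
Proof.
move=> p /= h; apply: contrapT => np; move/eqP: h; apply; apply: dx_eq0.
have : nbhs p (~` closure [set p | f p != 0]).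
  by apply: open_nbhs_nbhs; split => //; apply: closed_openC; exact: closed_closure.
apply: filterS => q /= nq; apply: contrapT => /eqP fq.
by apply: nq; apply: subset_closure.
Qed.

Lemma supp_dy f : [set p | dy f p != 0] `<=` closure [set p | f p != 0].
Proof.
move=> p /= h; apply: contrapT => np; move/eqP: h; apply; apply: dy_eq0.
have : nbhs p (~` closure [set p | f p != 0]).
  by apply: open_nbhs_nbhs; split => //; apply: closed_openC; exact: closed_closure.
apply: filterS => q /= nq; apply: contrapT => /eqP fq.
by apply: nq; apply: subset_closure.
Qed.

Lemma test_functionW (D : set (R * R)) f g : smooth2 g ->
  [set p | g p != 0] `<=` closure [set p | f p != 0] ->
  test_function D f -> test_function D g.
Proof.
move=> sg gf [_ cf fD].
have gf' : closure [set p | g p != 0] `<=` closure [set p | f p != 0].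
  rewrite [X in _ `<=` X](closure_id _).1; last exact: closed_closure.
  exact: closure_subset.
split => //; last exact: subset_trans fD.
by apply: subclosed_compact gf' => //; exact: closed_closure.
Qed.

Lemma test_dx (D : set (R * R)) f : test_function D f -> test_function D (dx f).
Proof.
move=> tf; apply: test_functionW (tf); last exact: supp_dx.
by case: tf => sf _ _; exact: smooth2_dx.
Qed.

Lemma test_dy (D : set (R * R)) f : test_function D f -> test_function D (dy f).
Proof.
move=> tf; apply: test_functionW (tf); last exact: supp_dy.
by case: tf => sf _ _; exact: smooth2_dy.
Qed.

Lemma test_eq0 (D : set (R * R)) f p : test_function D f -> ~ interior D p -> f p = 0.
Proof.
case=> _ _ h nD; apply: contrapT => /eqP fp; apply: nD; apply: h.
exact: subset_closure.
Qed.

End Smooth2.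

(** * A smooth step function and its derivatives *)

Section Step.
Context {R : realType}.

(** The functions [x^-j exp (- 1 / x)], extended by zero to the left. The powers are there because
    differentiation maps this family into its own linear span. *)
Definition flat (j : nat) (x : R) : R :=
  if 0 < x then x^-1 ^+ j * expR (- x^-1) else 0.

Lemma flat_ge0 j x : 0 <= flat j x.
Proof.
rewrite /flat; case: ifPn => // x0.
by rewrite mulr_ge0 ?expR_ge0// exprn_ge0// invr_ge0 ltW.
Qed.

(** From [exp t >= t^(j+2) / (j+2)!] at [t = 1 / x]. Since [flat j x / x] is [flat j.+1 x], this is
    the decay of the difference quotient of [flat j] at [0]. *)
Lemma flat_le j (x : R) : 0 < x -> flat j.+1 x <= (j.+2)`!%:R * x.
Proof.
move=> x0; rewrite /flat x0.
have ix0 : 0 < x^-1 by rewrite invr_gt0.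
have := expR_ge1Dxn j.+1 (ltW ix0); set E := expR _; set F := (_`!%:R) => h.
have F0 : 0 < F by rewrite ltr0n fact_gt0.
have E0 : 0 < E by exact: expR_gt0.
have hE : x^-1 ^+ j.+2 <= E * F.
  rewrite -ler_pdivrMr//; apply: le_trans h; rewrite lerDr//.
rewrite expRN -/E ler_pdivrMr// [leRHS]mulrC mulrA.
by rewrite -ler_pdivrMr// -exprSr.
Qed.

Lemma flat_der j : der (flat j) (fun x => flat j.+2 x - j%:R * flat j.+1 x).
Proof.
move=> x; have [x0|x0|<-] := ltgtP 0 x.
- have xn : x != 0 by rewrite gt_eqF.
  have d : is_derive x 1 (fun x : R => x^-1 ^+ j * expR (- x^-1))
     (flat j.+2 x - j%:R * flat j.+1 x).
    have dV : is_derive x 1 (fun x : R => x^-1) (- x ^- 2).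
      have := @is_deriveV R (fun x => x) x _ 1 xn (is_derive_id _ _).
      by rewrite /GRing.scale /= mulr1.
    have dX := @is_deriveX _ _ _ j x 1 _ dV.
    have dE := @is_derive1_comp R expR (fun x => - x^-1) x _ _ (is_derive_expR (- x^-1)) (is_deriveN dV).
    have dM := @is_deriveM _ _ _ _ x 1 _ _ dX dE.
    rewrite (_ : (fun x : R => x^-1 ^+ j * expR (- x^-1)) =
      (fun x : R => x^-1) ^+ j * (expR \o (fun x : R => - x^-1))); last first.
      by apply/funext => y; rewrite !fctE.
    apply: is_derive_eq dM _; rewrite exprfctE /flat x0 /= /GRing.scale /= !opprK -!exprVn.
    move: (expR _) => E; case: j {dX dE} => [|j].
      by rewrite expr0 mulr0n mul0r; ring.
    by rewrite -pred_Sn -mulr_natl !exprS; ring.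
  apply: near_eq_is_derive d; near=> y; rewrite /flat ifT//; near: y.
  exact: lt_nbhsr.
- rewrite /flat ltNge (ltW x0)/= mulr0 subr0.
  apply: near_eq_is_derive (der_cst 0 x).
  near=> y; rewrite /= /flat ifF//; apply/negbTE; rewrite -leNgt ltW//; near: y.
  exact: lt_nbhsl.
- rewrite /flat ltxx mulr0 subr0.
  suff h : h^-1 *: ((flat j \o shift 0) (h *: (1 : R^o)) - flat j 0) @[h --> 0^'] --> (0 : R).
    split; first by apply/cvg_ex; exists 0.
    exact/cvg_lim.
  apply/norm_cvg0P.
  apply: (@squeeze_cvgr _ _ _ _ (cst 0) (fun h => (j.+2)`!%:R * `|h|)).
  + near=> h; rewrite /= normr_ge0 /= addr0 /GRing.scale/= mulr1.
    rewrite [flat j 0]/flat ltxx subr0.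
    have [h0|h0] := ltP 0 h; last first.
      by rewrite /flat ltNge h0 /= mulr0 normr0 mulr_ge0.
    rewrite (gtr0_norm h0); apply: le_trans (flat_le j h0).
    rewrite ger0_norm; last by apply: mulr_ge0; [rewrite invr_ge0 ltW|exact: flat_ge0].
    by rewrite /flat h0 exprS mulrA.
  + exact: cvg_cst.
  + rewrite -[X in _ --> X](mulr0 (j.+2)`!%:R).
    apply: cvgM; first exact: cvg_cst.
    rewrite -[X in _ --> X](normr0 R); apply: cvg_norm.
    exact: nbhs_dnbhs.
Unshelve. all: by end_near. Qed.

Lemma smooth1_flat j : smooth1 (flat j).
Proof.
pose P (f : R -> R) := exists n (c : nat -> R), f = (fun x => \sum_(i < n) c i * flat i x).
apply: (@smooth1_coind _ P); last first.
  exists j.+1, (fun i => (i == j)%:R); apply/funext => x.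
  rewrite big_ord_recr /= eqxx mul1r big1 ?add0r// => i _.
  by rewrite (ltn_eqF (ltn_ord i)) mul0r.
have PD f g : P f -> P g -> P (fun x => f x + g x).
  move=> [n [c ->]] [m [d ->]]; exists (n + m)%N.
  exists (fun i => (if (i < n)%N then c i else 0) + (if (i < m)%N then d i else 0)).
  apply/funext => x.
  under [RHS]eq_bigr do rewrite mulrDl.
  rewrite big_split /=; congr (_ + _).
    rewrite big_split_ord /= [X in _ + X]big1 ?addr0; last first.
      by move=> i _; rewrite ltnNge leq_addr /= mul0r.
    by apply: eq_bigr => i _; rewrite ltn_ord.
  rewrite -(big_mkord xpredT (fun i => (if (i < m)%N then d i else 0) * flat i x)).
  rewrite addnC (@big_cat_nat _ _ _ m) ?leq_addr//= [X in _ + X]big_nat_cond.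
  rewrite [X in _ + X]big1 ?addr0; last first.
    by move=> i /andP[/andP[mi _] _]; rewrite ltnNge mi /= mul0r.
  by rewrite big_mkord; apply: eq_bigr => i _; rewrite ltn_ord.
have P1 i (c : R) : P (fun x => c * flat i x).
  exists i.+1, (fun k => c * (k == i)%:R); apply/funext => x.
  rewrite big_ord_recr /= eqxx mulr1 big1 ?add0r// => k _.
  by rewrite (ltn_eqF (ltn_ord k)) mulr0 mul0r.
move=> _ [n [c ->]].
elim: n => [|n [g Pg dg]].
  exists (fun=> 0); first by exists 0, c; apply/funext => x; rewrite big_ord0.
  by apply: der_eql (der_cst 0) _ => x; rewrite big_ord0.
exists (fun x => g x + (c n * flat n.+2 x + (- c n * n%:R) * flat n.+1 x)).
  by apply: (PD) => //; apply: PD; exact: P1.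
apply: der_eql; last by move=> x; rewrite big_ord_recr.
apply: derD => //; apply: der_eq (derZ _ (flat_der n)) _ => x.
by rewrite mulrBr mulNr mulrA mulNr.
Qed.

(** A step from [0] for [x <= 0] to [1] for [x >= 1]; all cutoffs below are built from it by affine
    changes of variable. *)
Definition rho (x : R) : R := flat 0 x / (flat 0 x + flat 0 (1 - x)).

Lemma flat0_gt0 (x : R) : 0 < x -> 0 < flat 0 x.
Proof. by move=> x0; rewrite /flat x0 expr0 mul1r expR_gt0. Qed.

Lemma rho_den (x : R) : 0 < flat 0 x + flat 0 (1 - x).
Proof.
have [x0|x0] := ltP 0 x.
  by rewrite ltr_pwDl ?flat0_gt0 ?flat_ge0.
by rewrite ltr_wpDl ?flat_ge0// flat0_gt0// subr_gt0 (le_lt_trans x0).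
Qed.

Lemma rho_ge0 x : 0 <= rho x.
Proof. by rewrite divr_ge0 ?flat_ge0// ltW// rho_den. Qed.

Lemma rho_le1 x : rho x <= 1.
Proof. by rewrite ler_pdivrMr ?rho_den// mul1r lerDl flat_ge0. Qed.

Lemma rho0 x : x <= 0 -> rho x = 0.
Proof. by move=> x0; rewrite /rho {1}/flat ltNge x0 /= mul0r. Qed.

Lemma rho1 x : 1 <= x -> rho x = 1.
Proof.
move=> x1; rewrite /rho [flat 0 (1 - x)]/flat subr_gt0 ltNge x1 /= addr0 divff//.
by rewrite gt_eqF// flat0_gt0// (lt_le_trans ltr01).
Qed.

Lemma smooth1_rho : smooth1 rho.
Proof.
apply: smooth1M; first exact: smooth1_flat.
apply: smooth1V => [|x]; last by rewrite gt_eqF// rho_den.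
apply: smooth1D; first exact: smooth1_flat.
apply: (@smooth1_comp _ (flat 0)); first exact: smooth1_flat.
by apply: smooth1B; [exact: smooth1_cst|exact: smooth1_id].
Qed.

Definition drho : R -> R := derive1 rho.
Definition ddrho : R -> R := derive1 drho.

Lemma rho_der : der rho drho.
Proof.
by have [f _ h] := smooth1_der smooth1_rho; rewrite /drho (derE h).
Qed.

Lemma smooth1_drho : smooth1 drho.
Proof.
by have [f sf h] := smooth1_der smooth1_rho; rewrite /drho (derE h).
Qed.

Lemma drho_der : der drho ddrho.
Proof.
by have [f _ h] := smooth1_der smooth1_drho; rewrite /ddrho (derE h).
Qed.

Lemma smooth1_ddrho : smooth1 ddrho.
Proof.
by have [f sf h] := smooth1_der smooth1_drho; rewrite /ddrho (derE h).
Qed.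

Lemma near_cst_der (f g : R -> R) (c x : R) : der f g ->
  (\near x, f x = c) -> g x = 0.
Proof.
move=> /derE <- h; rewrite derive1E.
by rewrite (@near_eq_derive _ _ _ f (cst c)) ?derive_cst//.
Qed.

Lemma drho0 x : (x < 0) || (1 < x) -> drho x = 0.
Proof.
move=> /orP[x0|x1].
  apply: (near_cst_der (c := 0) rho_der); near=> y; apply: rho0; apply/ltW; near: y.
  exact: lt_nbhsl.
apply: (near_cst_der (c := 1) rho_der); near=> y; apply: rho1; apply/ltW; near: y.
exact: lt_nbhsr.
Unshelve. all: by end_near. Qed.

Lemma ddrho0 x : (x < 0) || (1 < x) -> ddrho x = 0.
Proof.
move=> /orP[x0|x1].
  apply: (near_cst_der (c := 0) drho_der); near=> y; apply: drho0; apply/orP; left; near: y.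
  exact: lt_nbhsl.
apply: (near_cst_der (c := 0) drho_der); near=> y; apply: drho0; apply/orP; right; near: y.
exact: lt_nbhsr.
Unshelve. all: by end_near. Qed.

Lemma cont_bound (f : R -> R) (a b : R) : continuous f ->
  exists2 C, 0 <= C & forall x, a <= x <= b -> `|f x| <= C.
Proof.
move=> cf; have [ab|ba] := leP a b; last first.
  by exists 0 => // x /andP[ax xb]; have := le_trans ax xb; rewrite leNgt ba.
have [|c _ H] := @EVT_max R (fun x => `|f x|) a b ab.
  apply: continuous_subspaceT => x.
  by apply: continuous_comp; [exact: cf|exact: norm_continuous].
by exists `|f c| => // x xab; apply: H; rewrite in_itv.
Qed.

Lemma rho_bound : exists2 C, 1 <= C &
  forall x : R, [/\ `|rho x| <= C, `|drho x| <= C & `|ddrho x| <= C].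
Proof.
have [C1 C10 H1] := cont_bound 0 1 (smooth1_continuous smooth1_drho).
have [C2 C20 H2] := cont_bound 0 1 (smooth1_continuous smooth1_ddrho).
exists (1 + C1 + C2); first by rewrite -addrA lerDl addr_ge0.
move=> x; split.
- by rewrite ger0_norm ?rho_ge0// (le_trans (rho_le1 _))// -addrA lerDl addr_ge0.
- have [/drho0->|] := boolP ((x < 0) || (1 < x)).
    by rewrite normr0 -addrA addr_ge0// addr_ge0.
  rewrite negb_or -!leNgt => /H1 h; apply: le_trans h _.
  by rewrite addrAC lerDr addr_ge0.
- have [/ddrho0->|] := boolP ((x < 0) || (1 < x)).
    by rewrite normr0 -addrA addr_ge0// addr_ge0.
  rewrite negb_or -!leNgt => /H2 h; apply: le_trans h _.
  by rewrite lerDr addr_ge0.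
Qed.

End Step.

(** * Integrals over segments and Fourier series *)

(** An unoriented integral: it is [0] for [b < a], whence the hypotheses [a <= b] in what
    follows. *)
Definition cint {R : realType} (a b : R) (f : R -> R) : R :=
  \int[@lebesgue_measure R]_(x in `[a, b]) f x.

Section Cont.
Context {R : realType}.
Implicit Types (a b c : R) (f g F G : R -> R).

Lemma contD f g : continuous f -> continuous g -> continuous (fun x => f x + g x).
Proof. by move=> cf cg x; apply: cvgD; [exact: cf|exact: cg]. Qed.
Lemma contM f g : continuous f -> continuous g -> continuous (fun x => f x * g x).
Proof. by move=> cf cg x; apply: cvgM; [exact: cf|exact: cg]. Qed.
Lemma cont_cst (c : R) : continuous (fun _ : R => c).
Proof. by move=> x; exact: cvg_cst. Qed.
Lemma contN f : continuous f -> continuous (fun x => - f x).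
Proof. by move=> cf x; apply: cvgN; exact: cf. Qed.
Lemma contB f g : continuous f -> continuous g -> continuous (fun x => f x - g x).
Proof. by move=> cf cg; apply: contD => //; exact: contN. Qed.
Lemma contX f n : continuous f -> continuous (fun x => f x ^+ n).
Proof.
move=> cf; elim: n => [|n IH]; first exact: cont_cst.
by under eq_fun do rewrite exprS; exact: contM.
Qed.
Lemma cont_norm f : continuous f -> continuous (fun x => `|f x|).
Proof. by move=> cf x; apply: cvg_norm; exact: cf. Qed.
Lemma cont_sum n (f : 'I_n -> R -> R) :
  (forall i, continuous (f i)) -> continuous (fun x => \sum_i f i x).
Proof.
elim: n f => [|n IH] f cf.
  by under eq_fun do rewrite big_ord0; exact: cont_cst.
by under eq_fun do rewrite big_ord_recr; apply: contD => //; apply: IH.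
Qed.

Lemma cont_id : continuous (fun x : R => x).
Proof. by move=> x; exact: cvg_id. Qed.

Lemma der_sinM (a : R) : der (fun y => sin (a * y)) (fun y => a * cos (a * y)).
Proof.
apply: der_eq (der_comp der_sin (derZ a der_id)) _ => y.
by rewrite mulr1 mulrC.
Qed.

Lemma der_cosM (a : R) : der (fun y => cos (a * y)) (fun y => - (a * sin (a * y))).
Proof.
apply: der_eq (der_comp der_cos (derZ a der_id)) _ => y.
by rewrite mulr1 mulrC mulrN.
Qed.

Lemma cont_sinM (a : R) : continuous (fun y => sin (a * y)).
Proof. exact: der_continuous (der_sinM a). Qed.
Lemma cont_cosM (a : R) : continuous (fun y => cos (a * y)).
Proof. exact: der_continuous (der_cosM a). Qed.

End Cont.

Ltac cont :=
  cbv beta; lazymatch goal with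
  | |- continuous ?h =>
    lazymatch h with
    | (fun x => x) => exact: cont_id
    | (fun x => @?f x + @?g x) => apply: (@contD _ f g); [cont|cont]
    | (fun x => @?f x * @?g x) => apply: (@contM _ f g); [cont|cont]
    | (fun x => - @?f x) => apply: (@contN _ f); cont
    | (fun x => @?f x ^+ ?n) => apply: (@contX _ f n); cont
    | (fun x => `|@?f x|) => apply: (@cont_norm _ f); cont
    | (fun x => sin (?a * x)) => exact: (@cont_sinM _ a)
    | (fun x => cos (?a * x)) => exact: (@cont_cosM _ a)
    | _ => first [exact: cont_cst | assumption | solve [auto]]
    end
  end.

Section Cint.
Context {R : realType}.
Implicit Types (a b c : R) (f g F G : R -> R).
Local Notation leb := (@lebesgue_measure R).

Lemma cont_int a b f : continuous f -> leb.-integrable `[a, b] (EFin \o f).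
Proof.
move=> cf; apply: continuous_compact_integrable; first exact: segment_compact.
exact: continuous_subspaceT.
Qed.
Hint Resolve cont_int : core.

Lemma eq_cint a b f g : (forall x, a <= x <= b -> f x = g x) -> cint a b f = cint a b g.
Proof.
by move=> fg; apply: eq_Rintegral => x; rewrite inE /= in_itv /= => /fg.
Qed.

Lemma cintD a b f g : continuous f -> continuous g ->
  cint a b (fun x => f x + g x) = cint a b f + cint a b g.
Proof. by move=> cf cg; rewrite /cint RintegralD //; exact: cont_int. Qed.

Lemma cintB a b f g : continuous f -> continuous g ->
  cint a b (fun x => f x - g x) = cint a b f - cint a b g.
Proof. by move=> cf cg; rewrite /cint RintegralB //; exact: cont_int. Qed.

Lemma cintZ a b (c : R) f : continuous f ->
  cint a b (fun x => c * f x) = c * cint a b f.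
Proof. by move=> cf; rewrite /cint RintegralZl //; exact: cont_int. Qed.

Lemma cint0 a b : cint a b (fun=> 0) = 0.
Proof. by rewrite /cint Rintegral_cst // mul0r. Qed.

Lemma cint_sum a b n (f : 'I_n -> R -> R) : (forall i, continuous (f i)) ->
  cint a b (fun x => \sum_i f i x) = \sum_i cint a b (f i).
Proof.
elim: n f => [|n IH] f cf.
  by rewrite big_ord0 -[RHS](cint0 a b); apply: eq_cint => x _; rewrite big_ord0.
rewrite big_ord_recr /= -IH// -cintD//; last exact: cont_sum.
by apply: eq_cint => x _; rewrite big_ord_recr.
Qed.

Lemma cint_le a b f g : continuous f -> continuous g ->
  (forall x, a <= x <= b -> f x <= g x) -> cint a b f <= cint a b g.
Proof.
move=> cf cg fg; apply: le_Rintegral => //; do ?exact: cont_int.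
Qed.

Lemma cint_ge0 a b f : (forall x, a <= x <= b -> 0 <= f x) -> 0 <= cint a b f.
Proof. by move=> f0; apply: Rintegral_ge0 => x; rewrite /= in_itv /= => /f0. Qed.

Lemma cint_der a b F f : a <= b -> der F f -> continuous f -> cint a b f = F b - F a.
Proof.
rewrite le_eqVlt => /predU1P[<- _ _|ab dF cf].
  by rewrite /cint set_itv1 Rintegral_set1 subrr.
rewrite /cint /Rintegral (@continuous_FTC2 R f F a b) //.
- exact: continuous_subspaceT.
- split.
  + by move=> x _; exact: (der_derivable dF).
  + by apply: cvg_at_right_filter; exact: (der_continuous dF).
  + by apply: cvg_at_left_filter; exact: (der_continuous dF).
- by move=> x _; rewrite (derE dF).
Qed.

Lemma cint_cat b a c f : continuous f -> a <= b -> b <= c ->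
  cint a c f = cint a b f + cint b c f.
Proof.
move=> cf ab bc; apply/eqP; rewrite addrC -subr_eq; apply/eqP.
rewrite {1 2}/cint Rintegral_itvB //.
- by apply: Rintegral_itv_obnd_cbnd; apply: integrableS (cont_int b c cf) => //; exact: subset_itv_oc_cc.
- exact: cont_int.
Qed.

Lemma cint_cst a b (k : R) : a <= b -> cint a b (fun=> k) = k * (b - a).
Proof.
move=> ab; rewrite (@cint_der _ _ (fun x => k * x)) ?mulrBr//; last exact: cont_cst.
by apply: der_eq (derZ k der_id) _ => x; rewrite mulr1.
Qed.

(** As [cint a x f] is no primitive to the left of [a], the integral is based at a point [N] to the
    left of both [a] and [x]; the difference [F N x] does not depend on that choice. *)
Lemma primitive_exists f a : continuous f -> exists2 F, der F f & F a = 0.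
Proof.
move=> cf.
pose F N x := cint N x f - cint N a f.
have FE N M x : N <= M -> M <= a -> M <= x -> F M x = F N x.
  move=> NM Ma Mx; rewrite /F (cint_cat cf NM Mx) (cint_cat cf NM Ma).
  ring.
pose N0 x := Num.min x a - 1.
have N0a x : N0 x <= a by rewrite /N0; case: (leP x a); lra.
exists (fun x => F (N0 x) x); last by rewrite /F subrr.
move=> x.
(* For [x - 1 < y] this base lies to the left of [N0 y], so a single base serves in a neighbourhood
   of [x]. *)
pose N := Num.min x a - 2.
have dN : is_derive x 1 (F N) (f x).
  have Nx : N < x by rewrite /N; case: (leP x a); lra.
  have x1 : x < x + 1 by rewrite ltrDl.
  have [d1 d2] := continuous_FTC1_closed x1 (cont_int N (x + 1) cf) Nx (cf x).
  have e : is_derive x 1 (fun x => cint N x f) (f x).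
    by split; [exact: d1|rewrite -derive1E].
  by have := is_deriveB e (is_derive_cst (cint N a f) x (1 : R)); rewrite subr0.
apply: near_eq_is_derive dN; near=> y.
have xy : x - 1 < y by near: y; apply: lt_nbhsr; lra.
symmetry; apply: FE => //; rewrite /N /N0; case: (leP y a); case: (leP x a); lra.
Unshelve. all: by end_near. Qed.

Lemma cint_ibp a b F G f g : a <= b -> der F f -> der G g ->
  continuous f -> continuous g ->
  cint a b (fun x => f x * G x) = F b * G b - F a * G a - cint a b (fun x => F x * g x).
Proof.
move=> ab dF dG cf cg.
have cF := der_continuous dF; have cG := der_continuous dG.
rewrite -(cint_der ab (derM dF dG)); last by apply: contD; exact: contM.
rewrite cintD ?addrK //; exact: contM.
Qed.

Lemma cint_CS a b f g : a <= b -> continuous f -> continuous g ->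
  cint a b (fun x => f x * g x) ^+ 2 <= cint a b (fun x => f x ^+ 2) * cint a b (fun x => g x ^+ 2).
Proof.
move=> ab cf cg.
set A := cint a b (fun x => f x ^+ 2); set B := cint a b (fun x => g x ^+ 2).
set C := cint _ _ _.
have cf2 := contX (n:=2) cf; have cg2 := contX (n:=2) cg; have cfg := contM cf cg.
have H s t : 0 <= s ^+ 2 * A + 2 * s * t * C + t ^+ 2 * B.
  rewrite /A /B /C -!cintZ// -!cintD; try cont.
  by apply: cint_ge0 => x _; rewrite (_ : _ + _ = (s * f x + t * g x) ^+ 2) ?sqr_ge0//; ring.
have A0 : 0 <= A by apply: cint_ge0 => x _; exact: sqr_ge0.
have B0 : 0 <= B by apply: cint_ge0 => x _; exact: sqr_ge0.
(* The form at [(- C, A)] equals [A (A B - C^2)]. If [A = 0], a nonzero [C] would let it take the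
   value [- B - 2]. *)
have [A1|A1] := ltP 0 A.
  have := H (- C) A; have -> : (- C) ^+ 2 * A + 2 * (- C) * A * C + A ^+ 2 * B = A * (A * B - C ^+ 2) by ring.
  by rewrite pmulr_rge0// subr_ge0.
have {}A1 : A = 0 by apply/eqP; rewrite eq_le A1.
have [C0|C0] := eqVneq C 0; first by rewrite C0 expr0n mulr_ge0.
have := H (- (B + 1) / C) 1; rewrite A1 mulr0 add0r mulr1 expr1n mul1r.
by have -> : 2 * (- (B + 1) / C) * C + B = - B - 2 by [field]; lra.
Qed.

(** Mean value theorem for [G - F]. Derivatives are asked for on the segment only, which admits
    functions with poles outside it, such as the cotangent in [wirtinger]. *)
Lemma der_le_in a b F G f g : a <= b ->
  (forall x, a <= x <= b -> is_derive x 1 F (f x)) ->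
  (forall x, a <= x <= b -> is_derive x 1 G (g x)) ->
  (forall x, a <= x <= b -> f x <= g x) -> F b - F a <= G b - G a.
Proof.
rewrite le_eqVlt => /predU1P[<- *|ab dF dG fg]; first by rewrite !subrr.
have dH x : a <= x <= b -> is_derive x 1 (fun x => G x - F x) (g x - f x).
  by move=> xab; exact: is_deriveB (dG x xab) (dF x xab).
have [||c] := @MVT R (fun x => G x - F x) (fun x => g x - f x) a b ab.
- by move=> x; rewrite in_itv /= => /andP[ax xb]; apply: dH; rewrite !ltW.
- apply: derivable_within_continuous => x; rewrite in_itv /= => xab.
  by case: (dH x xab).
rewrite in_itv /= => /andP[ac cb] e.
suff : 0 <= (g c - f c) * (b - a) by rewrite -e; lra.
by rewrite mulr_ge0 ?subr_ge0 ?fg ?(ltW ac) ?(ltW cb) ?(ltW ab).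
Qed.

Lemma der_le a b F G f g : a <= b -> der F f -> der G g ->
  (forall x, a <= x <= b -> f x <= g x) -> F b - F a <= G b - G a.
Proof. by move=> ab dF dG; apply: der_le_in ab _ _ => x _. Qed.

End Cint.

(** * Orthogonal systems on a segment and Bessel's inequality *)

Section Orthogonal.
Context {R : realType}.
Variables (L : R) (K : nat) (e : 'I_K -> R -> R).
Hypothesis ce : forall i, continuous (e i).
Hypothesis gram : forall i j, cint 0 L (fun y => e i y * e j y) = (i == j)%:R * (L / 2).

Lemma cint_mul_comb (A : 'I_K -> R) (f : R -> R) : continuous f ->
  cint 0 L (fun y => f y * \sum_i A i * e i y) = \sum_i A i * cint 0 L (fun y => f y * e i y).
Proof.
move=> cf.
rewrite (eq_cint (g := fun y => \sum_i A i * (f y * e i y))); last first.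
  by move=> y _; rewrite mulr_sumr; apply: eq_bigr => i _; rewrite mulrCA.
rewrite cint_sum; last by move=> i; apply: contM; [exact: cont_cst|exact: contM].
by apply: eq_bigr => i _; rewrite cintZ//; exact: contM.
Qed.

Lemma cont_comb (A : 'I_K -> R) : continuous (fun y => \sum_i A i * e i y).
Proof. by apply: cont_sum => i; apply: contM => //; exact: cont_cst. Qed.

Lemma cint_sqr_comb (A : 'I_K -> R) :
  cint 0 L (fun y => (\sum_i A i * e i y) ^+ 2) = L / 2 * \sum_i A i ^+ 2.
Proof.
under eq_cint do rewrite expr2.
rewrite cint_mul_comb; last exact: cont_comb.
rewrite mulr_sumr; apply: eq_bigr => i _.
under eq_cint do rewrite mulrC.
rewrite cint_mul_comb// (bigD1 i)//= gram eqxx mul1r big1 ?addr0; first by ring.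
by move=> j ji; rewrite gram eq_sym (negbTE ji) mul0r mulr0.
Qed.

Lemma bessel (f : R -> R) : 0 < L -> continuous f ->
  \sum_i cint 0 L (fun y => f y * e i y) ^+ 2 <= L / 2 * cint 0 L (fun y => f y ^+ 2).
Proof.
move=> L0 cf; set b := fun i => cint 0 L (fun y => f y * e i y).
pose P y := \sum_i b i * e i y.
have cP : continuous P by exact: cont_comb.
(* The remainder is multiplied by [L / 2]; its square then integrates to [L / 2 * (L / 2 * I - S)],
   with [I] the square norm of [f] and [S] the sum of the squared coefficients. *)
have : 0 <= cint 0 L (fun y => (L / 2 * f y - P y) ^+ 2).
  by apply: cint_ge0 => y _; exact: sqr_ge0.
have -> : cint 0 L (fun y => (L / 2 * f y - P y) ^+ 2) =
   (L / 2) ^+ 2 * cint 0 L (fun y => f y ^+ 2) - L * cint 0 L (fun y => f y * P y)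
   + cint 0 L (fun y => P y ^+ 2).
  rewrite -!cintZ -?cintB -?cintD; try cont.
  by apply: eq_cint => y _; field.
rewrite cint_sqr_comb cint_mul_comb//.
under eq_bigr do rewrite -/(b _) -expr2.
set S := \sum_i _; set I := cint _ _ _ => h.
have : 0 <= L / 2 * (L / 2 * I - S) by move: h; rewrite /S /b; lra.
by rewrite pmulr_rge0 ?divr_gt0// subr_ge0.
Qed.

End Orthogonal.

(** * Sine series on a segment and Poincare's inequality beyond finitely many modes *)

Section Fourier.
Context {R : realType}.
Variable L : R.
Hypothesis L0 : 0 < L.

Definition kap (k : nat) : R := k.+1%:R * pi / L.

Lemma kap_gt0 k : 0 < kap k.
Proof. by rewrite divr_gt0// mulr_gt0// pi_gt0. Qed.

Lemma sin_npi n : sin (n%:R * pi) = 0 :> R.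
Proof.
elim: n => [|n IH]; first by rewrite mul0r sin0.
by rewrite -natr1 mulrDl mul1r sinDpi IH oppr0.
Qed.

Lemma sin_kapL k : sin (kap k * L) = 0.
Proof. by rewrite /kap mulfVK ?gt_eqF// sin_npi. Qed.

Lemma kap_inj k j : kap k = kap j -> k = j.
Proof.
move=> /(divIf (lt0r_neq0 L0)) /(mulIf (lt0r_neq0 (pi_gt0 R))) /eqP.
by rewrite eqr_nat => /eqP [].
Qed.


Lemma kap_sqr_neq k j : k != j -> kap k ^+ 2 - kap j ^+ 2 != 0.
Proof.
move=> kj; rewrite subr_eq0 eqrXn2 ?ltW ?kap_gt0//.
by apply: contra kj => /eqP /kap_inj ->.
Qed.

(** [kap k ^+ 2 - kap j ^+ 2] times the product of the sines is the derivative of their Wronskian,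
    which vanishes at [0] and [L]. *)
Lemma sin_orth k j : k != j ->
  cint 0 L (fun y => sin (kap k * y) * sin (kap j * y)) = 0.
Proof.
move=> kj; apply: (mulfI (kap_sqr_neq kj)); rewrite mulr0 -cintZ; last by cont.
pose a := kap k; pose b := kap j.
have D := derB (derM (der_sinM a) (derZ b (der_cosM b))) (derM (derZ a (der_cosM a)) (der_sinM b)).
rewrite (eq_cint (g := fun y => a * cos (a * y) * (b * cos (b * y)) + sin (a * y) * (b * - (b * sin (b * y))) - (a * - (a * sin (a * y)) * sin (b * y) + a * cos (a * y) * (b * cos (b * y))))).
  rewrite (cint_der (ltW L0) D); last by cont.
  by rewrite !sin_kapL !mulr0 !sin0 !mul0r !mulr0 !subrr.
by move=> y _; rewrite /a /b; ring.
Qed.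

Lemma cos_orth k j : k != j ->
  cint 0 L (fun y => cos (kap k * y) * cos (kap j * y)) = 0.
Proof.
move=> kj; apply: (mulfI (kap_sqr_neq kj)); rewrite mulr0 -cintZ; last by cont.
pose a := kap k; pose b := kap j.
have D := derB (derM (derZ a (der_sinM a)) (der_cosM b)) (derM (der_cosM a) (derZ b (der_sinM b))).
rewrite (eq_cint (g := fun y => a * (a * cos (a * y)) * cos (b * y) + a * sin (a * y) * - (b * sin (b * y)) - (- (a * sin (a * y)) * (b * sin (b * y)) + cos (a * y) * (b * (b * cos (b * y)))))).
  rewrite (cint_der (ltW L0) D); last by cont.
  by rewrite !sin_kapL !mulr0 !sin0 !mulr0 !mul0r !subrr.
by move=> y _; rewrite /a /b; ring.
Qed.

(** The two integrals have sum [L], and difference [0] because [a (cos^2 - sin^2)] is the derivative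
    of [sin cos]. *)
Lemma sin_cos_norm k :
  cint 0 L (fun y => sin (kap k * y) ^+ 2) = L / 2 /\
  cint 0 L (fun y => cos (kap k * y) ^+ 2) = L / 2.
Proof.
pose a := kap k.
have E1 : cint 0 L (fun y => cos (a * y) ^+ 2) + cint 0 L (fun y => sin (a * y) ^+ 2) = L.
  rewrite -cintD; try cont.
  by under eq_cint do rewrite cos2Dsin2; rewrite cint_cst ?mul1r ?subr0// ltW.
have E2 : cint 0 L (fun y => cos (a * y) ^+ 2) - cint 0 L (fun y => sin (a * y) ^+ 2) = 0.
  apply: (mulfI (lt0r_neq0 (kap_gt0 k))); rewrite mulr0 -/a -cintB -?cintZ; try cont.
  rewrite (eq_cint (g := fun y => a * cos (a * y) * cos (a * y) + sin (a * y) * - (a * sin (a * y)))).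
    rewrite (cint_der (ltW L0) (derM (der_sinM a) (der_cosM a))); last by cont.
    by rewrite sin_kapL !mulr0 !sin0 !mul0r subrr.
  by move=> y _; ring.
by rewrite -/a; split; lra.
Qed.

Lemma sin_gram K (i j : 'I_K) :
  cint 0 L (fun y => sin (kap i * y) * sin (kap j * y)) = (i == j)%:R * (L / 2).
Proof.
have [->|ij] := eqVneq i j; last by rewrite mul0r; exact: sin_orth.
by rewrite mul1r -(sin_cos_norm j).1; apply: eq_cint => y _; rewrite expr2.
Qed.

Lemma cos_gram K (i j : 'I_K) :
  cint 0 L (fun y => cos (kap i * y) * cos (kap j * y)) = (i == j)%:R * (L / 2).
Proof.
have [->|ij] := eqVneq i j; last by rewrite mul0r; exact: cos_orth.
by rewrite mul1r -(sin_cos_norm j).2; apply: eq_cint => y _; rewrite expr2.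
Qed.

(* With [v = mu cot (mu (y - a) + th)] one has [v' = - mu^2 - v^2], so that
   [h'^2 - mu^2 h^2 = (h' - h v)^2 + (h^2 v)']. *)
Lemma wirtinger (a b mu : R) (h h' : R -> R) : a <= b -> 0 < mu -> mu * (b - a) < pi ->
  der h h' -> continuous h' -> h a = 0 -> h b = 0 ->
  0 <= cint a b (fun y => h' y ^+ 2 - mu ^+ 2 * h y ^+ 2).
Proof.
move=> ab mu0 mab dh ch' ha hb.
(* This phase centres the argument: [mu (y - a) + th] stays inside []0, pi[] on [[a, b]], so the
   cotangent has no pole there. *)
pose th := (pi - mu * (b - a)) / 2.
pose z y := mu * y + (th - mu * a).
have dz : der z (fun=> mu).
  by apply: der_eq (derD (derZ mu der_id) (der_cst _)) _ => y; rewrite mulr1 addr0.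
have sz y : a <= y <= b -> 0 < sin (z y).
  move=> /andP[ay yb]; apply: sin_gt0_pi.
  have h1 : 0 <= mu * (y - a) by rewrite mulr_ge0 ?subr_ge0// ltW.
  have h2 : 0 <= mu * (b - y) by rewrite mulr_ge0 ?subr_ge0// ltW.
  by rewrite /z /th; apply/andP; split; lra.
have ch := der_continuous dh.
have [P dP _] := primitive_exists a (contB (contX (n:=2) ch') (contM (@cont_cst R (mu ^+ 2)) (contX (n:=2) ch))).
rewrite (cint_der ab dP); last by cont.
pose F y := h y ^+ 2 * (mu * (cos (z y) / sin (z y))).
have F0 y : h y = 0 -> F y = 0 by move=> e; rewrite /F e expr0n mul0r.
have <- : F b - F a = 0 by rewrite !F0// subrr.
apply: (der_le_in ab (f := fun y => 2 * h y * h' y * (mu * (cos (z y) / sin (z y))) +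
   h y ^+ 2 * (mu * (- mu - mu * (cos (z y) / sin (z y)) ^+ 2))) (g := fun y => h' y ^+ 2 - mu ^+ 2 * h y ^+ 2)).
- move=> y /sz/lt0r_neq0 s0.
  have dV : is_derive y 1 (fun y => (sin (z y))^-1) (- (cos (z y) * mu) / sin (z y) ^+ 2).
    have := @is_deriveV R (fun y => sin (z y)) y _ 1 s0 (der_comp der_sin dz y).
    by rewrite /GRing.scale /= => h1; apply: is_derive_eq h1 _; field.
  have d1 := derM dh dh y.
  have d2 := is_deriveM (is_derive_cst mu y (1:R)) (is_deriveM (der_comp der_cos dz y) dV).
  have := is_deriveM d1 d2; rewrite /F => d3.
  rewrite (_ : (fun y => _) = (fun x : R => h x * h x) * (cst mu * ((fun x => cos (z x)) * (fun y => (sin (z y))^-1)))); last first.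
    by apply/funext => x; rewrite /= !fctE expr2.
  by apply: is_derive_eq d3 _; rewrite !fctE /GRing.scale /=; field.
- by move=> y _; exact: dP.
move=> y _ /=; set v := cos _ / sin _; rewrite -subr_ge0.
rewrite [leRHS](_ : _ = (h' y - h y * (mu * v)) ^+ 2); first exact: sqr_ge0. by ring.
Qed.

(** The nodes cut [[0, L]] into [K + 1] segments of length [L / (K + 1)], each short enough for
    [wirtinger] because [mu L / (K + 1) < pi]. *)
Lemma poincare_nodes K (mu : R) h h' : 0 < mu -> mu * L < K.+1%:R * pi ->
  der h h' -> continuous h' ->
  (forall j, (j <= K.+1)%N -> h (j%:R * L / K.+1%:R) = 0) ->
  0 <= cint 0 L (fun y => h' y ^+ 2 - mu ^+ 2 * h y ^+ 2).
Proof.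
move=> mu0 muL dh ch' h0; have ch := der_continuous dh.
have K0 : 0 < K.+1%:R :> R by [].
pose y j : R := j%:R * L / K.+1%:R.
suff H n : (n <= K.+1)%N -> 0 <= cint 0 (y n) (fun y => h' y ^+ 2 - mu ^+ 2 * h y ^+ 2).
  by have := H K.+1 (leqnn _); rewrite /y mulrAC divff ?mul1r// gt_eqF.
elim: n => [_|n IH nK]; first by rewrite /y !mul0r /cint set_itv1 Rintegral_set1.
have yn : y n <= y n.+1 by rewrite ler_pM2r ?invr_gt0// ler_pM2r// ler_nat.
rewrite (@cint_cat _ (y n)) //; [|by cont|by rewrite /y divr_ge0// mulr_ge0// ltW].
rewrite addr_ge0 ?IH// 1?ltnW//; apply: wirtinger dh ch' _ _ => //; [|exact: h0 (ltnW nK)|exact: h0].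
rewrite /y -mulrBl -mulrBl -natr1 addrAC subrr add0r mul1r mulrA ltr_pdivrMr//.
by rewrite mulrC [ltRHS]mulrC mulrC.
Qed.

(* Some nonzero combination of [f] and the first [K] sines vanishes at the [K] interior nodes,
   so [poincare_nodes] applies to it. *)
Lemma poincare_fourier K (mu : R) (f f' : R -> R) :
  mu = (K%:R + 2^-1) * pi / L -> der f f' -> continuous f' -> f 0 = 0 -> f L = 0 ->
  mu ^+ 2 * cint 0 L (fun y => f y ^+ 2) <=
  cint 0 L (fun y => f' y ^+ 2)
  + mu ^+ 2 * (2 / L * \sum_(k < K) cint 0 L (fun y => f y * sin (kap k * y)) ^+ 2).
Proof.
move=> muE df cf' f0 fL; have cf := der_continuous df.
pose y (j : 'I_K) : R := j.+1%:R * L / K.+1%:R.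
pose A : 'M[R]_(1 + K, K) := col_mx (\row_(j < K) f (y j)) (\matrix_(k < K, j < K) sin (kap k * y j)).
(* [A] has [K + 1] rows, the values of [f] and of the sines at the interior nodes, but only [K]
   columns. A vector of its left kernel provides the coefficients [t] of [f] and [a k] of the
   sines. *)
have : kermx A != 0.
  rewrite kermx_eq0 /row_free; apply: contraTN (rank_leq_col A) => /eqP ->.
  by rewrite -ltnNge add1n.
case/rowV0Pn => v /sub_kermxP vA v0.
pose t := v 0 (lshift K 0); pose a k := v 0 (rshift 1 k).
have nodes (j : 'I_K) : t * f (y j) + \sum_k a k * sin (kap k * y j) = 0.
  have := congr1 (fun M : 'rV_K => M 0 j) vA; rewrite [RHS]mxE mxE big_split_ord /= big_ord1 => H.
  rewrite -[RHS]H; congr (_ + _); first by rewrite col_mxEu mxE.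
  by apply: eq_bigr => k _; rewrite col_mxEd mxE.
have ta : t != 0 \/ exists k, a k != 0.
  have [t0|] := eqVneq t 0; last by left.
  right; apply/existsP; apply: contraNT v0; rewrite negb_exists => /forallP a0.
  apply/eqP/rowP => i; rewrite mxE; case: (split_ordP i) => k ->; first by rewrite ord1.
  by have := a0 k; rewrite negbK => /eqP.
pose b k := cint 0 L (fun y => f y * sin (kap k * y)).
pose F0 := cint 0 L (fun y => f y ^+ 2); pose F1 := cint 0 L (fun y => f' y ^+ 2).
pose S y := \sum_k a k * sin (kap k * y).
pose S' y := \sum_k (a k * kap k) * cos (kap k * y).
have dS : der S S'.
  apply: der_sum => k; apply: der_eq (derZ (a k) (der_sinM (kap k))) _ => x.
  by rewrite mulrA.
have cS := der_continuous dS.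
have cS' : continuous S' by apply: cont_sum => k; cont.
pose h x := t * f x + S x; pose h' x := t * f' x + S' x.
have dh : der h h' by exact: derD (derZ t df) dS.
have ch' : continuous h' by rewrite /h'; cont.
have ch : continuous h by rewrite /h; cont.
have Kp : 0 < K.+1%:R :> R by [].
have mu0 : 0 < mu.
  by rewrite muE divr_gt0// mulr_gt0 ?pi_gt0// ltr_wpDl ?ler0n// invr_gt0.
have Q0 : 0 <= cint 0 L (fun y => h' y ^+ 2 - mu ^+ 2 * h y ^+ 2).
  apply: (poincare_nodes (K := K) mu0 _ dh); [|by cont|].
    rewrite muE mulfVK ?gt_eqF// ltr_pM2r ?pi_gt0// -(natr1 K) ltrD2l.
    by rewrite invf_lt1 ?ltr1n.
  move=> [_|j]; first by rewrite !mul0r /h f0 mulr0 add0r /S big1// => k _; rewrite mulr0 sin0 mulr0.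
  rewrite leq_eqVlt => /predU1P[jK|].
    rewrite jK mulrAC divff ?mul1r ?gt_eqF// /h fL mulr0 add0r /S big1// => k _.
    by rewrite sin_kapL mulr0.
  by rewrite ltnS => jK; exact: (nodes (Ordinal jK)).
have Ih : cint 0 L (fun y => h y ^+ 2) = t ^+ 2 * F0 + 2 * t * (\sum_k a k * b k) + L / 2 * \sum_k a k ^+ 2.
  rewrite -(cint_sqr_comb (fun k : 'I_K => @cont_sinM R (kap k)) (@sin_gram K)).
  rewrite -(cint_mul_comb L (fun k : 'I_K => @cont_sinM R (kap k)) a cf) -!cintZ -?cintD; try cont.
  by apply: eq_cint => y0 _; rewrite /h -/(S y0); ring.
have Ih' : cint 0 L (fun y => h' y ^+ 2) = t ^+ 2 * F1 + 2 * t * (\sum_k a k * kap k ^+ 2 * b k)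
    + L / 2 * \sum_k (a k * kap k) ^+ 2.
  rewrite -(cint_sqr_comb (fun k : 'I_K => @cont_cosM R (kap k)) (@cos_gram K)).
  have -> : \sum_k a k * kap k ^+ 2 * b k = \sum_k a k * kap k * cint 0 L (fun y => f' y * cos (kap k * y)).
    apply: eq_bigr => k _.
    have -> : cint 0 L (fun y => f' y * cos (kap k * y)) = kap k * b k; last by ring.
    rewrite (cint_ibp (ltW L0) df (der_cosM (kap k)))//; last by cont.
    rewrite f0 fL !mul0r subrr sub0r -mulN1r /b -!cintZ; try cont.
    by apply: eq_cint => y0 _; ring.
  rewrite -(cint_mul_comb L (fun k : 'I_K => @cont_cosM R (kap k)) _ cf') -!cintZ -?cintD; try cont.
  by apply: eq_cint => y0 _; rewrite /h' -/(S' y0); ring.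
(* The half integer puts [mu] above every [kap k] with [k < K] and below the [(K + 1) pi / L]
   allowed by [poincare_nodes]. *)
have km k : (k < K)%N -> kap k ^+ 2 < mu ^+ 2.
  move=> kK; rewrite ltrXn2r ?ltW ?kap_gt0//.
  rewrite muE /kap ltr_pM2r ?invr_gt0// ltr_pM2r ?pi_gt0//.
  by apply: le_lt_trans (_ : K%:R < _); rewrite ?ler_nat// ltrDl invr_gt0.
have Q1 : \sum_(k < K) (mu ^+ 2 - kap k ^+ 2) * (2 * t * a k * b k + L / 2 * a k ^+ 2) <= t ^+ 2 * (F1 - mu ^+ 2 * F0).
  move: Q0; rewrite cintB; try cont.
  rewrite cintZ; try cont.
  rewrite Ih Ih' -subr_ge0 => H; rewrite -subr_ge0; apply: le_trans H _.
  rewrite le_eqVlt; apply/orP; left; apply/eqP.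
  have -> : \sum_(k < K) (mu ^+ 2 - kap k ^+ 2) * (2 * t * a k * b k + L / 2 * a k ^+ 2) =
    mu ^+ 2 * (2 * t * \sum_k a k * b k) - 2 * t * (\sum_k a k * kap k ^+ 2 * b k)
    + mu ^+ 2 * (L / 2 * \sum_k a k ^+ 2) - L / 2 * \sum_k (a k * kap k) ^+ 2.
    rewrite !mulr_sumr -!sumrN -!big_split /=; apply: eq_bigr => k _.
    by ring.
  by ring.
(* If [t = 0], then [Q1] bounds by [0] a sum of nonnegative terms of which one is positive: a
   nonzero combination of the sines cannot vanish at all the nodes. *)
have [t0|t0] := eqVneq t 0.
  case: ta => [|[k ak]]; first by rewrite t0 eqxx.
  exfalso; move: Q1; rewrite t0 expr0n mul0r leNgt => /negP; apply.
  rewrite (bigD1 k)//= ltr_wpDr//.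
    apply: sumr_ge0 => j _; rewrite mulr0 !mul0r add0r.
    by rewrite mulr_ge0 ?subr_ge0 ?(ltW (km _ _))// mulr_ge0 ?sqr_ge0// divr_ge0// ltW.
  rewrite mulr0 !mul0r add0r mulr_gt0 ?subr_gt0 ?km// mulr_gt0 ?divr_gt0//.
  by rewrite exprn_even_gt0//= ak.
have t2 : 0 < t ^+ 2 by rewrite exprn_even_gt0.
rewrite -subr_ge0 -(pmulr_rge0 _ t2).
suff : - (t ^+ 2 * (mu ^+ 2 * (2 / L * \sum_(k < K) b k ^+ 2))) <=
    \sum_(k < K) (mu ^+ 2 - kap k ^+ 2) * (2 * t * a k * b k + L / 2 * a k ^+ 2).
  by move=> /le_trans /(_ Q1); rewrite /F0 /F1 /b; lra.
rewrite !mulr_sumr -sumrN; apply: ler_sum => k _.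
have c0 : 0 <= mu ^+ 2 - kap k ^+ 2 by rewrite subr_ge0 ltW// km.
have Ln : L != 0 by rewrite gt_eqF.
(* Completing the square in [a k] eliminates the unknown coefficients; apart from the wanted term
   only nonnegative ones are left. *)
have -> : (mu ^+ 2 - kap k ^+ 2) * (2 * t * a k * b k + L / 2 * a k ^+ 2) =
  (mu ^+ 2 - kap k ^+ 2) * (L / 2 * (a k + 2 * t * b k / L) ^+ 2)
  + kap k ^+ 2 * (2 / L * (t * b k) ^+ 2) - t ^+ 2 * (mu ^+ 2 * (2 / L * b k ^+ 2)) by field.
rewrite lerDr addr_ge0//; first by rewrite mulr_ge0// mulr_ge0 ?sqr_ge0// divr_ge0// ltW.
by rewrite mulr_ge0 ?sqr_ge0// mulr_ge0 ?sqr_ge0// divr_ge0// ltW.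
Qed.

End Fourier.

(** * Square integrable functions on the plane *)

Section Plane.
Context {R : realType}.
Local Notation RR := (measurableTypeR R * measurableTypeR R)%type.
Local Notation mu := (@lebesgue2 R).
Implicit Types (f g : R * R -> R).

Definition mfun2 (f : R * R -> R) := measurable_fun [set: RR] (f : RR -> R).

Lemma mfun2D f g : mfun2 f -> mfun2 g -> mfun2 (fun p => f p + g p).
Proof. exact: measurable_funD. Qed.
Lemma mfun2B f g : mfun2 f -> mfun2 g -> mfun2 (fun p => f p - g p).
Proof. exact: measurable_funB. Qed.
Lemma mfun2M f g : mfun2 f -> mfun2 g -> mfun2 (fun p => f p * g p).
Proof. exact: measurable_funM. Qed.
Lemma mfun2_cst (c : R) : mfun2 (fun=> c).
Proof. exact: measurable_cst. Qed.
Lemma cont_slice2 f (x : R) : continuous f -> continuous (fun y => f (x, y)).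
Proof. by move=> cf; have [_ /(_ x)] := continuous_curry cf. Qed.

Lemma cont_slice1 f (y : R) : continuous f -> continuous (fun x => f (x, y)).
Proof.
move=> cf x; apply/cvgrPdist_lt => e e0.
have /cvgrPdist_lt /(_ e e0) [[P Q] /= [Px Qy] H] := cf (x, y).
near=> z; apply: (H (z, y)); split => /=; last exact: nbhs_singleton.
by near: z.
Unshelve. all: by end_near. Qed.

(* Replacing the abscissa by [floor (n x) / n] gives measurable functions
   converging to [f]. *)
Lemma cont_mfun2 f : continuous f -> mfun2 f.
Proof.
move=> cf.
pose q (n : nat) (x : R) : R := (Num.floor (x * n.+1%:R))%:~R / n.+1%:R.
pose g n (p : RR) : R := f (q n p.1, p.2).
apply: (@measurable_fun_cvg _ _ _ [set: RR] g f).
  move=> n _ Y mY; rewrite setTI.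
  have -> : g n @^-1` Y = \bigcup_(k in [set: int])
     ((fun x : R => Num.floor (x * n.+1%:R)) @^-1` [set k] `*`
      (fun y => f (k%:~R / n.+1%:R, y)) @^-1` Y).
    apply/seteqP; split => [[x y] /= h|[x y] [k _ [/= xk h]]].
      by exists (Num.floor (x * n.+1%:R)).
    by rewrite /g /q /= xk.
  apply: countable_bigcupT_measurable => [|k]; first exact: countableP.
  apply: measurableX.
    rewrite (_ : _ @^-1` _ = `[k%:~R / n.+1%:R, (k + 1)%:~R / n.+1%:R[%classic); first exact: measurable_itv.
    apply/seteqP; split => x /=; rewrite in_itv /= ler_pdivrMr// ltr_pdivlMr//.
      by move=> <-; exact: floor_itv.
    by move=> h; apply/eqP; rewrite floor_eq.
  have cy := @cont_slice2 f (k%:~R / n.+1%:R) cf.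
  by have := continuous_measurable_fun cy measurableT mY; rewrite setTI.
move=> [x y] _; rewrite /g /=.
suff h1 : (q ^~ x) @ \oo --> x by exact: (cvg_comp _ _ h1 (@cont_slice1 f y cf x)).
apply/cvgrPdist_le => e e0; near=> n.
have n0 : 0 < n.+1%:R :> R by [].
have /andP[h1 h2] := floor_itv (x * n.+1%:R).
rewrite -[X in `|X - _|](mulfK (lt0r_neq0 n0)) /q -mulrBl normrM normfV (gtr0_norm n0).
rewrite ler_pdivrMr// ger0_norm ?subr_ge0//.
apply: (@le_trans _ _ 1); first by move: h2; rewrite intrD; lra.
near: n; exists (Num.truncn e^-1) => // n /= hn.
rewrite mulrC -ler_pdivrMr// div1r ltW//.
apply: lt_le_trans (truncnS_gt _) _; rewrite ler_nat ltnS //.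
Unshelve. all: by end_near. Qed.

Definition sqi (f : R * R -> R) :=
  mfun2 f /\ mu.-integrable setT (EFin \o (fun p => f p ^+ 2)).

Definition ip (f g : R * R -> R) : R := \int[mu]_p (f p * g p).

Lemma intble_le f g : mfun2 f -> mu.-integrable setT (EFin \o g) ->
  (forall p, `|f p| <= g p) -> mu.-integrable setT (EFin \o f).
Proof.
move=> mf ig fg; apply: le_integrable ig => //; first exact/measurable_EFinP.
by move=> p _ /=; rewrite lee_fin (le_trans (fg p))// ler_norm.
Qed.

Lemma intbleD f g : mu.-integrable setT (EFin \o f) -> mu.-integrable setT (EFin \o g) ->
  mu.-integrable setT (EFin \o (fun p => f p + g p)).
Proof. by move=> h1 h2; exact: (integrableD measurableT h1 h2). Qed.

Lemma intbleZ (c : R) f : mu.-integrable setT (EFin \o f) ->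
  mu.-integrable setT (EFin \o (fun p => c * f p)).
Proof. by move=> h1; exact: (integrableZl measurableT c h1). Qed.

Lemma sqi_mul f g : sqi f -> sqi g -> mu.-integrable setT (EFin \o (fun p => f p * g p)).
Proof.
move=> [mf f2] [mg g2]; apply: intble_le (intbleD f2 g2) _; first exact: mfun2M.
move=> p; rewrite ler_norml; apply/andP; split; nra.
Qed.

Lemma sqiZ (c : R) f : sqi f -> sqi (fun p => c * f p).
Proof.
move=> [mf f2]; split; first by apply: mfun2M => //; exact: mfun2_cst.
rewrite (_ : (fun p => _) = (fun p => c ^+ 2 * f p ^+ 2)); last first.
  by apply/funext => p; rewrite exprMn.
exact: intbleZ.
Qed.

Lemma sqiD f g : sqi f -> sqi g -> sqi (fun p => f p + g p).
Proof.
move=> hf hg; have [mf f2] := hf; have [mg g2] := hg; split; first exact: mfun2D.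
rewrite (_ : (fun p => _) = (fun p => (f p ^+ 2 + g p ^+ 2) + 2 * (f p * g p))); last first.
  by apply/funext => p; ring.
by apply: intbleD; [exact: intbleD|apply/intbleZ/sqi_mul].
Qed.

Lemma sqiB f g : sqi f -> sqi g -> sqi (fun p => f p - g p).
Proof.
move=> hf hg; rewrite (_ : (fun p => _) = (fun p => f p + -1 * g p)).
  by apply: sqiD => //; exact: sqiZ.
by apply/funext => p; rewrite mulN1r.
Qed.

Lemma sqi0 : sqi (fun=> 0).
Proof.
split; first exact: mfun2_cst.
rewrite (_ : _ \o _ = cst 0%E); first exact: integrable0.
by apply/funext => p /=; rewrite expr0n.
Qed.

Lemma sqi_sum n (f : 'I_n -> R * R -> R) : (forall i, sqi (f i)) -> sqi (fun p => \sum_i f i p).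
Proof.
elim: n f => [|n IH] f mf.
  by under eq_fun do rewrite big_ord0; exact: sqi0.
by under eq_fun do rewrite big_ord_recr; apply: sqiD => //; apply: IH.
Qed.

Lemma ipC f g : ip f g = ip g f.
Proof. by apply: eq_Rintegral => p _; rewrite mulrC. Qed.

Lemma eq_ip f g f' g' : (forall p, f p * g p = f' p * g' p) -> ip f g = ip f' g'.
Proof. by move=> e; apply: eq_Rintegral => p _. Qed.

Lemma ipDl f g h : sqi f -> sqi g -> sqi h ->
  ip (fun p => f p + g p) h = ip f h + ip g h.
Proof.
move=> hf hg hh; rewrite /ip -RintegralD//; [|exact: sqi_mul..].
by apply: eq_Rintegral => p _; rewrite mulrDl.
Qed.

Lemma ipZl (c : R) f h : sqi f -> sqi h -> ip (fun p => c * f p) h = c * ip f h.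
Proof.
move=> hf hh; rewrite /ip -RintegralZl//; last exact: sqi_mul.
by apply: eq_Rintegral => p _; rewrite mulrA.
Qed.

Lemma ipBl f g h : sqi f -> sqi g -> sqi h ->
  ip (fun p => f p - g p) h = ip f h - ip g h.
Proof.
move=> hf hg hh; rewrite /ip -RintegralB//; [|exact: sqi_mul..].
by apply: eq_Rintegral => p _; rewrite mulrBl.
Qed.

Lemma ipDr f g h : sqi f -> sqi g -> sqi h ->
  ip h (fun p => f p + g p) = ip h f + ip h g.
Proof. by move=> *; rewrite ipC ipDl// ![ip _ h]ipC. Qed.

Lemma ipBr f g h : sqi f -> sqi g -> sqi h ->
  ip h (fun p => f p - g p) = ip h f - ip h g.
Proof. by move=> *; rewrite ipC ipBl// ![ip _ h]ipC. Qed.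

Lemma ipZr (c : R) f h : sqi f -> sqi h -> ip h (fun p => c * f p) = c * ip h f.
Proof. by move=> *; rewrite ipC ipZl// ipC. Qed.

Lemma ip0r h : ip h (fun=> 0) = 0.
Proof.
rewrite /ip (@eq_Rintegral _ _ _ _ _ (fun=> 0)); last by move=> p _; rewrite mulr0.
by rewrite /Rintegral integral0.
Qed.

Lemma ip_sumr n (f : 'I_n -> R * R -> R) h : sqi h -> (forall i, sqi (f i)) ->
  ip h (fun p => \sum_i f i p) = \sum_i ip h (f i).
Proof.
move=> hh; elim: n f => [|n IH] f hf.
  by rewrite big_ord0 -[RHS](ip0r h); apply: eq_ip => p; rewrite big_ord0.
rewrite big_ord_recr /= -IH// -ipDr//; last by apply: sqi_sum.
by apply: eq_ip => p; rewrite big_ord_recr.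
Qed.

Lemma ip_ge0 f : 0 <= ip f f.
Proof. by apply: Rintegral_ge0 => p _; rewrite -expr2 sqr_ge0. Qed.

Lemma ip_CS f g : sqi f -> sqi g -> ip f g ^+ 2 <= ip f f * ip g g.
Proof.
move=> hf hg.
set A := ip f f; set B := ip g g; set C := ip f g.
have H s t : 0 <= s ^+ 2 * A + 2 * s * t * C + t ^+ 2 * B.
  have := ip_ge0 (fun p => s * f p + t * g p).
  rewrite ipDl ?ipDr ?ipZl ?ipZr; try by repeat first [apply: sqiD|apply: sqiZ|assumption].
  rewrite -/A -/B -/C (ipC g f) -/C => h.
  by rewrite (_ : _ + _ = s * (s * A) + s * (t * C) + (t * (s * C) + t * (t * B))) //; ring.
have A0 : 0 <= A by exact: ip_ge0.
have B0 : 0 <= B by exact: ip_ge0.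
have [A1|A1] := ltP 0 A.
  have := H (- C) A; have -> : (- C) ^+ 2 * A + 2 * (- C) * A * C + A ^+ 2 * B = A * (A * B - C ^+ 2) by ring.
  by rewrite pmulr_rge0// subr_ge0.
have {}A1 : A = 0 by apply/eqP; rewrite eq_le A1.
have [C0|C0] := eqVneq C 0; first by rewrite C0 expr0n mulr_ge0.
have := H (- (B + 1) / C) 1; rewrite A1 mulr0 add0r mulr1 expr1n mul1r.
by have -> : 2 * (- (B + 1) / C) * C + B = - B - 2 by [field]; lra.
Qed.

Lemma ip_CS_sqrt f g : sqi f -> sqi g ->
  `|ip f g| <= Num.sqrt (ip f f) * Num.sqrt (ip g g).
Proof.
move=> hf hg; rewrite -sqrtrM ?ip_ge0// -sqrtr_sqr ler_sqrt ?ip_CS//.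
by rewrite mulr_ge0 ?ip_ge0.
Qed.

Lemma sqrt_cvg0 (a : nat -> R) : a @ \oo --> (0 : R) -> (fun n => Num.sqrt (a n)) @ \oo --> (0 : R).
Proof.
move=> h; rewrite -[X in _ --> X](@sqrtr0 R).
by apply: (cvg_comp _ _ h); exact: sqrt_continuous.
Qed.

Lemma ip_cvg0l (f g : nat -> R * R -> R) (B : R) :
  (forall n, sqi (f n)) -> (forall n, sqi (g n)) ->
  (fun n => ip (f n) (f n)) @ \oo --> (0 : R) -> (forall n, ip (g n) (g n) <= B) ->
  (fun n => ip (f n) (g n)) @ \oo --> (0 : R).
Proof.
move=> hf hg h0 hB; apply/norm_cvg0P.
apply: (@squeeze_cvgr _ _ _ _ (cst 0) (fun n => Num.sqrt (ip (f n) (f n)) * Num.sqrt B)).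
- near=> n; rewrite /= normr_ge0 /=; apply: le_trans (ip_CS_sqrt (hf n) (hg n)) _.
  by rewrite ler_wpM2l ?sqrtr_ge0// ler_wsqrtr.
- exact: cvg_cst.
- rewrite -[X in _ --> X](mul0r (Num.sqrt B)); apply: cvgM; last exact: cvg_cst.
  exact: sqrt_cvg0.
Unshelve. all: by end_near. Qed.

Lemma ip_cvgl (f : nat -> R * R -> R) f0 g : (forall n, sqi (f n)) -> sqi f0 -> sqi g ->
  (fun n => ip (fun p => f n p - f0 p) (fun p => f n p - f0 p)) @ \oo --> (0 : R) ->
  (fun n => ip (f n) g) @ \oo --> ip f0 g.
Proof.
move=> hf hf0 hg h; apply: cvg_zero.
rewrite (_ : (fun n => ip (f n) g) - cst (ip f0 g) = (fun n => ip (fun p => f n p - f0 p) g)).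
  apply: (@ip_cvg0l (fun n p => f n p - f0 p) (fun=> g) (ip g g)) => // n.
  exact: sqiB.
by apply/funext => n; rewrite ipBl.
Qed.

(** Writes [<f_n, g_n>] as [<f_n, g0> + <g_n, f0> - <f0, g0> + <f_n - f0, g_n - g0>]; Cauchy-Schwarz
    makes the last term tend to [0]. *)
Lemma ip_cvg (f g : nat -> R * R -> R) f0 g0 :
  (forall n, sqi (f n)) -> sqi f0 -> (forall n, sqi (g n)) -> sqi g0 ->
  (fun n => ip (fun p => f n p - f0 p) (fun p => f n p - f0 p)) @ \oo --> (0 : R) ->
  (fun n => ip (fun p => g n p - g0 p) (fun p => g n p - g0 p)) @ \oo --> (0 : R) ->
  (fun n => ip (f n) (g n)) @ \oo --> ip f0 g0.
Proof.
move=> hf hf0 hg hg0 h1 h2.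
have hf' n : sqi (fun p => f n p - f0 p) by exact: sqiB.
have hg' n : sqi (fun p => g n p - g0 p) by exact: sqiB.
have e1 := ip_cvgl hf hf0 hg0 h1.
have e2 := ip_cvgl hg hg0 hf0 h2.
have e3 : (fun n => ip (fun p => f n p - f0 p) (fun p => g n p - g0 p)) @ \oo --> (0 : R).
  apply/norm_cvg0P.
  apply: (@squeeze_cvgr _ _ _ _ (cst 0) (fun n => Num.sqrt (ip (fun p => f n p - f0 p) (fun p => f n p - f0 p))
     * Num.sqrt (ip (fun p => g n p - g0 p) (fun p => g n p - g0 p)))).
  - by near=> n; rewrite /= normr_ge0 /=; exact: (ip_CS_sqrt (hf' n) (hg' n)).
  - exact: cvg_cst.
  - by rewrite -[X in _ --> X](mul0r 0); apply: cvgM; exact: sqrt_cvg0.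
rewrite (_ : ip f0 g0 = ip f0 g0 + (ip g0 f0 - ip f0 g0) + 0); last by rewrite (ipC g0) subrr !addr0.
rewrite (_ : (fun n => _) = (fun n => ip (f n) g0 + (ip (g n) f0 - ip f0 g0) + ip (fun p => f n p - f0 p) (fun p => g n p - g0 p))).
  by apply: cvgD => //; apply: cvgD => //; apply: cvgB => //; exact: cvg_cst.
apply/funext => n; rewrite ipBl// !ipBr// (ipC (g n) f0); ring.
Unshelve. all: by end_near. Qed.

End Plane.

Section Plane2.
Context {R : realType}.
Local Notation RR := (measurableTypeR R * measurableTypeR R)%type.
Local Notation mu := (@lebesgue2 R).
Local Notation leb := (@lebesgue_measure R).
Implicit Types (f g : R * R -> R).

Definition box (a b c d : R) : set (R * R) := `[a, b]%classic `*` `[c, d]%classic.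

Lemma boxP a b c d p : box a b c d p <-> (a <= p.1 <= b) /\ (c <= p.2 <= d).
Proof. by rewrite /box /= !in_itv. Qed.

Lemma indT (A : set (R * R)) p : A p -> \1_A p = 1 :> R.
Proof. by move=> Ap; rewrite indicE mem_set. Qed.
Lemma indF (A : set (R * R)) p : ~ A p -> \1_A p = 0 :> R.
Proof. by move=> Ap; rewrite indicE memNset. Qed.
Lemma ind_ge0 (A : set (R * R)) p : 0 <= \1_A p :> R.
Proof. by rewrite indicE ler0n. Qed.
Lemma ind_le1 (A : set (R * R)) p : \1_A p <= 1 :> R.
Proof. by rewrite indicE lern1 leq_b1. Qed.

Definition meas2 (A : set (R * R)) := measurable (A : set RR).

Lemma mfun2_ind (A : set (R * R)) : meas2 A -> mfun2 (\1_A : R * R -> R).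
Proof. by move=> mA; exact: measurable_indic. Qed.

Lemma meas2_box a b c d : meas2 (box a b c d).
Proof. by apply: measurableX; exact: measurable_itv. Qed.

Lemma int_ind_box a b c d : mu.-integrable setT (EFin \o (\1_(box a b c d) : R * R -> R)).
Proof.
apply/integrableP; split; first by apply/measurable_EFinP; exact: mfun2_ind (meas2_box _ _ _ _).
under eq_integral do rewrite /= ger0_norm ?ind_ge0//.
rewrite integral_indic//; last exact: meas2_box.
rewrite setIT (_ : mu _ = (leb `[a, b]%classic * leb `[c, d]%classic)%E); last first.
  by apply: product_measure1E; exact: measurable_itv.
by rewrite !lebesgue_measure_itv /=; case: ifP => _; case: ifP => _; rewrite ?mule0 ?mul0e // -!EFinB -EFinM ltry.
Qed.

Definition supp_box (M : R) f := forall p, f p != 0 -> box (- M) M (- M) M p.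

Lemma sqi_bnd (M C : R) f : mfun2 f -> (forall p, `|f p| <= C) -> supp_box M f -> sqi f.
Proof.
move=> mf fC fM; split => //.
apply: intble_le (intbleZ (C ^+ 2) (int_ind_box (- M) M (- M) M)) _.
  by apply: mfun2M.
move=> p; rewrite ger0_norm ?sqr_ge0//.
have [->|fp] := eqVneq (f p) 0.
  by rewrite expr0n /= mulr_ge0 ?sqr_ge0// ind_ge0.
rewrite (indT (fM _ fp)) mulr1 -[leLHS]real_normK ?num_real// lerXn2r ?nnegrE//.
exact: le_trans (fC p).
Qed.

Lemma sqi_int (M : R) f : sqi f -> supp_box M f -> mu.-integrable setT (EFin \o f).
Proof.
move=> [mf f2] fM; apply: intble_le (intbleD f2 (int_ind_box (- M) M (- M) M)) _ => // p.
have [->|fp] := eqVneq (f p) 0; first by rewrite expr0n normr0 add0r ind_ge0.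
rewrite (indT (fM _ fp)); rewrite ler_norml; apply/andP; split; nra.
Qed.

Lemma sqi_mulb (C : R) f g : sqi f -> mfun2 g -> (forall p, f p != 0 -> `|g p| <= C) ->
  sqi (fun p => f p * g p).
Proof.
move=> [mf f2] mg gC; split; first exact: mfun2M.
apply: intble_le (intbleZ (C ^+ 2) f2) _; first by do !apply: mfun2M.
move=> p; rewrite ger0_norm ?sqr_ge0// exprMn mulrC.
have [->|fp] := eqVneq (f p) 0; first by rewrite expr0n !mulr0.
rewrite ler_wpM2r ?sqr_ge0// -[leLHS]real_normK ?num_real// lerXn2r ?nnegrE//.
  exact: le_trans (gC p fp).
exact: gC.
Qed.

(** Dominated convergence with majorant [|C| |v|], integrable because [v] is square integrable with
    bounded support. The [f n] are controlled only where [v] does not vanish. *)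
Lemma dct (M C : R) (v : R * R -> R) (f : nat -> R * R -> R) f0 :
  sqi v -> supp_box M v -> (forall n, mfun2 (f n)) -> mfun2 f0 ->
  (forall n p, v p != 0 -> `|f n p| <= C) ->
  (forall p, v p != 0 -> (fun n => f n p) @ \oo --> f0 p) ->
  (fun n => ip v (f n)) @ \oo --> ip v f0.
Proof.
move=> hv vM mf mf0 fC ff0.
have C0 p : v p != 0 -> 0 <= C by move=> vp; apply: le_trans (fC 0 p vp).
have iv := sqi_int hv vM; have [mv _] := hv.
have [] := @dominated_convergence _ _ _ mu setT measurableT
  (fun n p => (v p * f n p)%:E) (fun p => (v p * f0 p)%:E) (fun p => (`|C| * `|v p|)%:E).
- by move=> n; apply/measurable_EFinP; exact: mfun2M.
- by apply/measurable_EFinP; exact: mfun2M.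
- apply: aeW => p _; apply: cvg_EFin; first exact: nearW.
  rewrite /comp /=.
  have [->|vp] := eqVneq (v p) 0.
    by rewrite mul0r; under eq_fun do rewrite mul0r; exact: cvg_cst.
  by apply: cvgM; [exact: cvg_cst|exact: ff0].
- apply: intbleZ; rewrite (_ : _ \o _ = (fun p => `|(EFin \o v) p|%E)) //; exact: integrable_abse.
- apply: aeW => p n _; rewrite /= lee_fin normrM mulrC.
  have [->|vp] := eqVneq (v p) 0; first by rewrite normr0 !mulr0.
  by rewrite ler_wpM2r// (le_trans (fC n p vp))// ler_norm.
move=> iv0 _ h; apply: fine_cvg; rewrite fineK; last exact: integrable_fin_num.
exact: h.
Qed.

End Plane2.

(** * Fubini and Tonelli for functions on rectangles and strips *)

Section Fub.
Context {R : realType}.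
Local Notation RR := (measurableTypeR R * measurableTypeR R)%type.
Local Notation mu := (@lebesgue2 R).
Local Notation leb := (@lebesgue_measure R).
Implicit Types (f g : R * R -> R).

Lemma cont_bound2 f (a b c d : R) : continuous f ->
  exists2 C, 0 <= C & forall p, box a b c d p -> `|f p| <= C.
Proof.
move=> cf; have [[p bp]|/nonemptyPn bE] := pselect (box a b c d !=set0); last first.
  by exists 0 => // p; rewrite bE.
have [||q _ H] := @compact_EVT_max _ R (fun p => `|f p|) (box a b c d) (ex_intro _ p bp).
- by apply: compact_setX; exact: segment_compact.
- by apply: continuous_subspaceT => q; apply: continuous_comp; [exact: cf|exact: norm_continuous].
by exists `|f q| => // r /mem_set br; exact: H.
Qed.

Lemma intble_box f (a b c d : R) : continuous f ->
  mu.-integrable setT (EFin \o (fun p => \1_(box a b c d) p * f p)).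
Proof.
move=> cf; have [C C0 H] := cont_bound2 a b c d cf.
apply: intble_le (intbleZ C (int_ind_box a b c d)) _.
  by apply: mfun2M; [exact: mfun2_ind (meas2_box _ _ _ _)|exact: cont_mfun2].
move=> p; rewrite normrM ger0_norm ?ind_ge0//.
have [bp|bp] := pselect (box a b c d p); last by rewrite (indF bp) mul0r mulr0.
by rewrite (indT bp) mul1r mulr1 H.
Qed.

Lemma cont_cint f (c d : R) : continuous f ->
  continuous (fun x => cint c d (fun y => f (x, y))).
Proof.
move=> cf x.
have xI : x \in (`](x - 1), (x + 1)[%classic : set R) by rewrite inE /= in_itv /=; lra.
have [C C0 H] := cont_bound2 (x - 1) (x + 1) c d cf.
apply: (@continuity_under_integral R _ _ leb (fun x y => f (x, y)) `[c, d] _ (x - 1) (x + 1) _ _ (fun=> C)) => //.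
- by move=> z _; exact: cont_int (cont_slice2 cf).
- by apply: aeW => y _ z _; exact: cont_slice1.
- exact: (cont_int c d (@cont_cst R C)).
- move=> z; rewrite /= in_itv /= => /andP[z1 z2]; apply: aeW => y; rewrite /= in_itv /= => yd.
  by apply: H; apply/boxP; split => //=; rewrite !ltW.
Qed.

Lemma cint_EFin (c d : R) (g : R -> R) : continuous g ->
  (\int[leb]_(y in `[c, d]) (g y)%:E)%E = (cint c d g)%:E.
Proof.
move=> cg; rewrite /cint /Rintegral fineK//; apply: integrable_fin_num => //.
exact: cont_int.
Qed.

Lemma fub f (a b c d : R) : continuous f ->
  \int[mu]_p (\1_(box a b c d) p * f p) = cint a b (fun x => cint c d (fun y => f (x, y))).
Proof.
move=> cf; rewrite /Rintegral -(@integral12_prod_meas1 _ _ _ _ R leb leb _ (intble_box a b c d cf)).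
rewrite /cint /Rintegral [in RHS]integral_mkcond; congr fine; apply: eq_integral => x _.
rewrite /fubini_F /= /patch; case: ifPn => [|].
  rewrite inE /= in_itv /= => xab; rewrite -/(Rintegral _ _ _) -/(cint _ _ _).
  rewrite -cint_EFin; last exact: cont_slice2.
  rewrite [RHS]integral_mkcond; apply: eq_integral => y _; rewrite /patch; case: ifPn.
    by rewrite inE /= in_itv /= => ycd; rewrite indT ?mul1r//; apply/boxP.
  rewrite notin_setE /= in_itv /= => ycd; rewrite indF ?mul0r// => /boxP[_ /=].
  by move=> /ycd.
rewrite notin_setE /= in_itv /= => xab; rewrite (eq_integral (cst 0%E)) ?integral0// => y _.
by rewrite indF ?mul0r// => /boxP[/= /xab].
Qed.

Lemma fub_swap f (a b c d : R) : continuous f ->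
  \int[mu]_p (\1_(box a b c d) p * f p) = cint c d (fun y => cint a b (fun x => f (x, y))).
Proof.
move=> cf; rewrite /Rintegral -(@integral21_prod_meas1 _ _ _ _ R leb leb _ (intble_box a b c d cf)).
rewrite /cint /Rintegral [in RHS]integral_mkcond; congr fine; apply: eq_integral => y _.
rewrite /fubini_G /= /patch; case: ifPn => [|].
  rewrite inE /= in_itv /= => ycd; rewrite -/(Rintegral _ _ _) -/(cint _ _ _).
  rewrite -cint_EFin; last exact: cont_slice1.
  rewrite [RHS]integral_mkcond; apply: eq_integral => x _; rewrite /patch; case: ifPn.
    by rewrite inE /= in_itv /= => xab; rewrite indT ?mul1r//; apply/boxP.
  rewrite notin_setE /= in_itv /= => xab; rewrite indF ?mul0r// => /boxP[/=].
  by move=> /xab.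
rewrite notin_setE /= in_itv /= => ycd; rewrite (eq_integral (cst 0%E)) ?integral0// => x _.
by rewrite indF ?mul0r// => /boxP[_ /= /ycd].
Qed.

(* Tonelli, for functions which need not be continuous in the plane. *)
Lemma ip_le_iter f (a b : R) (B : R -> R) : mfun2 f -> continuous B -> (forall x, 0 <= B x) ->
  (forall p, f p != 0 -> a <= p.1 <= b) ->
  (forall x, a <= x <= b -> (\int[leb]_y (f (x, y) ^+ 2)%:E <= (B x)%:E)%E) ->
  ip f f <= cint a b B.
Proof.
move=> mf cB B0 fab fB.
have mf2 : measurable_fun [set: RR] (fun p : RR => (f p ^+ 2)%:E).
  by apply/measurable_EFinP; exact: (mfun2M mf mf).
have H : (\int[mu]_p (f p ^+ 2)%:E <= (cint a b B)%:E)%E.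
  rewrite (@fubini_tonelli1 _ _ _ _ R leb leb _ mf2); last by move=> p; rewrite lee_fin sqr_ge0.
  rewrite -cint_EFin// [leRHS]integral_mkcond; apply: ge0_le_integral => //.
  - by move=> x _; apply: integral_ge0 => y _; rewrite lee_fin sqr_ge0.
  - by apply: measurable_fun_fubini_tonelli_F => // p; rewrite lee_fin sqr_ge0.
  - apply/(measurable_restrictT _ _).1 => //; apply/measurable_EFinP.
    apply: measurable_funTS; exact: continuous_measurable_fun.
  move=> x _; rewrite /patch; case: ifPn.
    by rewrite inE /= in_itv /=; exact: fB.
  rewrite notin_setE /= in_itv /= => xab; rewrite /fubini_F (eq_integral (cst 0%E)) ?integral0// => y _ /=.
  have [->|/fab //] := eqVneq (f (x, y)) 0; by rewrite expr0n.
have -> : ip f f = \int[mu]_p (f p ^+ 2) by apply: eq_Rintegral => p _; rewrite expr2.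
rewrite /Rintegral -lee_fin fineK//.
rewrite ge0_fin_numE; last by apply: integral_ge0 => p _; rewrite lee_fin sqr_ge0.
by apply: le_lt_trans H _; rewrite ltry.
Qed.

End Fub.

(** * The equation of one mode *)

Section UnderIntegral.
Context {R : realType}.
Local Notation leb := (@lebesgue_measure R).

Lemma der_cint (f f' : R * R -> R) (c d : R) : derx f f' -> continuous f -> continuous f' ->
  der (fun x => cint c d (fun y => f (x, y))) (fun x => cint c d (fun y => f' (x, y))).
Proof.
move=> df cf cf' x.
have [C C0 H] := cont_bound2 (x - 1) (x + 1) c d cf'.
have E z y : partial1of2 (fun x y => f (x, y)) z y = f' (z, y).
  by rewrite /partial1of2 (derE (df y)).
have xI : (`](x - 1), (x + 1)[%classic : set R) x by rewrite /= in_itv /=; lra.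
have h1 z : (`](x - 1), (x + 1)[%classic : set R) z -> leb.-integrable `[c, d] (EFin \o (fun y => f (z, y))).
  by move=> _; exact: cont_int (cont_slice2 cf).
have h2 z y : (`](x - 1), (x + 1)[%classic : set R) z -> (`[c, d]%classic : set R) y -> derivable (fun z => f (z, y)) z 1.
  by move=> _ _; exact: der_derivable (df y) z.
have h3 : leb.-integrable `[c, d] (EFin \o (fun _ : R => C)).
  exact: (cont_int c d (@cont_cst R C)).
have h4 z y : (`](x - 1), (x + 1)[%classic : set R) z -> (`[c, d]%classic : set R) y ->
    `|partial1of2 (fun x y => f (x, y)) z y| <= C.
  rewrite /= !in_itv /= E => /andP[z1 z2] yd; apply: H; apply/boxP; split => //=.
  by rewrite !ltW.
have D := @differentiation_under_integral R _ _ leb (fun x y => f (x, y)) `[c, d] (measurable_itv _) x (x - 1) (x + 1) xI h1 h2 (fun=> C) (fun=> C0) h3 h4.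
have D' := @derivable_under_integral R _ _ leb (fun x y => f (x, y)) `[c, d] (measurable_itv _) x (x - 1) (x + 1) xI h1 h2 (fun=> C) (fun=> C0) h3 h4.
split; first exact: D'.
rewrite -derive1E; etransitivity; first exact: D.
by apply: eq_Rintegral => y _; rewrite E.
Qed.

Lemma smooth1_cint (f : R * R -> R) (c d : R) : smooth2 f ->
  smooth1 (fun x => cint c d (fun y => f (x, y))).
Proof.
move=> sf.
apply: (@smooth1_coind _ (fun h => exists2 f, smooth2 f & h = (fun x => cint c d (fun y => f (x, y))))); last by exists f.
move=> _ [{sf}f sf ->]; exists (fun x => cint c d (fun y => dx f (x, y))).
  by exists (dx f) => //; exact: smooth2_dx.
apply: der_cint; [exact: smooth2_derx|exact: smooth2_continuous|].
exact/smooth2_continuous/smooth2_dx.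
Qed.

End UnderIntegral.

Section ODE.
Context {R : realType}.
Implicit Types (a c x : R) (f g F H : R -> R).

Lemma der_norm_le a c F H f h : der F f -> der H h -> F a = 0 -> H a = 0 ->
  (forall x, a <= x <= c -> `|f x| <= h x) -> forall x, a <= x <= c -> `|F x| <= H x.
Proof.
move=> dF dH Fa Ha fh x /andP[ax xc].
have fh' y : a <= y <= x -> `|f y| <= h y.
  by move=> /andP[ay yx]; apply: fh; rewrite ay (le_trans yx).
rewrite ler_norml; apply/andP; split.
  have := der_le ax (derN dH) dF; rewrite /= Fa Ha !oppr0 !addr0; apply => y /fh'.
  by rewrite ler_norml => /andP[].
have := der_le ax dF dH; rewrite Fa Ha !oppr0 !addr0; apply => y /fh'.
by rewrite ler_norml => /andP[].
Qed.

Lemma der_expM (k : R) : der (fun y => expR (k * y)) (fun y => k * expR (k * y)).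
Proof.
apply: der_eq (der_comp der_exp (derZ k der_id)) _ => y.
by rewrite mulr1 mulrC.
Qed.

Lemma smooth1_expM (k : R) : smooth1 (fun y => expR (k * y)).
Proof.
apply: (@smooth1_comp _ expR); first exact: smooth1_exp.
by apply: smooth1M; [exact: smooth1_cst|exact: smooth1_id].
Qed.
Lemma smooth1_sinM (k : R) : smooth1 (fun y => sin (k * y)).
Proof.
apply: (@smooth1_comp _ sin); first exact: smooth1_sin.
by apply: smooth1M; [exact: smooth1_cst|exact: smooth1_id].
Qed.
Lemma smooth1_cosM (k : R) : smooth1 (fun y => cos (k * y)).
Proof.
apply: (@smooth1_comp _ cos); first exact: smooth1_cos.
by apply: smooth1M; [exact: smooth1_cst|exact: smooth1_id].
Qed.
Lemma smooth1Z (k : R) f : smooth1 f -> smooth1 (fun y => k * f y).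
Proof. by move=> h; exact: (smooth1M (@smooth1_cst R k) h). Qed.

Lemma der_bnd_aux a c F f (J : R) : der F f -> F a = 0 ->
  (forall x, a <= x <= c -> `|f x| <= J) -> forall x, a <= x <= c -> `|F x| <= J * (x - a).
Proof.
move=> dF Fa fJ; have dH : der (fun x => J * (x - a)) (fun=> J).
  apply: der_eq (derZ J (derB der_id (der_cst a))) _ => x.
  by rewrite subr0 mulr1.
by apply: (der_norm_le dF dH Fa) => //; rewrite subrr mulr0.
Qed.

(* For [lam > 0] by variation of constants. Otherwise [psi'' + lam psi] is
   [(D - kp) (D + kp) psi] with [kp ^ 2 = - lam]; integrating the first factor from [c] and
   the second one from [a] avoids any exponential loss. *)
Lemma ode_solution a c (lam Lam : R) G : a <= c -> 1 <= Lam -> - Lam ^+ 2 <= lam -> smooth1 G ->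
  exists psi psi' : R -> R,
  [/\ smooth1 psi, der psi psi', der psi' (fun x => G x - lam * psi x), psi a = 0 &
    forall x, a <= x <= c ->
      `|psi x| <= 2 * (c - a) * cint a c (fun y => `|G y|) /\
      `|psi' x| <= (2 + Lam * (c - a)) * cint a c (fun y => `|G y|)].
Proof.
move=> ac Lam1 lamL sG; have cG := smooth1_continuous sG.
have cGn : continuous (fun y => `|G y|) by exact: cont_norm.
have [J0 dJ J0a] := primitive_exists a cGn.
pose J := cint a c (fun y => `|G y|).
have JE : J = J0 c by rewrite /J (cint_der ac dJ) // J0a subr0.
have J_ge0 : 0 <= J by apply: cint_ge0.
have J0_le x : a <= x <= c -> J0 x <= J.
  move=> /andP[ax xc]; have := cint_der xc dJ cGn; rewrite JE => e.
  by rewrite -subr_ge0 -e; apply: cint_ge0.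
have ca0 : 0 <= c - a by rewrite subr_ge0.
have [lam0|lam0] := ltP 0 lam.
  pose om : R := Num.sqrt lam; have om0 : 0 < om by rewrite sqrtr_gt0.
  have om2 : om ^+ 2 = lam by rewrite sqr_sqrtr// ltW.
  have sA := smooth1M (@smooth1_cosM om) sG.
  have sB := smooth1M (@smooth1_sinM om) sG.
  have [A dA A0] := primitive_exists a (smooth1_continuous sA).
  have [B dB B0] := primitive_exists a (smooth1_continuous sB).
  have An x : a <= x <= c -> `|A x| <= J.
    move=> xac; apply: le_trans (J0_le x xac).
    apply: (der_norm_le dA dJ) xac => // y _.
    by rewrite normrM ler_piMl// ler_norml cos_geN1 cos_le1.
  have Bn x : a <= x <= c -> `|B x| <= J.
    move=> xac; apply: le_trans (J0_le x xac).
    apply: (der_norm_le dB dJ) xac => // y _.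
    by rewrite normrM ler_piMl// ler_norml sin_geN1 sin_le1.
  (* Variation of constants: the integral over [[a, x]] of [sin (om (x - y)) / om * G y]. *)
  pose psi x := om^-1 * (sin (om * x) * A x - cos (om * x) * B x).
  pose psi' x := cos (om * x) * A x + sin (om * x) * B x.
  have dpsi : der psi psi'.
    apply: der_eq (derZ om^-1 (derB (derM (der_sinM om) dA) (derM (der_cosM om) dB))) _ => x.
    by rewrite /psi'; field; rewrite gt_eqF.
  have psi'n x : a <= x <= c -> `|psi' x| <= 2 * J.
    move=> xac; rewrite mulr_natl mulr2n; apply: le_trans (ler_normD _ _) _; apply: lerD.
      by rewrite normrM (le_trans _ (An x xac))// ler_piMl// ler_norml cos_geN1 cos_le1.
    by rewrite normrM (le_trans _ (Bn x xac))// ler_piMl// ler_norml sin_geN1 sin_le1.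
  have psia : psi a = 0 by rewrite /psi A0 B0 !mulr0 subrr mulr0.
  exists psi, psi'; split; [|exact: dpsi| |exact: psia|].
  - apply: smooth1Z; apply: smooth1B; apply: smooth1M.
    + exact: smooth1_sinM.
    + exact: smooth1_prim dA.
    + exact: smooth1_cosM.
    + exact: smooth1_prim dB.
  - apply: der_eq (derD (derM (der_cosM om) dA) (derM (der_sinM om) dB)) _ => x.
    rewrite -om2 /psi -[in RHS](mul1r (G x)) -(cos2Dsin2 (om * x)).
    by field; rewrite gt_eqF.
  - move=> x xac; split.
      (* [psi] is bounded by integrating [psi'], because [om^-1] is unbounded as [lam] tends to
         [0]. *)
      apply: le_trans (der_bnd_aux dpsi psia psi'n xac) _.
      rewrite mulrAC ler_wpM2r// ler_wpM2l// lerB//; by case/andP: xac.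
    apply: le_trans (psi'n x xac) _; rewrite ler_wpM2r// lerDl mulr_ge0//.
    exact: le_trans Lam1.
pose kp : R := Num.sqrt (- lam); have kp0 : 0 <= kp by rewrite sqrtr_ge0.
have kp2 : kp ^+ 2 = - lam by rewrite sqr_sqrtr// oppr_ge0.
have kpL : kp <= Lam.
  by rewrite -ler_sqr ?nnegrE ?(le_trans ler01 Lam1)// kp2; lra.
have sA := smooth1M (@smooth1_expM (- kp)) sG.
have [A1 dA1 _] := primitive_exists a (smooth1_continuous sA).
pose A x := A1 x - A1 c.
have dA : der A (fun x => expR (- kp * x) * G x).
  by apply: der_eq (derB dA1 (der_cst _)) _ => x; rewrite subr0.
have Ac : A c = 0 by rewrite /A subrr.
(* Minus the integral over [[x, c]] of [exp (- kp (y - x)) * G y]: starting from [c] keeps the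
   exponential at most [1]. *)
pose g x := expR (kp * x) * A x.
have eK x : expR (kp * x) * expR (- kp * x) = 1 by rewrite mulNr expRxMexpNx_1.
have dg : der g (fun x => kp * g x + G x).
  apply: der_eq (derM (der_expM kp) dA) _ => x.
  by rewrite /g mulrA eK; ring.
have gn x : a <= x <= c -> `|g x| <= J.
  move=> /andP[ax xc].
  (* A majorant of [|A|]: its decrease dominates [exp (- kp y) |G y|], and [exp (kp x) * h x] is the
     part of [J] carried by [[x, c]]. *)
  pose h y := expR (- kp * y) * (J0 c - J0 y).
  have dh : der h (fun y => - kp * h y - expR (- kp * y) * `|G y|).
    apply: der_eq (derM (der_expM (- kp)) (derB (der_cst _) dJ)) _ => y.
    by rewrite /h; ring.
  have h0 y : a <= y <= c -> 0 <= h y.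
    by move=> yac; rewrite mulr_ge0 ?expR_ge0// subr_ge0 -JE J0_le.
  have hc : h c = 0 by rewrite /h subrr mulr0.
  have Ah : `|A x| <= h x.
    have hle y : x <= y <= c -> expR (- kp * y) * `|G y| <= - (- kp * h y - expR (- kp * y) * `|G y|).
      move=> /andP[xy yc]; have := h0 y; rewrite yc (le_trans ax xy) => /(_ isT) hy.
      by have := mulr_ge0 kp0 hy; lra.
    have En y : `|expR (- kp * y) * G y| = expR (- kp * y) * `|G y|.
      by rewrite normrM ger0_norm ?expR_ge0.
    have H1 : A c - A x <= - h c - - h x.
      apply: (der_le xc dA (derN dh)) => y /hle; apply: le_trans; rewrite -En.
      exact: ler_norm.
    have H2 : - A c - - A x <= - h c - - h x.
      apply: (der_le xc (derN dA) (derN dh)) => y /hle; apply: le_trans; rewrite -En.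
      by rewrite -normrN ler_norm.
    by rewrite ler_norml; apply/andP; split; move: H1 H2; rewrite Ac hc; lra.
  rewrite /g normrM ger0_norm ?expR_ge0//.
  apply: le_trans (ler_wpM2l (expR_ge0 _) Ah) _.
  rewrite /h mulrA eK mul1r JE lerBlDr lerDl.
  have H0 : 0 - 0 <= J0 x - J0 a by exact: (der_le ax (der_cst 0) dJ).
  by move: H0; rewrite subrr J0a subr0.
have sg : smooth1 g.
  apply: smooth1M; first exact: smooth1_expM.
  exact: smooth1_prim dA.
have sB := smooth1M (@smooth1_expM kp) sg.
have [B dB Ba] := primitive_exists a (smooth1_continuous sB).
(* The other factor is inverted from [a], which yields both the bounded kernel [exp (- kp (x - y))]
   and [psi a = 0]. *)
pose psi x := expR (- kp * x) * B x.
have dpsi : der psi (fun x => g x - kp * psi x).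
  apply: der_eq (derM (der_expM (- kp)) dB) _ => x.
  by rewrite /psi -[in RHS](mul1r (g x)) -(eK x); ring.
have psin x : a <= x <= c -> `|psi x| <= J * (x - a).
  move=> xac.
  have dH : der (fun x => expR (kp * x) * (J * (x - a))) (fun x => kp * (expR (kp * x) * (J * (x - a))) + expR (kp * x) * J).
    apply: der_eq (derM (der_expM kp) (derZ J (derB der_id (der_cst a)))) _ => y.
    by rewrite subr0 mulr1; ring.
  rewrite /psi normrM ger0_norm ?expR_ge0//.
  have := der_norm_le dB dH Ba; rewrite subrr !mulr0 => /(_ c erefl) H0.
  apply: le_trans (ler_wpM2l (expR_ge0 _) (H0 _ x xac)) _.
    move=> y yac; have [ay _] := andP yac.
    rewrite normrM ger0_norm ?expR_ge0//.
    apply: le_trans (ler_wpM2l (expR_ge0 _) (gn y yac)) _.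
    by rewrite lerDr mulr_ge0// mulr_ge0 ?expR_ge0// mulr_ge0// subr_ge0.
  by rewrite /= (mulrA (expR (- kp * x))) (mulrC (expR (- kp * x))) eK mul1r.
exists psi, (fun x => g x - kp * psi x); split; [|exact: dpsi| | |].
- apply: smooth1M; first exact: smooth1_expM.
  exact: smooth1_prim dB.
- apply: der_eq (derB dg (derZ kp dpsi)) _ => x.
  have lamE : lam = - kp ^+ 2 by rewrite kp2 opprK.
  by rewrite [in RHS]lamE; ring.
- by rewrite /psi Ba mulr0.
move=> x xac; have [ax xc] := andP xac.
have p1 : `|psi x| <= (c - a) * J.
  by apply: le_trans (psin x xac) _; rewrite mulrC ler_wpM2r// lerB.
split.
  apply: le_trans p1 _; rewrite -/J -mulrA ler_peMl ?mulr_ge0//; lra.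
rewrite -/J; apply: le_trans (ler_normB _ _) _; rewrite mulrDl; apply: lerD.
  by apply: le_trans (gn x xac) _; rewrite ler_peMl//; lra.
rewrite normrM ger0_norm// -mulrA ler_pM//.
Qed.

End ODE.

(** * Straightening the wing *)

(** The shape is that of [ddil], with [q] for [dcutsq] and [r] for [invheight]. *)
Lemma cube_bound {R : realType} (L q P r b : R) : 0 <= L -> 0 <= r <= b -> `|q| <= P ->
  `|L * (2^-1 * q * (r * (r * r)))| <= L * (2^-1 * P * (b * (b * b))).
Proof.
move=> L0 /andP[r0 rb] qP; have hr : 0 <= r * (r * r) by rewrite !mulr_ge0.
rewrite !normrM (ger0_norm L0) (ger0_norm r0) ger0_norm ?invr_ge0//.
apply: ler_wpM2l => //; apply: ler_pM; rewrite ?mulr_ge0 ?invr_ge0//; first exact: ler_wpM2l.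
by apply: ler_pM => //; [exact: mulr_ge0|exact: ler_pM].
Qed.

(** The shape is that of [dddil], with [t] for [ddcutsq]. *)
Lemma quintic_bound {R : realType} (L q P t D r b : R) : 0 <= L -> 0 <= r <= b ->
  `|q| <= P -> `|t| <= D ->
  `|L * (2^-1 * t * (r * (r * r)) + 3 / 4 * q ^+ 2 * r ^+ 5)| <=
  L * (2^-1 * D * (b * (b * b)) + 3 / 4 * P ^+ 2 * b ^+ 5).
Proof.
move=> L0 rb qP tD; have /andP[r0 rb'] := rb.
have := cube_bound ler01 rb tD; rewrite !mul1r => h.
rewrite normrM (ger0_norm L0); apply: ler_wpM2l => //.
apply: le_trans (ler_normD _ _) _; apply: lerD => //.
have q2 : q ^+ 2 <= P ^+ 2 by rewrite -[q ^+ 2]real_normK ?num_real// lerXn2r ?nnegrE// (le_trans _ qP).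
have r5 : r ^+ 5 <= b ^+ 5 by rewrite lerXn2r ?nnegrE// (le_trans r0).
have q0 : 0 <= 3 / 4 * q ^+ 2 by apply: mulr_ge0 => //; exact: sqr_ge0.
rewrite ger0_norm; last by apply: mulr_ge0 => //; exact: exprn_ge0.
apply: ler_pM => //; first exact: exprn_ge0.
exact: ler_wpM2l.
Qed.

Section Straight.
Context {R : realType}.
Variable L0 : R.
Hypothesis hL0 : 0 < L0.

Lemma der_affine (k b : R) : der (fun x => k * x + b) (fun=> k).
Proof. by apply: der_eq (derD (derZ k der_id) (der_cst b)) _ => x; rewrite mulr1 addr0. Qed.

Lemma smooth1_affine (k b : R) : smooth1 (fun x => k * x + b).
Proof.
by apply: smooth1D; [apply: smooth1Z; exact: smooth1_id|exact: smooth1_cst].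
Qed.

(* The dilation [L0 / stadium_height L0 x] of the vertical fibres is only C^{1,1} at [x = 0].
   In its smooth substitute [dil n], the square of the positive part of [x] is replaced by
   [possq n x], which agrees with it for [0 <= x] and vanishes for [x <= - L0 / (2 (n + 1))];
   [farcut] removes the singularity at [x = L0]. *)
Definition sqramp (t : R) := t * t * rho (t + 1).
Definition dsqramp (t : R) := 2 * t * rho (t + 1) + t * t * drho (t + 1).
Definition ddsqramp (t : R) := 2 * rho (t + 1) + 4 * t * drho (t + 1) + t * t * ddrho (t + 1).

Lemma der_shift (f f' : R -> R) (b : R) : der f f' -> der (fun t => f (t + b)) (fun t => f' (t + b)).
Proof.
move=> df; apply: der_eq (der_comp df (derD der_id (der_cst b))) _ => x.
by rewrite addr0 mulr1.
Qed.

Lemma sqramp_der : der sqramp dsqramp.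
Proof.
apply: der_eq (derM (derM der_id der_id) (der_shift 1 rho_der)) _ => x.
by rewrite /dsqramp; ring.
Qed.

Lemma dsqramp_der : der dsqramp ddsqramp.
Proof.
apply: der_eq (derD (derM (derZ 2 der_id) (der_shift 1 rho_der)) (derM (derM der_id der_id) (der_shift 1 drho_der))) _ => x.
by rewrite /ddsqramp; ring.
Qed.

Lemma smooth1_sqramp : smooth1 sqramp.
Proof.
apply: smooth1M; first by apply: smooth1M; exact: smooth1_id.
apply: (@smooth1_comp _ rho); first exact: smooth1_rho.
by apply: smooth1D; [exact: smooth1_id|exact: smooth1_cst].
Qed.

Lemma sqramp_ge0 t : 0 <= sqramp t.
Proof. by rewrite /sqramp mulr_ge0 ?rho_ge0// -expr2 sqr_ge0. Qed.
Lemma sqramp_le t : sqramp t <= t * t.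
Proof. by rewrite /sqramp ler_piMr ?rho_le1// -expr2 sqr_ge0. Qed.
Lemma sqrampR t : 0 <= t -> sqramp t = t * t.
Proof. by move=> t0; rewrite /sqramp rho1 ?mulr1// lerDr. Qed.
Lemma sqrampL t : t <= -1 -> sqramp t = 0.
Proof. by move=> t0; rewrite /sqramp rho0 ?mulr0//; lra. Qed.
Lemma dsqrampR t : 0 < t -> dsqramp t = 2 * t.
Proof.
by move=> t0; rewrite /dsqramp rho1 ?drho0; [ring|rewrite ltrDr t0 orbT|lra].
Qed.
Lemma dsqrampL t : t < -1 -> dsqramp t = 0.
Proof.
by move=> t0; rewrite /dsqramp rho0 ?drho0; [ring|apply/orP; left; lra|lra].
Qed.
Lemma ddsqrampR t : 0 < t -> ddsqramp t = 2.
Proof.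
move=> t0; have h : (t + 1 < 0) || (1 < t + 1) by rewrite ltrDr t0 orbT.
by rewrite /ddsqramp rho1 ?drho0 ?ddrho0//; [ring|lra].
Qed.
Lemma ddsqrampL t : t < -1 -> ddsqramp t = 0.
Proof.
move=> t0; have h : (t + 1 < 0) || (1 < t + 1) by apply/orP; left; lra.
by rewrite /ddsqramp rho0 ?drho0 ?ddrho0//; [ring|lra].
Qed.

(** Linear growth of the first derivative and boundedness of the second survive the scaling in
    [possq]: they bound [dpossq] and [ddpossq] on bounded sets uniformly in [n], as befits a C^{1,1}
    limit. *)
Lemma sqramp_bounds : exists2 C, 1 <= C & forall t, `|dsqramp t| <= 2 * `|t| + C /\ `|ddsqramp t| <= C.
Proof.
have [C1 C11 H1] := @rho_bound R.
have [D1 D10 E1] := cont_bound (-1) 0 (der_continuous dsqramp_der).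
have cdd : continuous ddsqramp.
  have [f sf h] := smooth1_der smooth1_sqramp.
  have e := derE sqramp_der; rewrite (derE h) in e; subst f.
  have [g sg h2] := smooth1_der sf.
  have e := derE dsqramp_der; rewrite (derE h2) in e; subst g.
  exact: smooth1_continuous.
have [D2 D20 E2] := cont_bound (-1) 0 cdd.
exists (2 + D1 + D2); first lra.
move=> t; have [t1|t1] := ltP t (-1).
  by rewrite dsqrampL// ddsqrampL// normr0; split; [rewrite addr_ge0 ?mulr_ge0//; lra|lra].
have [t0|t0] := ltP 0 t.
  rewrite dsqrampR// ddsqrampR// normrM; split; last by rewrite ger0_norm//; lra.
  by rewrite [`|2|]ger0_norm// lerDl; lra.
have tI : -1 <= t <= 0 by apply/andP.
split; first by have := E1 t tI; have := normr_ge0 t; lra.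
by have := E2 t tI; lra.
Qed.

(** The factor [2] makes the smoothing layer, of width [1 / rampscale n], at most [L0 / 2] wide, so
    that [possq] stays below [(L0 / 2)^2] for [x <= 0]. *)
Definition rampscale (n : nat) : R := 2 * n.+1%:R / L0.

Lemma rampscale_gt0 n : 0 < rampscale n. Proof. by rewrite divr_gt0// mulr_gt0. Qed.
Lemma rampscaleV n : (rampscale n)^-1 <= L0 / 2.
Proof.
rewrite -[leRHS]invrK lef_pV2 ?posrE ?rampscale_gt0 ?invr_gt0 ?divr_gt0// invf_div.
by rewrite ler_pM2r ?invr_gt0// ler_peMr// ler1n.
Qed.

Definition possq n x := (rampscale n)^-1 * ((rampscale n)^-1 * sqramp (rampscale n * x)).
Definition dpossq n x := (rampscale n)^-1 * dsqramp (rampscale n * x).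
Definition ddpossq n x := ddsqramp (rampscale n * x).

Lemma possq_der n : der (possq n) (dpossq n).
Proof.
apply: der_eq (derZ _ (derZ _ (der_comp sqramp_der (derZ (rampscale n) der_id)))) _ => x.
by rewrite /dpossq mulr1; field; rewrite gt_eqF// rampscale_gt0.
Qed.
Lemma dpossq_der n : der (dpossq n) (ddpossq n).
Proof.
apply: der_eq (derZ _ (der_comp dsqramp_der (derZ (rampscale n) der_id))) _ => x.
by rewrite /ddpossq mulr1; field; rewrite gt_eqF// rampscale_gt0.
Qed.
Lemma smooth1_possq n : smooth1 (possq n).
Proof.
do 2 apply: smooth1Z; apply: smooth1_comp; first exact: smooth1_sqramp.
by apply: smooth1Z; exact: smooth1_id.
Qed.
Lemma possq_ge0 n x : 0 <= possq n x.
Proof.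
have a0 : 0 <= (rampscale n)^-1 by rewrite invr_ge0 ltW// rampscale_gt0.
apply: mulr_ge0 => //; apply: mulr_ge0 => //; exact: sqramp_ge0.
Qed.
Lemma possq_le n x : possq n x <= x * x.
Proof.
rewrite /possq mulrA -ler_pdivlMl ?mulr_gt0 ?invr_gt0 ?rampscale_gt0//.
apply: le_trans (sqramp_le _) _; rewrite le_eqVlt; apply/orP; left; apply/eqP.
by field; rewrite gt_eqF// rampscale_gt0.
Qed.
Lemma possqR n x : 0 <= x -> possq n x = x * x.
Proof.
move=> x0; rewrite /possq sqrampR; last by rewrite mulr_ge0// ltW// rampscale_gt0.
by field; rewrite gt_eqF// rampscale_gt0.
Qed.
Lemma dpossqR n x : 0 < x -> dpossq n x = 2 * x.
Proof.
move=> x0; rewrite /dpossq dsqrampR; last by rewrite mulr_gt0// rampscale_gt0.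
by field; rewrite gt_eqF// rampscale_gt0.
Qed.
Lemma ddpossqR n x : 0 < x -> ddpossq n x = 2.
Proof. by move=> x0; rewrite /ddpossq ddsqrampR// mulr_gt0// rampscale_gt0. Qed.
Lemma possq_small n x : x <= 0 -> possq n x <= (L0 / 2) ^+ 2.
Proof.
move=> x0; have [h|h] := leP (rampscale n * x) (-1).
  by rewrite /possq sqrampL// !mulr0 sqr_ge0.
apply: le_trans (possq_le n x) _; rewrite -expr2 -sqrrN lerXn2r ?nnegrE ?oppr_ge0 ?divr_ge0 ?(ltW hL0)//.
apply: le_trans (rampscaleV n); rewrite -(ler_pM2l (rampscale_gt0 n)) divff ?gt_eqF ?rampscale_gt0//.
by rewrite mulrN; lra.
Qed.

Lemma possqL x : x < 0 -> exists N, forall n, (N <= n)%N -> [/\ possq n x = 0, dpossq n x = 0 & ddpossq n x = 0].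
Proof.
move=> x0; pose N := Num.truncn (L0 / (- x)); exists N => n Nn.
have h : rampscale n * x < -1.
  rewrite -[x]opprK mulrN ltrN2 -ltr_pdivrMr ?oppr_gt0// div1r /rampscale.
  have h1 : L0 / - x < n.+1%:R.
    by apply: lt_le_trans (truncnS_gt _) _; rewrite ler_nat ltnS.
  rewrite ltr_pdivlMr// mulrC; apply: lt_trans h1 _.
  by rewrite ltr_pMl ?ltr1n.
by rewrite /possq /dpossq /ddpossq sqrampL ?dsqrampL ?ddsqrampL ?mulr0// ltW.
Qed.

(** Equal to [1] up to [L0 / 2], where the true height is kept, and to [0] from [3 / 4 * L0] on. *)
Definition farcut (x : R) := rho ((- 4 / L0) * x + 3).
Definition dfarcut (x : R) := (- 4 / L0) * drho ((- 4 / L0) * x + 3).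
Definition ddfarcut (x : R) := (- 4 / L0) * ((- 4 / L0) * ddrho ((- 4 / L0) * x + 3)).

Lemma farcut_der : der farcut dfarcut.
Proof. by apply: der_eq (der_comp rho_der (der_affine _ _)) _ => x; rewrite /dfarcut mulrC. Qed.
Lemma dfarcut_der : der dfarcut ddfarcut.
Proof.
apply: der_eq (derZ _ (der_comp drho_der (der_affine _ _))) _ => x.
by rewrite /ddfarcut; congr (_ * _); rewrite mulrC.
Qed.
Lemma smooth1_farcut : smooth1 farcut.
Proof. by apply: (@smooth1_comp _ rho); [exact: smooth1_rho|exact: smooth1_affine]. Qed.

Lemma farcut_arg x : (x < L0 / 2) = (1 < (- 4 / L0) * x + 3).
Proof.
have e : (- 4 / L0) * x + 3 - 1 = 4 / L0 * (L0 / 2 - x) by field; rewrite gt_eqF.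
by rewrite -[RHS]subr_gt0 e pmulr_rgt0 ?divr_gt0// subr_gt0.
Qed.

Lemma farcutL x : x < L0 / 2 -> [/\ farcut x = 1, dfarcut x = 0 & ddfarcut x = 0].
Proof.
rewrite farcut_arg => h; rewrite /farcut /dfarcut /ddfarcut rho1 ?ltW//.
by rewrite drho0 ?h ?orbT// ddrho0 ?h ?orbT// !mulr0.
Qed.

Lemma farcutR x : 3 / 4 * L0 <= x -> farcut x = 0.
Proof.
move=> h; apply: rho0; rewrite -subr_ge0.
have -> : 0 - (- 4 / L0 * x + 3) = 4 / L0 * (x - 3 / 4 * L0) by field; rewrite gt_eqF.
by rewrite mulr_ge0 ?divr_ge0 ?(ltW hL0)// subr_ge0.
Qed.

Definition cutsq n x := possq n x * farcut x.
Definition dcutsq n x := dpossq n x * farcut x + possq n x * dfarcut x.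
Definition ddcutsq n x := (ddpossq n x * farcut x + dpossq n x * dfarcut x) + (dpossq n x * dfarcut x + possq n x * ddfarcut x).

Lemma cutsq_der n : der (cutsq n) (dcutsq n).
Proof. exact: (derM (possq_der n) farcut_der). Qed.
Lemma dcutsq_der n : der (dcutsq n) (ddcutsq n).
Proof. exact: (derD (derM (dpossq_der n) farcut_der) (derM (possq_der n) dfarcut_der)). Qed.

Lemma cutsqL n x : x < L0 / 2 -> [/\ cutsq n x = possq n x, dcutsq n x = dpossq n x & ddcutsq n x = ddpossq n x].
Proof.
by move=> /farcutL[t0 t1 t2]; rewrite /cutsq /dcutsq /ddcutsq t0 t1 t2 !mulr1 !mulr0 !addr0.
Qed.

Lemma cutsq_ge0 n x : 0 <= cutsq n x.
Proof. by rewrite mulr_ge0 ?possq_ge0 ?rho_ge0. Qed.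

(** For positive [x] with [farcut x] nonzero, [x^2] is at most [9 / 16 * L0^2]. The looser [3 / 4]
    leaves [heightsq] at least [L0^2 / 4], which is the bound [2 / L0] of [invheight_le]. *)
Lemma cutsq_le n x : cutsq n x <= 3 / 4 * L0 ^+ 2.
Proof.
have [h|h] := leP (3 / 4 * L0) x.
  by rewrite /cutsq farcutR// mulr0 mulr_ge0 ?sqr_ge0//; lra.
have h1 : cutsq n x <= possq n x by rewrite ler_piMr ?possq_ge0// rho_le1.
apply: le_trans h1 _; have [x0|x0] := leP x 0.
  by apply: le_trans (possq_small n x0) _; rewrite exprMn; have := sqr_ge0 L0; lra.
apply: le_trans (possq_le n x) _.
have : x * x <= (3 / 4 * L0) * (3 / 4 * L0) by rewrite ler_pM// ltW.
by have := sqr_ge0 L0; rewrite expr2; lra.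
Qed.

Definition heightsq n x := L0 ^+ 2 - cutsq n x.
Lemma heightsq_gt0 n x : 0 < heightsq n x.
Proof.
rewrite subr_gt0; apply: le_lt_trans (cutsq_le n x) _.
by have h : 0 < L0 ^+ 2 := exprn_gt0 2 hL0; lra.
Qed.

Definition invheight n x := (Num.sqrt (heightsq n x))^-1.
Definition dil n x := L0 * invheight n x.
Definition ddil n x := L0 * (2^-1 * dcutsq n x * (invheight n x * (invheight n x * invheight n x))).
Definition dddil n x := L0 * (2^-1 * ddcutsq n x * (invheight n x * (invheight n x * invheight n x))
  + 3 / 4 * dcutsq n x ^+ 2 * invheight n x ^+ 5).

Lemma invheight_gt0 n x : 0 < invheight n x.
Proof. by rewrite invr_gt0 sqrtr_gt0 heightsq_gt0. Qed.

Lemma invheight_le n x : invheight n x <= 2 / L0.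
Proof.
rewrite /invheight -[leRHS]invrK lef_pV2 ?posrE ?sqrtr_gt0 ?heightsq_gt0 ?invr_gt0 ?divr_gt0// invf_div.
rewrite -[leLHS]ger0_norm ?divr_ge0 ?(ltW hL0)// -sqrtr_sqr ler_sqrt ?(ltW (heightsq_gt0 n x))//.
rewrite exprMn /heightsq; have := cutsq_le n x; have := sqr_ge0 L0; lra.
Qed.

Lemma invheight_der n : der (invheight n) (fun x => 2^-1 * dcutsq n x * (invheight n x * (invheight n x * invheight n x))).
Proof.
apply: der_eq (der_rsqrt (derB (der_cst _) (cutsq_der n)) (heightsq_gt0 n)) _ => x.
by rewrite /invheight /heightsq sub0r; ring.
Qed.
Lemma dil_der n : der (dil n) (ddil n).
Proof. exact: (derZ L0 (invheight_der n)). Qed.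
Lemma ddil_der n : der (ddil n) (dddil n).
Proof.
apply: der_eq (derZ L0 (derM (derZ 2^-1 (dcutsq_der n)) (derM (invheight_der n) (derM (invheight_der n) (invheight_der n))))) _ => x.
by rewrite /dddil; field.
Qed.
Lemma smooth1_dil n : smooth1 (dil n).
Proof.
apply: smooth1Z; apply: smooth1_rsqrt (heightsq_gt0 n).
apply: smooth1B; first exact: smooth1_cst.
by apply: smooth1M; [exact: smooth1_possq|exact: smooth1_farcut].
Qed.

Lemma dil_ge1 n x : 1 <= dil n x.
Proof.
rewrite /dil ler_pdivlMr ?sqrtr_gt0 ?heightsq_gt0// mul1r.
rewrite -[leRHS]gtr0_norm// -sqrtr_sqr ler_wsqrtr// /heightsq lerBlDr lerDl.
exact: cutsq_ge0.
Qed.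

Lemma dilR n x : 0 <= x < L0 / 2 -> dil n x = L0 / stadium_height L0 x.
Proof.
move=> /andP[x0 xL]; have [q _ _] := cutsqL n xL; rewrite /dil /invheight /heightsq q possqR// -expr2 /stadium_height.
case: ifPn => [x1|//]; have -> : x = 0 by apply/eqP; rewrite eq_le x1.
by rewrite expr0n subr0 sqrtr_sqr gtr0_norm.
Qed.

(** To the right of [0] the smoothing has no effect, which is why [dil L0 0] serves as the true
    dilation in the wing. *)
Lemma ddilR n x : 0 < x < L0 / 2 -> ddil n x = ddil 0 x /\ dddil n x = dddil 0 x.
Proof.
move=> /andP[x0 xL].
have e k : [/\ cutsq k x = x * x, dcutsq k x = 2 * x & ddcutsq k x = 2].
  by have [-> -> ->] := cutsqL k xL; rewrite possqR ?ltW// dpossqR// ddpossqR.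
have [a b c] := e n; have [a0 b0 c0] := e 0.
by rewrite /ddil /dddil /invheight /heightsq a b c a0 b0 c0.
Qed.

Lemma dilL x : x < 0 -> exists N, forall n, (N <= n)%N -> [/\ dil n x = 1, ddil n x = 0 & dddil n x = 0].
Proof.
move=> x0; have [N H] := possqL x0; exists N => n /H[a b c].
have xL : x < L0 / 2 by rewrite (lt_trans x0)// divr_gt0.
have [q dq ddq] := cutsqL n xL.
have rE : invheight n x = L0^-1 by rewrite /invheight /heightsq q a subr0 sqrtr_sqr gtr0_norm.
rewrite /dil /ddil /dddil dq ddq b c rE; split; last by ring.
  exact: (mulfV (lt0r_neq0 hL0)).
by ring.
Qed.

(** Uniform in [n]: this is the domination needed when the smoothing is removed. The range stops at
    [L0 / 2], before [farcut] starts to act. *)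
Lemma dil_bounds (B0 : R) : 0 < B0 -> exists2 C, 1 <= C & forall n x, - B0 <= x < L0 / 2 ->
  [/\ dil n x <= C, `|ddil n x| <= C & `|dddil n x| <= C].
Proof.
move=> hB0; have [D D1 H] := sqramp_bounds.
pose P := 2 * (B0 + L0) + D * (L0 / 2).
have P0 : 0 <= P by rewrite addr_ge0// mulr_ge0// ?addr_ge0 ?divr_ge0 ?(ltW hB0) ?(ltW hL0)//; lra.
pose r := 2 / L0; have r0 : 0 <= r by rewrite divr_ge0 ?(ltW hL0).
have D0 : 0 <= D by lra.
have r3 : 0 <= r * (r * r) by apply: mulr_ge0 => //; exact: mulr_ge0.
have r5 : 0 <= r ^+ 5 by exact: exprn_ge0.
have h1 : 0 <= L0 * (2^-1 * P * (r * (r * r))).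
  by apply: mulr_ge0; [exact: ltW|apply: mulr_ge0 => //; apply: mulr_ge0].
have h2 : 0 <= L0 * (2^-1 * D * (r * (r * r)) + 3 / 4 * P ^+ 2 * r ^+ 5).
  apply: mulr_ge0; first exact: ltW.
  apply: addr_ge0; first by apply: mulr_ge0 => //; apply: mulr_ge0.
  by apply: mulr_ge0 => //; apply: mulr_ge0; [|exact: sqr_ge0].
exists (2 + L0 * (2^-1 * P * (r * (r * r))) + L0 * (2^-1 * D * (r * (r * r)) + 3 / 4 * P ^+ 2 * r ^+ 5)).
  lra.
move=> n x /andP[xB xL]; have [q dq ddq] := cutsqL n xL.
have a0 := rampscale_gt0 n.
have xn : `|x| <= B0 + L0.
  by rewrite ler_norml; apply/andP; split; have := hL0; have := hB0; lra.
have dP : `|dcutsq n x| <= P.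
  rewrite dq /dpossq normrM gtr0_norm; last by rewrite invr_gt0.
  have [h _] := H (rampscale n * x).
  apply: le_trans (ler_wpM2l _ h) _; first by rewrite invr_ge0 ltW.
  rewrite normrM (gtr0_norm a0).
  have -> : (rampscale n)^-1 * (2 * (rampscale n * `|x|) + D) = 2 * `|x| + D * (rampscale n)^-1 by field; rewrite gt_eqF.
  rewrite /P; apply: lerD; first by rewrite ler_pM2l.
  by rewrite ler_wpM2l ?rampscaleV//; lra.
have ddP : `|ddcutsq n x| <= D by rewrite ddq; have [] := H (rampscale n * x).
have rp := ltW (invheight_gt0 n x); have rle := invheight_le n x.
have rb : 0 <= invheight n x <= r by rewrite rp.
have b1 := cube_bound (ltW hL0) rb dP; have b2 := quintic_bound (ltW hL0) rb dP ddP.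
have w1 : L0 * r = 2 by rewrite mulrC (divfK (lt0r_neq0 hL0)).
split.
- apply: le_trans (ler_wpM2l (ltW hL0) rle) _; rewrite w1 -addrA lerDl; exact: addr_ge0.
- by apply: le_trans b1 _; rewrite addrAC lerDr; apply: addr_ge0.
- by apply: le_trans b2 _; rewrite lerDr; apply: addr_ge0.
Qed.

End Straight.

(** * Weak solutions and the resonance identity *)

(* Differs from the stadium by a null set; off [x = 0] the dilations [dil n] converge with
   their derivatives. *)
Definition split_stadium {R : realType} (B0 L0 : R) : set (R * R) :=
  [set p | [/\ - B0 < p.1 < L0, p.1 != 0 & 0 < p.2 < stadium_height L0 p.1]].

(* [v] and its gradient [vx], [vy] are extended by zero to the plane; [u] approximates [v]
   in H^1. *)
Definition weak_solution {R : realType} (B0 L0 E : R) (v vx vy : R * R -> R)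
    (u : nat -> R * R -> R) : Prop :=
  [/\ [/\ sqi v, sqi vx & sqi vy],
      forall p, ~ split_stadium B0 L0 p -> [/\ v p = 0, vx p = 0 & vy p = 0],
      forall n, test_function (stadium B0 L0) (u n),
      [/\ (fun n => ip (fun p => u n p - v p) (fun p => u n p - v p)) @ \oo --> (0 : R),
          (fun n => ip (fun p => dx (u n) p - vx p) (fun p => dx (u n) p - vx p)) @ \oo --> (0 : R)
        & (fun n => ip (fun p => dy (u n) p - vy p) (fun p => dy (u n) p - vy p)) @ \oo --> (0 : R)]
    & forall phi, test_function (stadium B0 L0) phi ->
        ip vx (dx phi) + ip vy (dy phi) = E * ip v phi].

Section Weak.
Context {R : realType}.
Variables (B0 L0 : R).
Hypotheses (hB0 : 0 < B0) (hL0 : 0 < L0).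
Local Notation D := (stadium B0 L0).
Local Notation O := (split_stadium B0 L0).
Local Notation M := (B0 + L0 + 1).
Local Notation bx := (\1_(box (- M) M (- M) M) : R * R -> R).

Lemma height_le x : stadium_height L0 x <= L0.
Proof.
rewrite /stadium_height; case: ifP => // _.
rewrite -[leRHS]gtr0_norm// -sqrtr_sqr ler_wsqrtr// lerBlDr lerDl sqr_ge0//.
Qed.

Lemma stadium_box p : D p -> box (- M) M (- M) M p.
Proof.
move=> [/andP[h1 h2] /andP[h3 h4]]; have h5 := height_le p.1.
by apply/boxP; split; apply/andP; split; have := hB0; have := hL0; lra.
Qed.

Lemma split_sub p : O p -> D p.
Proof. by move=> [/andP[h1 h2] _ /andP[h3 h4]]; split; rewrite !ltW. Qed.

Lemma test_nD phi p : test_function D phi -> ~ D p -> phi p = 0.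
Proof. by move=> tp nD; apply: test_eq0 tp _ => /interior_subset. Qed.

Lemma test_supp phi : test_function D phi -> supp_box M phi.
Proof.
move=> tp p pp; apply: stadium_box; apply: contrapT => nD.
by move/eqP: pp; apply; exact: test_nD nD.
Qed.

Lemma interior_slice2 (A : set (R * R)) x y : interior A (x, y) ->
  \forall z \near y, A (x, z).
Proof.
move=> [[P Q] [/= Px Qy] PQ]; near=> z; apply: (PQ (x, z)); split => /=.
  exact: nbhs_singleton.
by near: z.
Unshelve. all: by end_near. Qed.

Lemma test_bottom phi x : test_function D phi -> phi (x, 0) = 0.
Proof.
move=> tp; apply: test_eq0 tp _ => /interior_slice2 /nbhs_ballP[e /= e0 H].
have [_ /andP[/= h _]] : D (x, - (e / 2)).
  by apply: H; rewrite /ball /= opprK add0r gtr0_norm ?divr_gt0//; lra.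
by move: h; rewrite oppr_ge0 leNgt divr_gt0.
Qed.

Lemma test_top phi x : test_function D phi -> phi (x, L0) = 0.
Proof.
move=> tp; apply: test_eq0 tp _ => /interior_slice2 /nbhs_ballP[e /= e0 H].
have [_ /andP[/= _ h]] : D (x, L0 + e / 2).
  apply: H; rewrite /ball /= opprD addrA subrr sub0r normrN gtr0_norm ?divr_gt0//; lra.
by have := le_trans h (height_le x); rewrite leNgt ltrDl divr_gt0.
Qed.

Lemma test_side phi x y : test_function D phi -> ~ (- M < x < M) -> phi (x, y) = 0.
Proof.
move=> tp nx; apply: test_nD tp _ => -[/= /andP[h1 h2] _]; apply: nx.
by apply/andP; split; have := hB0; have := hL0; lra.
Qed.

Lemma test_vside phi x y : test_function D phi -> ~ (- M < y < M) -> phi (x, y) = 0.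
Proof.
move=> tp nx; apply: test_nD tp _ => -[_ /= /andP[h1 h2]]; apply: nx.
by have := height_le x; have := hB0; have := hL0; move=> *; apply/andP; split; lra.
Qed.

Lemma test_cont phi : test_function D phi -> continuous phi.
Proof. by case=> sp _ _; exact: smooth2_continuous. Qed.

Lemma sqi_bx f : continuous f -> sqi (fun p => bx p * f p).
Proof.
move=> cf; have [C C0 H] := cont_bound2 (- M) M (- M) M cf.
apply: (@sqi_bnd _ M C).
- by apply: mfun2M; [exact: mfun2_ind (meas2_box _ _ _ _)|exact: cont_mfun2].
- move=> p; have [bp|bp] := pselect (box (- M) M (- M) M p).
    by rewrite (indT bp) mul1r H.
  by rewrite (indF bp) mul0r normr0.
- move=> p; apply: contraPP => bp; rewrite (indF bp) mul0r eqxx //.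
Qed.

Lemma bx_supp h p : supp_box M h -> bx p * h p = h p.
Proof.
move=> hs; have [->|hp] := eqVneq (h p) 0; first by rewrite mulr0.
by rewrite (indT (hs p hp)) mul1r.
Qed.

Lemma sqi_test phi : test_function D phi -> sqi phi.
Proof.
move=> tp; have := sqi_bx (test_cont tp).
by rewrite (_ : (fun p => _) = phi)//; apply/funext => p; exact: (bx_supp p (test_supp tp)).
Qed.

(** A continuous function need not be square integrable on the plane; the indicator of a box around
    the stadium makes the bilinearity of [ip] available without changing the value. *)
Lemma ip_bx h f : supp_box M h -> ip h f = ip h (fun p => bx p * f p).
Proof. by move=> hs; apply: eq_ip => p; rewrite [in RHS]mulrCA [in RHS]mulrA bx_supp. Qed.

Lemma ip_addc h f g : sqi h -> supp_box M h -> continuous f -> continuous g ->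
  ip h (fun p => f p + g p) = ip h f + ip h g.
Proof.
move=> sh bh cf cg; rewrite (ip_bx f bh) (ip_bx g bh) (ip_bx _ bh) -ipDr//; [|exact: sqi_bx..].
by apply: eq_ip => p; rewrite mulrDr.
Qed.

Lemma ip_mulc (c : R) h f : sqi h -> supp_box M h -> continuous f ->
  ip h (fun p => c * f p) = c * ip h f.
Proof.
move=> sh bh cf; rewrite (ip_bx f bh) (ip_bx _ bh) -ipZr//; last exact: sqi_bx.
by apply: eq_ip => p; rewrite (mulrCA _ c).
Qed.

Lemma ip_subc h f g : sqi h -> supp_box M h -> continuous f -> continuous g ->
  ip h (fun p => f p - g p) = ip h f - ip h g.
Proof.
move=> sh bh cf cg; rewrite (ip_bx f bh) (ip_bx g bh) (ip_bx _ bh) -ipBr//; [|exact: sqi_bx..].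
by apply: eq_ip => p; rewrite mulrBr.
Qed.

Lemma integral_dx phi : test_function D phi -> \int[@lebesgue2 R]_p (bx p * dx phi p) = 0.
Proof.
move=> tp; have [sp _ _] := tp.
rewrite fub_swap; last exact/smooth2_continuous/smooth2_dx.
rewrite -[RHS](cint0 (- M) M); apply: eq_cint => y _.
rewrite (cint_der _ (smooth2_derx sp y)).
- rewrite !(test_side _ tp) ?subrr// ?ltxx ?andbF//.
- by have := hB0; have := hL0; lra.
- exact: (cont_slice1 (smooth2_continuous (smooth2_dx sp))).
Qed.

Lemma integral_dy phi : test_function D phi -> \int[@lebesgue2 R]_p (bx p * dy phi p) = 0.
Proof.
move=> tp; have [sp _ _] := tp.
rewrite fub; last exact/smooth2_continuous/smooth2_dy.
rewrite -[RHS](cint0 (- M) M); apply: eq_cint => x _.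
rewrite (cint_der _ (smooth2_dery sp x)).
- rewrite !(test_vside _ tp) ?subrr// ?ltxx ?andbF//.
- by have := hB0; have := hL0; lra.
- exact: (cont_slice2 (smooth2_continuous (smooth2_dy sp))).
Qed.

Lemma test_mul phi f : test_function D phi -> smooth2 f -> test_function D (fun p => phi p * f p).
Proof.
move=> tp sf; apply: test_functionW (tp).
  by case: tp => sp _ _; exact: smooth2M.
move=> p /= pf; apply: subset_closure => /=.
by apply: contraNneq pf => ->; rewrite mul0r.
Qed.

(** [phi f] is again a test function, so the integral of its derivative vanishes. *)
Lemma test_ibpx phi f : test_function D phi -> smooth2 f -> ip (dx phi) f = - ip phi (dx f).
Proof.
move=> tp sf; have [sp _ _] := tp.
apply/eqP; rewrite -addr_eq0; apply/eqP.
rewrite (ip_bx _ (test_supp (test_dx tp))) (ip_bx _ (test_supp tp)).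
rewrite /ip -RintegralD //; last 2 first.
- by apply: sqi_mul; [exact/sqi_test/test_dx|exact/sqi_bx/smooth2_continuous].
- by apply: sqi_mul; [exact/sqi_test|exact/sqi_bx/smooth2_continuous/smooth2_dx].
rewrite -[RHS](integral_dx (test_mul tp sf)); apply: eq_Rintegral => p _.
rewrite (derxE (derxM (smooth2_derx sp) (smooth2_derx sf))); ring.
Qed.

Lemma test_ibpy phi f : test_function D phi -> smooth2 f -> ip (dy phi) f = - ip phi (dy f).
Proof.
move=> tp sf; have [sp _ _] := tp.
apply/eqP; rewrite -addr_eq0; apply/eqP.
rewrite (ip_bx _ (test_supp (test_dy tp))) (ip_bx _ (test_supp tp)).
rewrite /ip -RintegralD //; last 2 first.
- by apply: sqi_mul; [exact/sqi_test/test_dy|exact/sqi_bx/smooth2_continuous].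
- by apply: sqi_mul; [exact/sqi_test|exact/sqi_bx/smooth2_continuous/smooth2_dy].
rewrite -[RHS](integral_dy (test_mul tp sf)); apply: eq_Rintegral => p _.
rewrite (deryE (deryM (smooth2_dery sp) (smooth2_dery sf))); ring.
Qed.

Section Sol.
Variables (E : R) (v vx vy : R * R -> R) (u : nat -> R * R -> R).
Hypothesis ws : weak_solution B0 L0 E v vx vy u.

Lemma ws_supp p : ~ O p -> [/\ v p = 0, vx p = 0 & vy p = 0].
Proof. by case: ws => _ h _ _ _; exact: h. Qed.
Lemma ws_in p : v p != 0 -> O p.
Proof. by apply: contraPP => /ws_supp[-> _ _]; rewrite eqxx. Qed.
Lemma wsx_in p : vx p != 0 -> O p.
Proof. by apply: contraPP => /ws_supp[_ -> _]; rewrite eqxx. Qed.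
Lemma wsy_in p : vy p != 0 -> O p.
Proof. by apply: contraPP => /ws_supp[_ _ ->]; rewrite eqxx. Qed.
Lemma ws_box : [/\ supp_box M v, supp_box M vx & supp_box M vy].
Proof. by split => p h; apply/stadium_box/split_sub; [exact: ws_in|exact: wsx_in|exact: wsy_in]. Qed.

(** Limit of [test_ibpx] along [u n]: the boundary term vanishes because [v] is a limit of test
    functions, whatever [f] does at the boundary. *)
Lemma ws_ibpx f : smooth2 f -> ip vx f = - ip v (dx f).
Proof.
move=> sf; have [[h0 hx hy] _ tu [c0 cx cy] _] := ws; have [b0 b1 b2] := ws_box.
have s1 := sqi_bx (smooth2_continuous sf).
have s2 := sqi_bx (smooth2_continuous (smooth2_dx sf)).
rewrite (ip_bx _ b1) (ip_bx _ b0).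
have e1 := ip_cvgl (fun n => sqi_test (test_dx (tu n))) hx s1 cx.
have /cvgN e2 := (ip_cvgl (fun n => sqi_test (tu n)) h0 s2 c0).
have e : (fun n => ip (dx (u n)) (fun p => bx p * f p)) = - (fun n => ip (u n) (fun p => bx p * dx f p)).
  apply/funext => n; rewrite fctE -(ip_bx _ (test_supp (tu n))) -test_ibpx//.
  by rewrite -(ip_bx _ (test_supp (test_dx (tu n)))).
by rewrite e in e1; rewrite -(cvg_lim (@Rhausdorff R) e1) -(cvg_lim (@Rhausdorff R) e2).
Qed.

Lemma ws_ibpy f : smooth2 f -> ip vy f = - ip v (dy f).
Proof.
move=> sf; have [[h0 hx hy] _ tu [c0 cx cy] _] := ws; have [b0 b1 b2] := ws_box.
have s1 := sqi_bx (smooth2_continuous sf).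
have s2 := sqi_bx (smooth2_continuous (smooth2_dy sf)).
rewrite (ip_bx _ b2) (ip_bx _ b0).
have e1 := ip_cvgl (fun n => sqi_test (test_dy (tu n))) hy s1 cy.
have /cvgN e2 := (ip_cvgl (fun n => sqi_test (tu n)) h0 s2 c0).
have e : (fun n => ip (dy (u n)) (fun p => bx p * f p)) = - (fun n => ip (u n) (fun p => bx p * dy f p)).
  apply/funext => n; rewrite fctE -(ip_bx _ (test_supp (tu n))) -test_ibpy//.
  by rewrite -(ip_bx _ (test_supp (test_dy (tu n)))).
by rewrite e in e1; rewrite -(cvg_lim (@Rhausdorff R) e1) -(cvg_lim (@Rhausdorff R) e2).
Qed.

(** The equation tested with [u n], in the limit. *)
Lemma ws_energy : ip vx vx + ip vy vy = E * ip v v.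
Proof.
have [[h0 hx hy] _ tu [c0 cx cy] w] := ws.
have e0 := ip_cvgl (fun n => sqi_test (tu n)) h0 h0 c0.
have e1 := ip_cvgl (fun n => sqi_test (test_dx (tu n))) hx hx cx.
have e2 := ip_cvgl (fun n => sqi_test (test_dy (tu n))) hy hy cy.
have e3 : (fun n => ip (dx (u n)) vx + ip (dy (u n)) vy) @ \oo --> ip vx vx + ip vy vy by exact: cvgD.
have e4 : (fun n => E * ip (u n) v) @ \oo --> E * ip v v by apply: cvgM => //; exact: cvg_cst.
have e : (fun n => ip (dx (u n)) vx + ip (dy (u n)) vy) = (fun n => E * ip (u n) v).
  by apply/funext => n; rewrite ![ip _ vx]ipC ![ip _ vy]ipC [ip _ v]ipC w.
by rewrite e in e3; rewrite -(cvg_lim (@Rhausdorff R) e3) -(cvg_lim (@Rhausdorff R) e4).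
Qed.

End Sol.

End Weak.

Lemma smooth1_of_der {R : realType} (f g : R -> R) : smooth1 f -> der f g -> smooth1 g.
Proof. by move=> /smooth1_der[h sh dh] dg; rewrite -(derE dg) (derE dh). Qed.

(** * Testing the equation with one mode *)

Section Identity.
Context {R : realType}.
Local Notation RR := (measurableTypeR R * measurableTypeR R)%type.
Variables (B0 L0 : R).
Hypotheses (hB0 : 0 < B0) (hL0 : 0 < L0).
Local Notation D := (stadium B0 L0).
Local Notation O := (split_stadium B0 L0).
Local Notation M := (B0 + L0 + 1).
Local Notation dil := (dil L0).
Local Notation ddil := (ddil L0).
Local Notation dddil := (dddil L0).

Variables (E k dl : R) (P P1 P2 G : R -> R).
Hypotheses (k0 : 0 <= k) (kL : sin (k * L0) = 0).
Hypotheses (dl0 : 0 < dl) (dlL : dl < L0 / 2).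
Hypotheses (sP : smooth1 P) (dP : der P P1) (dP1 : der P1 P2).
Hypothesis PB : P (- B0) = 0.
Hypothesis Pdl : forall x, dl < x -> [/\ P x = 0, P1 x = 0 & P2 x = 0].
Hypothesis PG : forall x, x < 0 -> P2 x + (E - k ^+ 2) * P x = G x.
Hypothesis cG : continuous G.

Let sP1 : smooth1 P1. Proof. exact: smooth1_of_der dP. Qed.
Let sP2 : smooth1 P2. Proof. exact: smooth1_of_der dP1. Qed.
Let sw n : smooth1 (dil n). Proof. exact: smooth1_dil. Qed.
Let dw n : der (dil n) (ddil n). Proof. exact: dil_der. Qed.
Let ddw n : der (ddil n) (dddil n). Proof. exact: ddil_der. Qed.

Definition trial n (p : R * R) := P p.1 * sin (k * (p.2 * dil n p.1)).
Definition trialx n (p : R * R) := P1 p.1 * sin (k * (p.2 * dil n p.1)) +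
  P p.1 * (cos (k * (p.2 * dil n p.1)) * (k * (p.2 * ddil n p.1))).
Definition trialy n (p : R * R) := P p.1 * (cos (k * (p.2 * dil n p.1)) * (k * dil n p.1)).
Definition trialxx n (p : R * R) :=
  P2 p.1 * sin (k * (p.2 * dil n p.1)) +
  2 * P1 p.1 * (cos (k * (p.2 * dil n p.1)) * (k * (p.2 * ddil n p.1))) +
  P p.1 * (- sin (k * (p.2 * dil n p.1)) * (k * (p.2 * ddil n p.1)) * (k * (p.2 * ddil n p.1)) +
           cos (k * (p.2 * dil n p.1)) * (k * (p.2 * dddil n p.1))).
Definition trialyy n (p : R * R) := P p.1 * (- sin (k * (p.2 * dil n p.1)) * (k * dil n p.1) * (k * dil n p.1)).
Definition lap_trial n (p : R * R) := trialxx n p + trialyy n p + E * trial n p.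

Lemma smooth2_arg n : smooth2 (fun p : R * R => p.2 * dil n p.1).
Proof. exact: (smooth2M (@smooth2_snd R (fun y => y) smooth1_id) (@smooth2_fst R (dil n) (@sw n))). Qed.

Lemma trial_smooth n : smooth2 (trial n).
Proof.
apply: (smooth2M (smooth2_fst sP)).
apply: (@smooth2_comp _ (fun t => sin (k * t)) (fun p => p.2 * dil n p.1)); first exact: smooth1_sinM.
exact: smooth2_arg.
Qed.

Lemma trial_derx n : derx (trial n) (trialx n).
Proof.
move=> y /=; rewrite /trial /trialx /=.
exact: (derM dP (der_comp der_sin (derZ k (derZ y (@dw n))))).
Qed.

Lemma trialx_derx n : derx (trialx n) (trialxx n).
Proof.
move=> y; rewrite /trialx /trialxx /=.
have darg : der (fun x => k * (y * dil n x)) (fun x => k * (y * ddil n x)) by do 2 apply: derZ.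
have ddarg : der (fun x => k * (y * ddil n x)) (fun x => k * (y * dddil n x)) by do 2 apply: derZ.
apply: der_eq (derD (derM dP1 (der_comp der_sin darg)) (derM dP (derM (der_comp der_cos darg) ddarg))) _ => x.
by ring.
Qed.

Lemma darg_y (a : R) : der (fun y => k * (y * a)) (fun=> k * a).
Proof.
apply: der_eq (derZ k (derM der_id (der_cst a))) _ => y.
by rewrite mul1r mulr0 addr0.
Qed.

Lemma trial_dery n : dery (trial n) (trialy n).
Proof.
by move=> x; rewrite /trial /trialy /=; apply/derZ/(der_comp der_sin)/darg_y.
Qed.

Lemma trialy_dery n : dery (trialy n) (trialyy n).
Proof.
move=> x; rewrite /trialy /trialyy /=; apply: derZ.
apply: der_eq (derM (der_comp der_cos (darg_y _)) (der_cst _)) _ => y.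
by ring.
Qed.

Lemma trialx_smooth n : smooth2 (trialx n).
Proof. by rewrite -(derxE (trial_derx n)); exact: smooth2_dx (trial_smooth n). Qed.
Lemma trialy_smooth n : smooth2 (trialy n).
Proof. by rewrite -(deryE (trial_dery n)); exact: smooth2_dy (trial_smooth n). Qed.
Lemma trialxx_smooth n : smooth2 (trialxx n).
Proof. by rewrite -(derxE (trialx_derx n)); exact: smooth2_dx (trialx_smooth n). Qed.
Lemma trialyy_smooth n : smooth2 (trialyy n).
Proof. by rewrite -(deryE (trialy_dery n)); exact: smooth2_dy (trialy_smooth n). Qed.
Lemma cont_trial n : continuous (trial n). Proof. exact/smooth2_continuous/trial_smooth. Qed.
Lemma cont_trialx n : continuous (trialx n). Proof. exact/smooth2_continuous/trialx_smooth. Qed.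
Lemma cont_trialy n : continuous (trialy n). Proof. exact/smooth2_continuous/trialy_smooth. Qed.

Lemma smooth2_cst (c : R) : smooth2 (fun=> c : R).
Proof. exact: (@smooth2_fst R (fun=> c) (@smooth1_cst R c)). Qed.

Lemma lap_trial_smooth n : smooth2 (lap_trial n).
Proof.
apply: smooth2D; first by apply: smooth2D; [exact: trialxx_smooth|exact: trialyy_smooth].
by apply: smooth2M; [exact: smooth2_cst|exact: trial_smooth].
Qed.

(* [trial n] need not vanish near the boundary of the stadium, so it is cut off within [2 / n] of
   it; as [n] grows the derivatives of the cutoff stay bounded against [trial n]. *)
Definition leftcut n (x : R) := rho (n.+1%:R * x + (n.+1%:R * B0 - 1)).
Definition dleftcut n (x : R) := n.+1%:R * drho (n.+1%:R * x + (n.+1%:R * B0 - 1)).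
Definition fibrecut n (t : R) := rho (n.+1%:R * t - 1) * rho (- n.+1%:R * t + (n.+1%:R * L0 - 1)).
Definition dfibrecut1 n (t : R) := n.+1%:R * drho (n.+1%:R * t - 1).
Definition dfibrecut2 n (t : R) := - n.+1%:R * drho (- n.+1%:R * t + (n.+1%:R * L0 - 1)).
Definition dfibrecut n (t : R) := dfibrecut1 n t * rho (- n.+1%:R * t + (n.+1%:R * L0 - 1)) + rho (n.+1%:R * t - 1) * dfibrecut2 n t.

Lemma rho_affine (a b : R) : der (fun t => rho (a * t + b)) (fun t => a * drho (a * t + b)).
Proof. by apply: der_eq (der_comp rho_der (der_affine a b)) _ => t; rewrite mulrC. Qed.

Lemma smooth1_rho_affine (a b : R) : smooth1 (fun t => rho (a * t + b)).
Proof. by apply: (@smooth1_comp _ rho); [exact: smooth1_rho|exact: smooth1_affine]. Qed.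

Lemma leftcut_der n : der (leftcut n) (dleftcut n). Proof. exact: rho_affine. Qed.
Lemma fibrecut_der n : der (fibrecut n) (dfibrecut n).
Proof. exact: (derM (rho_affine _ _) (rho_affine _ _)). Qed.

Definition cut n (p : R * R) := leftcut n p.1 * fibrecut n (p.2 * dil n p.1).
Definition cutx n (p : R * R) := dleftcut n p.1 * fibrecut n (p.2 * dil n p.1) + leftcut n p.1 * (dfibrecut n (p.2 * dil n p.1) * (p.2 * ddil n p.1)).
Definition cuty n (p : R * R) := leftcut n p.1 * (dfibrecut n (p.2 * dil n p.1) * dil n p.1).

Lemma cut_derx n : derx (cut n) (cutx n).
Proof.
move=> y; rewrite /cut /cutx /=; apply: derM; first exact: leftcut_der.
by apply: (der_comp (@fibrecut_der n)); exact: derZ.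
Qed.
Lemma cut_dery n : dery (cut n) (cuty n).
Proof.
move=> x; rewrite /cut /cuty /=; apply/derZ/(der_comp (@fibrecut_der n)).
by apply: der_eq (derM der_id (der_cst _)) _ => y; rewrite mul1r mulr0 addr0.
Qed.
Lemma cut_smooth n : smooth2 (cut n).
Proof.
apply: smooth2M; first exact/smooth2_fst/smooth1_rho_affine.
apply: (@smooth2_comp _ (fibrecut n) (fun p => p.2 * dil n p.1)).
  by apply: smooth1M; exact: smooth1_rho_affine.
exact: smooth2_arg.
Qed.

Definition cut_trial n (p : R * R) := cut n p * trial n p.

(* [a <= x <= dl], [a <= y w <= L0 - a] with [a] small is a compact subset of
   the open set [- B0 < x < L0 / 2], [0 < y w < L0] of the stadium. *)
Lemma cut_trial_test n : test_function D (cut_trial n).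
Proof.
have st : smooth2 (cut_trial n) by apply: smooth2M; [exact: cut_smooth|exact: trial_smooth].
have m0 : 0 < n.+1%:R :> R by [].
pose a : R := n.+1%:R^-1; have a0 : 0 < a by rewrite invr_gt0.
have cx : continuous (fun p : R * R => p.1) by move=> p; exact: cvg_fst.
have cy : continuous (fun p : R * R => p.2 * dil n p.1).
  exact: smooth2_continuous (smooth2_arg n).
pose F : set (R * R) := [set p | [/\ - B0 + a <= p.1, p.1 <= dl, a <= p.2 * dil n p.1 & p.2 * dil n p.1 <= L0 - a]].
have cF : closed F.
  rewrite (_ : F = ((fun p : R * R => p.1) @^-1` [set x | - B0 + a <= x] `&`
     (fun p : R * R => p.1) @^-1` [set x | x <= dl]) `&`
     ((fun p : R * R => p.2 * dil n p.1) @^-1` [set x | a <= x] `&`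
     (fun p : R * R => p.2 * dil n p.1) @^-1` [set x | x <= L0 - a])); last first.
    by apply/seteqP; split => [p [? ? ? ?]|p [[? ?] [? ?]]].
  do 2 apply: closedI; apply: closed_comp => //.
pose U : set (R * R) := [set p | [/\ - B0 < p.1, p.1 < L0 / 2, 0 < p.2 * dil n p.1 & p.2 * dil n p.1 < L0]].
have oU : open U.
  rewrite (_ : U = ((fun p : R * R => p.1) @^-1` [set x | - B0 < x] `&`
     (fun p : R * R => p.1) @^-1` [set x | x < L0 / 2]) `&`
     ((fun p : R * R => p.2 * dil n p.1) @^-1` [set x | 0 < x] `&`
     (fun p : R * R => p.2 * dil n p.1) @^-1` [set x | x < L0])); last first.
    by apply/seteqP; split => [p [? ? ? ?]|p [[? ?] [? ?]]].
  do 2 apply: openI; apply: open_comp => //.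
have UD : U `<=` D.
  move=> [x y] [/= h1 h2 h3 h4]; have w1 := dil_ge1 hL0 n x.
  have w0 : 0 < dil n x by apply: lt_le_trans w1.
  have y0 : 0 < y by rewrite -(pmulr_lgt0 _ w0).
  split=> /=; first by apply/andP; split; have := hL0; lra.
  rewrite (ltW y0) /=; have [x0|x0] := leP x 0.
    rewrite /stadium_height x0; apply: le_trans (ltW h4).
    by rewrite ler_peMr// ltW.
  have wE : dil n x = L0 / stadium_height L0 x by apply: dilR => //; rewrite ltW.
  have H0 : 0 < stadium_height L0 x.
    by have := w0; rewrite wE pmulr_rgt0// invr_gt0.
  move: h4; rewrite wE mulrCA -ltr_pdivlMl// mulVf ?gt_eqF// ltr_pdivrMr// mul1r.
  exact: ltW.
have FU : F `<=` U.
  by move=> p [h1 h2 h3 h4]; split; have := dlL; lra.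
have tF : [set p | cut_trial n p != 0] `<=` F.
  move=> [x y] /= h.
  have c1 : rho (n.+1%:R * x + (n.+1%:R * B0 - 1)) != 0.
    by apply: contraNneq h => c; rewrite /cut_trial /cut /leftcut /= c !mul0r.
  have c2 : rho (n.+1%:R * (y * dil n x) - 1) != 0.
    by apply: contraNneq h => c; rewrite /cut_trial /cut /fibrecut /= c mul0r mulr0 mul0r.
  have c3 : rho (- n.+1%:R * (y * dil n x) + (n.+1%:R * L0 - 1)) != 0.
    by apply: contraNneq h => c; rewrite /cut_trial /cut /fibrecut /= c !mulr0 mul0r.
  have c4 : P x != 0 by apply: contraNneq h => c; rewrite /cut_trial /trial /= c mul0r mulr0.
  have rn (z : R) : rho z != 0 -> 0 < z.
    by apply: contraNT; rewrite -leNgt => /rho0 ->.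
  have {}c1 := rn _ c1; have {}c2 := rn _ c2; have {}c3 := rn _ c3.
  have am : n.+1%:R * a = 1 by rewrite divff// gt_eqF.
  split => /=.
  - rewrite -(ler_pM2l m0) mulrDr am; lra.
  - by rewrite leNgt; apply: contra c4 => /Pdl[-> _ _]; rewrite eqxx.
  - rewrite -(ler_pM2l m0) am; lra.
  - rewrite -(ler_pM2l m0) mulrBr am; lra.
have tF' : closure [set p | cut_trial n p != 0] `<=` F.
  by rewrite [X in _ `<=` X](closure_id _).1//; exact: closure_subset.
split => //.
  apply: (subclosed_compact (@closed_closure _ _) (compact_setX (@segment_compact _ (- M) M) (@segment_compact _ (- M) M))).
  by move=> p /tF'/FU/UD/(stadium_box hB0 hL0).
apply: subset_trans tF' _; apply: subset_trans FU _.
by rewrite -open_subsetE.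
Qed.


(** Uniform in [n]. The restriction to [p.1 <= dl] keeps the abscissa below [L0 / 2], where
    [dil_bounds] applies; beyond [dl] the trial functions vanish. *)
Definition ubd (f : nat -> R * R -> R) :=
  exists C, forall n p, O p -> p.1 <= dl -> `|f n p| <= C.

Lemma ubdD f g : ubd f -> ubd g -> ubd (fun n p => f n p + g n p).
Proof.
move=> [C h] [C' h']; exists (C + C') => n p Op pd.
by apply: le_trans (ler_normD _ _) _; rewrite lerD ?h ?h'.
Qed.
Lemma ubdM f g : ubd f -> ubd g -> ubd (fun n p => f n p * g n p).
Proof.
move=> [C h] [C' h']; exists (C * C') => n p Op pd.
by rewrite normrM ler_pM ?h ?h'.
Qed.
Lemma ubdN f : ubd f -> ubd (fun n p => - f n p).
Proof. by move=> [C h]; exists C => n p Op pd; rewrite normrN h. Qed.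
Lemma ubd_cst (c : R) : ubd (fun _ _ => c).
Proof. by exists `|c|. Qed.
Lemma ubd_le1 (f : nat -> R * R -> R) : (forall n p, `|f n p| <= 1) -> ubd f.
Proof. by move=> h; exists 1. Qed.

Lemma inner_x p : O p -> p.1 <= dl -> - B0 <= p.1 < L0 / 2.
Proof. by move=> [/andP[h1 h2] _ _] pd; have := dlL; lra. Qed.

Lemma ubd_x (f : R -> R) : continuous f -> ubd (fun _ p => f p.1).
Proof.
move=> cf; have [C _ H] := cont_bound (- B0) (L0 / 2) cf.
by exists C => n p Op /(inner_x Op)/andP[h1 h2]; apply: H; rewrite h1 ltW.
Qed.
Lemma ubd_y : ubd (fun _ p => p.2).
Proof.
exists L0 => n p [_ _ /andP[h1 h2]] _; rewrite gtr0_norm//.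
exact: le_trans (ltW h2) (height_le hL0 _).
Qed.
Lemma ubd_w : [/\ ubd (fun n p => dil n p.1), ubd (fun n p => ddil n p.1) & ubd (fun n p => dddil n p.1)].
Proof.
have [C C1 H] := dil_bounds hL0 hB0.
have H' n p : O p -> p.1 <= dl -> [/\ dil n p.1 <= C, `|ddil n p.1| <= C & `|dddil n p.1| <= C].
  by move=> Op pd; apply: H; exact: inner_x.
split; exists C => n p Op pd; have [h1 h2 h3] := H' n p Op pd => //.
by rewrite ger0_norm// (le_trans ler01)// dil_ge1.
Qed.
Lemma ubd_sin f : ubd (fun n p => sin (f n p)).
Proof. by apply: ubd_le1 => n p; rewrite ler_norml sin_geN1 sin_le1. Qed.
Lemma ubd_cos f : ubd (fun n p => cos (f n p)).
Proof. by apply: ubd_le1 => n p; rewrite ler_norml cos_geN1 cos_le1. Qed.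
Lemma ubd_rho f : ubd (fun n p => rho (f n p)).
Proof. by apply: ubd_le1 => n p; rewrite ger0_norm ?rho_le1// rho_ge0. Qed.

Lemma ubd_P : [/\ ubd (fun _ p => P p.1), ubd (fun _ p => P1 p.1) & ubd (fun _ p => P2 p.1)].
Proof. by split; apply: ubd_x; exact: smooth1_continuous. Qed.

Lemma ubd_ph : ubd trial.
Proof. by have [h _ _] := ubd_P; apply: ubdM => //; exact: ubd_sin. Qed.
Lemma ubd_kdw : ubd (fun n p => k * (p.2 * ddil n p.1)).
Proof.
have [_ h _] := ubd_w; apply: ubdM; first exact: ubd_cst.
by apply: ubdM => //; exact: ubd_y.
Qed.
Lemma ubd_kw : ubd (fun n p => k * dil n p.1).
Proof. by have [h _ _] := ubd_w; apply: ubdM => //; exact: ubd_cst. Qed.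
Lemma ubd_phx : ubd trialx.
Proof.
have [h h1 _] := ubd_P; apply: ubdD; first by apply: ubdM => //; exact: ubd_sin.
by apply: ubdM => //; apply: ubdM; [exact: ubd_cos|exact: ubd_kdw].
Qed.
Lemma ubd_phy : ubd trialy.
Proof.
by have [h h1 _] := ubd_P; apply: ubdM => //; apply: ubdM; [exact: ubd_cos|exact: ubd_kw].
Qed.
Lemma ubd_lap : ubd lap_trial.
Proof.
have [h h1 h2] := ubd_P; have [_ _ w2] := ubd_w.
have kd := ubd_kdw; have kw := ubd_kw.
apply: ubdD; last by apply: ubdM; [exact: ubd_cst|exact: ubd_ph].
apply: ubdD.
  apply: ubdD.
    apply: ubdD; first by apply: ubdM => //; exact: ubd_sin.
    apply: ubdM; first by apply: ubdM => //; exact: ubd_cst.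
    by apply: ubdM => //; exact: ubd_cos.
  apply: ubdM => //; apply: ubdD.
    by do 2 apply: ubdM => //; apply: ubdN; exact: ubd_sin.
  apply: ubdM; first exact: ubd_cos.
  by apply: ubdM; [exact: ubd_cst|apply: ubdM => //; exact: ubd_y].
by apply: ubdM => //; do 2 apply: ubdM => //; apply: ubdN; exact: ubd_sin.
Qed.

(** The derivative of the cutoff has size [n], but only at distance at most [2 / (n + 1)] from
    [x = - B0], where [P (- B0) = 0] makes [P] of size [1 / n]. *)
Lemma ubd_dct : ubd (fun n p => dleftcut n p.1 * P p.1).
Proof.
have [C C1 H] := @rho_bound R.
have [D D0 HD] := cont_bound (- B0) (L0 / 2) (smooth1_continuous sP1).
exists (2 * C * D) => n p Op pd; have /andP[h1 h2] := inner_x Op pd.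
have m0 : 0 < n.+1%:R :> R by [].
have PD : `|P p.1| <= D * (p.1 - - B0).
  by apply: (der_bnd_aux dP PB (c := L0 / 2)); rewrite ?h1 ?ltW// => x; exact: HD.
rewrite /dleftcut !normrM (gtr0_norm m0).
set z := (_ + (_ - 1)); have [_ Hz _] := H z.
have [z1|z1] := ltP 1 z.
  by rewrite drho0 ?z1 ?orbT// normr0 mulr0 mul0r; apply: mulr_ge0 => //; lra.
have z2 : n.+1%:R * (p.1 + B0) <= 2 by move: z1; rewrite /z mulrDr; lra.
have PD' : n.+1%:R * `|P p.1| <= D * 2.
  apply: le_trans (ler_wpM2l (ltW m0) PD) _; rewrite opprK mulrCA.
  exact: ler_wpM2l.
rewrite mulrAC; have := ler_pM (mulr_ge0 (ltW m0) (normr_ge0 _)) (normr_ge0 _) PD' Hz.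
by rewrite [X in _ <= X -> _]mulrAC mulrC [X in _ <= X -> _]mulrC; lra.
Qed.

(** The same compensation at the two ends of a fibre: [sin (k t)] vanishes at [t = 0] and, by [kL],
    at [t = L0]. *)
Lemma dfibrecut_sin : exists C, forall n t, `|dfibrecut n t * sin (k * t)| <= C.
Proof.
have [C C1 H] := @rho_bound R; exists (2 * k * C + 2 * k * C) => n t.
have m0 : 0 < n.+1%:R :> R by [].
have bC : 0 <= 2 * k * C by apply: mulr_ge0; [apply: mulr_ge0|lra].
have key (a b z : R) : 0 <= a -> `|b| <= k * a -> `|drho z| <= C -> n.+1%:R * a <= 2 ->
    `|n.+1%:R * drho z * b| <= 2 * k * C.
  move=> a0 ba dC ma; rewrite !normrM (gtr0_norm m0) mulrAC.
  apply: ler_pM => //.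
  apply: le_trans (ler_wpM2l (ltW m0) ba) _.
  by rewrite mulrCA mulrC; exact: ler_wpM2r.
have r1 (z : R) : `|rho z| <= 1 by rewrite ger0_norm ?rho_le1 ?rho_ge0.
rewrite /dfibrecut mulrDl; apply: le_trans (ler_normD _ _) _; apply: lerD.
  rewrite mulrAC normrM; apply: le_trans (_ : `|dfibrecut1 n t * sin (k * t)| * 1 <= _).
    by apply: ler_wpM2l.
  rewrite mulr1 /dfibrecut1; set z := n.+1%:R * t - 1.
  have [zo|] := boolP ((z < 0) || (1 < z)); first by rewrite drho0// mulr0 mul0r normr0.
  rewrite negb_or -!leNgt => /andP[z0 z1]; have [_ dz _] := H z.
  have t0 : 0 <= t by rewrite -(pmulr_rge0 _ m0); move: z0; rewrite /z; lra.
  apply: (key t) => //; last by move: z1; rewrite /z; lra.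
  have B := @der_bnd_aux R 0 t _ _ k (der_sinM k).
  rewrite -[X in _ <= _ * X](subr0 t); apply: B.
  - by rewrite mulr0 sin0.
  - by move=> x _; rewrite normrM (ger0_norm k0) ler_piMr// ler_norml cos_geN1 cos_le1.
  - by rewrite t0 lexx.
rewrite -mulrA normrM; apply: le_trans (_ : 1 * `|dfibrecut2 n t * sin (k * t)| <= _).
  by apply: ler_wpM2r.
rewrite mul1r /dfibrecut2; set z := (_ + (_ - 1)).
have [zo|] := boolP ((z < 0) || (1 < z)); first by rewrite drho0// mulr0 mul0r normr0.
rewrite negb_or -!leNgt => /andP[z0 z1]; have [_ dz _] := H z.
have zE : n.+1%:R * (L0 - t) = z + 1 by rewrite /z; ring.
have t0 : 0 <= L0 - t by rewrite -(pmulr_rge0 _ m0) zE; lra.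
rewrite mulNr mulNr normrN; apply: (key (L0 - t)) => //; last by rewrite zE; lra.
have dF : der (fun u => sin (k * (L0 - u))) (fun u => cos (k * (L0 - u)) * (k * (0 - 1))).
  exact: (der_comp der_sin (derZ k (derB (der_cst L0) der_id))).
have B := @der_bnd_aux R 0 (L0 - t) _ _ k dF.
rewrite -[X in _ <= _ * X](subr0 (L0 - t)) -[X in sin (k * X)](subKr L0 t); apply: B.
- by rewrite subr0.
- move=> x _; rewrite sub0r mulrN1 normrM normrN (ger0_norm k0) ler_piMl//.
  by rewrite ler_norml cos_geN1 cos_le1.
- by rewrite t0 lexx.
Qed.

Lemma archi_ev (a : R) : 0 < a -> exists N, forall n, (N <= n)%N -> 2 < n.+1%:R * a.
Proof.
move=> a0; exists (Num.truncn (2 / a)) => n Nn.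
rewrite -ltr_pdivrMr//; apply: lt_le_trans (truncnS_gt _) _.
by rewrite ler_nat ltnS.
Qed.

Lemma arg_ev p : O p -> p.1 <= dl -> exists t N, 0 < t < L0 /\
  forall n, (N <= n)%N -> p.2 * dil n p.1 = t.
Proof.
case: p => x y [/= /andP[h1 h2] x0 /andP[h3 h4]] xd; have [x1|x1] := ltP x 0.
  have [N H] := dilL hL0 x1; exists y, N; split.
    by rewrite h3 /=; apply: lt_le_trans h4 (height_le hL0 _).
  by move=> n /H[-> _ _]; rewrite mulr1.
have wE n : dil n x = L0 / stadium_height L0 x.
  by apply: dilR => //; rewrite x1 (le_lt_trans xd dlL).
exists (y * (L0 / stadium_height L0 x)), 0; split; last by move=> n _; rewrite /= wE.
have H0 : 0 < stadium_height L0 x by exact: lt_trans h4.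
apply/andP; split; first by rewrite mulr_gt0// divr_gt0.
by rewrite mulrCA gtr_pMr// ltr_pdivrMr// mul1r.
Qed.

(** A fixed point of [O] leaves the shrinking layers in which the cutoff acts, and its stretched
    ordinate is eventually constant; pointwise convergence is thus eventual equality. *)
Lemma cut_ev p : O p -> p.1 <= dl -> exists N, forall n, (N <= n)%N ->
  [/\ cut n p = 1, cutx n p = 0 & cuty n p = 0].
Proof.
move=> Op pd; have [t [N1 [/andP[t0 tL] Ht]]] := arg_ev Op pd.
have xB : 0 < p.1 + B0 by case: Op => /andP[h1 h2] _ _; lra.
have tL' : 0 < L0 - t by rewrite subr_gt0.
have [N2 H2] := archi_ev xB; have [N3 H3] := archi_ev t0; have [N4 H4] := archi_ev tL'.
exists (maxn (maxn N1 N2) (maxn N3 N4)) => n; rewrite !geq_max => /andP[/andP[n1 n2] /andP[n3 n4]].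
have {}H2 := H2 n n2; have {}H3 := H3 n n3; have {}H4 := H4 n n4.
rewrite /cut /cutx /cuty (Ht n n1) /leftcut /dleftcut /fibrecut /dfibrecut /dfibrecut1 /dfibrecut2.
have z1 : 1 < n.+1%:R * p.1 + (n.+1%:R * B0 - 1) by move: H2; rewrite mulrDr; lra.
have z2 : 1 < n.+1%:R * t - 1 by lra.
have z3 : 1 < - n.+1%:R * t + (n.+1%:R * L0 - 1) by move: H4; rewrite mulrBr mulNr; lra.
rewrite !rho1 ?(ltW z1) ?(ltW z2) ?(ltW z3)// !drho0 ?z1 ?z2 ?z3 ?orbT//.
by split; ring.
Qed.

Lemma cvg_ev (f : nat -> R) (l : R) : (exists N, forall n, (N <= n)%N -> f n = l) -> f @ \oo --> l.
Proof.
move=> [N H]; apply: cvg_near_cst.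
by exists N => // n /= Nn; apply/eqP; exact: H.
Qed.

Lemma trial_out n p : dl < p.1 -> [/\ trial n p = 0, trialx n p = 0, trialy n p = 0 & lap_trial n p = 0].
Proof.
move=> /Pdl[e0 e1 e2]; rewrite /lap_trial /trial /trialx /trialy /trialxx /trialyy e0 e1 e2.
by split; ring.
Qed.

Lemma ip_lim0 (h : R * R -> R) (f : nat -> R * R -> R) f0 :
  sqi h -> (forall p, h p != 0 -> O p) -> (forall n, mfun2 (f n)) -> mfun2 f0 -> ubd f ->
  (forall n p, dl < p.1 -> f n p = 0) -> (forall p, dl < p.1 -> f0 p = 0) ->
  (forall p, O p -> p.1 <= dl -> exists N, forall n, (N <= n)%N -> f n p = f0 p) ->
  (fun n => ip h (f n)) @ \oo --> ip h f0.
Proof.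
move=> sh hO mf mf0 [C fC] fd f0d fe.
apply: (@dct R M `|C|) => //.
- by move=> p /hO Op; apply: (stadium_box hB0 hL0); exact: split_sub.
- move=> n p /hO Op; have [pd|pd] := leP p.1 dl; last by rewrite fd// normr0.
  exact: le_trans (fC n p Op pd) (ler_norm _).
- move=> p /hO Op; apply: cvg_ev; have [pd|pd] := leP p.1 dl; first exact: fe.
  by exists 0 => n _; rewrite fd// f0d.
Qed.

Lemma ubd_cut_err (f : nat -> R * R -> R) : ubd f -> ubd (fun n p => f n p - cut n p * f n p).
Proof.
move=> hf; apply: ubdD => //; apply: ubdN; apply: ubdM => //.
by apply: ubdM; [exact: ubd_rho|apply: ubdM; exact: ubd_rho].
Qed.

Lemma ubd_eta : ubd (fun n p => fibrecut n (p.2 * dil n p.1)).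
Proof. by apply: ubdM; exact: ubd_rho. Qed.

Lemma ubd_deta_sin : ubd (fun n p => dfibrecut n (p.2 * dil n p.1) * sin (k * (p.2 * dil n p.1))).
Proof. by have [C H] := dfibrecut_sin; exists C => n p _ _; exact: H. Qed.

(** The terms are regrouped so that each large derivative of a cutoff meets the factor of [trial n]
    that vanishes where it lives: [P] at [- B0], the sine at the ends of a fibre. *)
Lemma ubd_cutx_ph : ubd (fun n p => cutx n p * trial n p).
Proof.
have [pb _ _] := ubd_P; have [_ w1 _] := ubd_w.
suff : ubd (fun n p => (dleftcut n p.1 * P p.1) * (fibrecut n (p.2 * dil n p.1) * sin (k * (p.2 * dil n p.1))) +
   leftcut n p.1 * ((dfibrecut n (p.2 * dil n p.1) * sin (k * (p.2 * dil n p.1))) * ((p.2 * ddil n p.1) * P p.1))).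
  by move=> [C H]; exists C => n p Op pd; rewrite (le_trans _ (H n p Op pd))// /cutx /trial le_eqVlt; apply/orP; left; apply/eqP; congr (`|_|); ring.
apply: ubdD.
  by apply: ubdM; [exact: ubd_dct|apply: ubdM; [exact: ubd_eta|exact: ubd_sin]].
apply: ubdM; first exact: ubd_rho.
apply: ubdM; first exact: ubd_deta_sin.
by apply: ubdM => //; apply: ubdM => //; exact: ubd_y.
Qed.

Lemma ubd_cuty_ph : ubd (fun n p => cuty n p * trial n p).
Proof.
have [pb _ _] := ubd_P; have [w1 _ _] := ubd_w.
suff : ubd (fun n p => leftcut n p.1 * ((dfibrecut n (p.2 * dil n p.1) * sin (k * (p.2 * dil n p.1))) * (dil n p.1 * P p.1))).
  by move=> [C H]; exists C => n p Op pd; rewrite (le_trans _ (H n p Op pd))// /cuty /trial le_eqVlt; apply/orP; left; apply/eqP; congr (`|_|); ring.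
apply: ubdM; first exact: ubd_rho.
by apply: ubdM; [exact: ubd_deta_sin|exact: ubdM].
Qed.

Definition err n p := trial n p - cut n p * trial n p.
Definition errx n p := (trialx n p - cut n p * trialx n p) - cutx n p * trial n p.
Definition erry n p := (trialy n p - cut n p * trialy n p) - cuty n p * trial n p.

Lemma cut_trial_dx n p : dx (cut_trial n) p = cutx n p * trial n p + cut n p * trialx n p.
Proof. by rewrite (derxE (derxM (@cut_derx n) (@trial_derx n))). Qed.
Lemma cut_trial_dy n p : dy (cut_trial n) p = cuty n p * trial n p + cut n p * trialy n p.
Proof. by rewrite (deryE (deryM (@cut_dery n) (@trial_dery n))). Qed.

(** Where [p] lies in [O] and [p.1 <= dl], the pointwise limit of [lap_trial n]: to the left the
    mode equation leaves [G] times the sine, to the right the index [0] stands for all [n]. *)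
Definition limit_fun (p : R * R) : R :=
  \1_[set p : R * R | p.1 < 0] p * (G p.1 * sin (k * p.2)) + (1 - \1_[set p : R * R | p.1 < 0] p) * lap_trial 0 p.

Variables (v vx vy : R * R -> R) (u : nat -> R * R -> R).
Hypothesis ws : weak_solution B0 L0 E v vx vy u.

Lemma ip_lap n : ip v (lap_trial n) = - (ip vx (trialx n) + ip vy (trialy n) - E * ip v (trial n)).
Proof.
have [[sv _ _] _ _ _ _] := ws; have [bv _ _] := ws_box hB0 hL0 ws.
rewrite (ws_ibpx hB0 hL0 ws (trialx_smooth n)) (ws_ibpy hB0 hL0 ws (trialy_smooth n)).
rewrite (derxE (trialx_derx n)) (deryE (trialy_dery n)).
have c1 := smooth2_continuous (trialxx_smooth n).
have c2 := smooth2_continuous (trialyy_smooth n).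
have c3 := @cont_trial n.
have c12 : continuous (fun p => trialxx n p + trialyy n p).
  by apply: smooth2_continuous; apply: smooth2D; [exact: trialxx_smooth|exact: trialyy_smooth].
have c4 : continuous (fun p => E * trial n p).
  by apply: smooth2_continuous; apply: smooth2M; [exact: smooth2_cst|exact: trial_smooth].
rewrite /lap_trial (ip_addc sv bv c12 c4) (ip_addc sv bv c1 c2) (ip_mulc E sv bv c3).
by ring.
Qed.

Lemma meas2_left : meas2 [set p : R * R | p.1 < 0].
Proof.
rewrite (_ : [set p | _] = (fst : RR -> R) @^-1` `]-oo, 0[).
  by rewrite -[X in meas2 X]setTI; apply: measurable_fst => //; exact: measurable_itv.
by apply/seteqP; split => p /=; rewrite in_itv.
Qed.

(** The weak equation applies to the admissible [cut_trial n], so only the errors made by the cutoff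
    remain. *)
Lemma ip_split n : ip vx (trialx n) + ip vy (trialy n) - E * ip v (trial n) =
  ip vx (errx n) + ip vy (erry n) - E * ip v (err n).
Proof.
have [[sv sx sy] _ _ _ w] := ws; have [bv bvx bvy] := ws_box hB0 hL0 ws.
have tt := cut_trial_test n; have [st _ _] := tt.
have c0 := smooth2_continuous st.
have cx := smooth2_continuous (smooth2_dx st).
have cy := smooth2_continuous (smooth2_dy st).
have := w _ tt.
have -> : ip vx (errx n) = ip vx (trialx n) - ip vx (dx (cut_trial n)).
  rewrite -(ip_subc sx bvx (@cont_trialx n) cx).
  by apply: eq_ip => p; rewrite cut_trial_dx /errx; ring.
have -> : ip vy (erry n) = ip vy (trialy n) - ip vy (dy (cut_trial n)).
  rewrite -(ip_subc sy bvy (@cont_trialy n) cy).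
  by apply: eq_ip => p; rewrite cut_trial_dy /erry; ring.
have -> : ip v (err n) = ip v (trial n) - ip v (cut_trial n).
  by rewrite -(ip_subc sv bv (@cont_trial n) c0).
move: (ip vx (trialx n)) (ip vy (trialy n)) (ip v (trial n)) (ip vx (dx _)) (ip vy (dy _)) (ip v (cut_trial n)) => a b c a' b' c' h.
by rewrite mulrBr -h; ring.
Qed.

(** The limit of [ip v (lap_trial n)] is computed twice: it is [0] because [ip_lap] and [ip_split]
    reduce it to cutoff errors, and [ip v limit_fun] by dominated convergence. *)
Lemma weak_identity : ip v limit_fun = 0.
Proof.
have [[sv sx sy] _ _ _ _] := ws.
have mc (f : R * R -> R) : smooth2 f -> mfun2 f by move=> sf; exact: (cont_mfun2 (smooth2_continuous sf)).
have m0 n : mfun2 (trial n) by exact: (mc _ (@trial_smooth n)).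
have m1 n : mfun2 (trialx n) by exact: (mc _ (@trialx_smooth n)).
have m2 n : mfun2 (trialy n) by exact: (mc _ (@trialy_smooth n)).
have mcut n : mfun2 (cut n) by exact: (mc _ (@cut_smooth n)).
have mcx n : mfun2 (cutx n) by rewrite -(derxE (@cut_derx n)); exact: (mc _ (smooth2_dx (@cut_smooth n))).
have mcy n : mfun2 (cuty n) by rewrite -(deryE (@cut_dery n)); exact: (mc _ (smooth2_dy (@cut_smooth n))).
have me0 n : mfun2 (err n) by apply: mfun2B => //; exact: mfun2M.
have me1 n : mfun2 (errx n) by apply: mfun2B; [apply: mfun2B => //; exact: mfun2M|exact: mfun2M].
have me2 n : mfun2 (erry n) by apply: mfun2B; [apply: mfun2B => //; exact: mfun2M|exact: mfun2M].
have mz : mfun2 (fun=> 0 : R) by exact: mfun2_cst.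
have z0 : (fun n => ip v (err n)) @ \oo --> (0 : R).
  rewrite -[X in _ --> X](ip0r v); apply: ip_lim0 => //.
  - exact: ws_in ws.
  - exact: ubd_cut_err ubd_ph.
  - by move=> n p /(@trial_out n)[q0 q1 q2 q3]; rewrite /err q0; ring.
  - by move=> p Op /(cut_ev Op)[N H]; exists N => n /H[c cx cy]; rewrite /err c; ring.
have z1 : (fun n => ip vx (errx n)) @ \oo --> (0 : R).
  rewrite -[X in _ --> X](ip0r vx); apply: ip_lim0 => //.
  - exact: wsx_in ws.
  - by apply: ubdD; [exact: ubd_cut_err ubd_phx|apply: ubdN; exact: ubd_cutx_ph].
  - by move=> n p /(@trial_out n)[q0 q1 q2 q3]; rewrite /errx q0 q1; ring.
  - by move=> p Op /(cut_ev Op)[N H]; exists N => n /H[c cx cy]; rewrite /errx c cx; ring.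
have z2 : (fun n => ip vy (erry n)) @ \oo --> (0 : R).
  rewrite -[X in _ --> X](ip0r vy); apply: ip_lim0 => //.
  - exact: wsy_in ws.
  - by apply: ubdD; [exact: ubd_cut_err ubd_phy|apply: ubdN; exact: ubd_cuty_ph].
  - by move=> n p /(@trial_out n)[q0 q1 q2 q3]; rewrite /erry q0 q2; ring.
  - by move=> p Op /(cut_ev Op)[N H]; exists N => n /H[c cx cy]; rewrite /erry c cy; ring.
have l0 : (fun n => ip v (lap_trial n)) @ \oo --> (0 : R).
  rewrite (_ : (fun n => _) = (fun n => - (ip vx (errx n) + ip vy (erry n) - E * ip v (err n)))); last first.
    by apply/funext => n; rewrite ip_lap ip_split.
  rewrite (_ : 0 = - (0 + 0 - E * 0)); last by ring.
  by apply: cvgN; apply: cvgB; [exact: cvgD|apply: cvgM => //; exact: cvg_cst].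
have mi := mfun2_ind meas2_left.
have mlim : mfun2 limit_fun.
  apply: mfun2D; apply: mfun2M => //.
  - apply: mfun2M; first by apply: cont_mfun2 => p; apply: continuous_comp; [exact: cvg_fst|exact: cG].
    exact: (mc _ (@smooth2_snd R _ (@smooth1_sinM R k))).
  - by apply: mfun2B => //; exact: mfun2_cst.
  - exact: (mc _ (@lap_trial_smooth 0)).
have l1 : (fun n => ip v (lap_trial n)) @ \oo --> ip v limit_fun.
  apply: ip_lim0 => //.
  - exact: ws_in ws.
  - by move=> n; exact: (mc _ (@lap_trial_smooth n)).
  - exact: ubd_lap.
  - by move=> n p /(@trial_out n)[].
  - move=> p pd; have [_ _ _ l] := @trial_out 0 p pd.
    rewrite /limit_fun l mulr0 addr0 indF ?mul0r// => /= p0.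
    by have := lt_trans (lt_trans dl0 pd) p0; rewrite ltxx.
  - move=> p Op pd; have [p0|p0] := ltP p.1 0.
      have [N H] := dilL hL0 p0; exists N => n /H[w w1 w2].
      rewrite /limit_fun indT// subrr mul0r addr0 mul1r -PG//.
      by rewrite /lap_trial /trialxx /trialyy /trial w w1 w2 (_ : p.2 * 1 = p.2); [ring|exact: mulr1].
    have pp : 0 < p.1 by case: Op => _ p1 _; rewrite lt_def p1.
    have pL : p.1 < L0 / 2 by exact: le_lt_trans dlL.
    exists 0 => n _; rewrite /limit_fun indF ?mul0r ?add0r ?subr0 ?mul1r; last first.
      by move=> /= q0; have := lt_trans q0 pp; rewrite ltxx.
    have xr : 0 < p.1 < L0 / 2 by rewrite pp.
    have xr' : 0 <= p.1 < L0 / 2 by rewrite ltW.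
    have [d1 d2] := ddilR hL0 n xr.
    by rewrite /lap_trial /trialxx /trialyy /trial d1 d2 !(dilR hL0 _ xr').
by rewrite -(cvg_lim (@Rhausdorff R) l1); exact: (cvg_lim (@Rhausdorff R) l0).
Qed.

End Identity.

(** * Summation over the modes *)

Lemma sqr_le_norm (R : realType) (x y : R) : `|x| <= y -> x ^+ 2 <= y ^+ 2.
Proof.
move=> h; rewrite -[x ^+ 2]real_normK ?num_real//.
by rewrite ler_sqr// nnegrE // (le_trans _ h).
Qed.

(** All variables are values at one point: [p], [p1] of [psi] and its derivative, [r], [r1], [r2] of
    the step, [w], [w1], [w2] of the dilation. Each derivative costs a factor [s], so second order
    terms have size [s^2 J]. The [36] in [Q] covers the [19 + 16] of the first bound and the [16]
    and [20] of the other two. *)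
Lemma mode_bound (R : realType) (Cr Cw l g J s r r1 r2 p p1 w w1 w2 k : R) :
  1 <= Cr -> 1 <= Cw -> 0 <= l -> 0 <= J -> 1 <= s -> 0 <= k <= 4 * s ->
  `|r| <= Cr -> `|r1| <= Cr -> `|r2| <= Cr ->
  `|w| <= Cw -> `|w1| <= Cw -> `|w2| <= Cw ->
  `|p| <= 2 * l * J -> `|p1| <= (2 + 4 * s * l) * J ->
  let P := p * r in
  let P1 := p1 * r + p * (- s * r1) in
  let P2 := ((g - (s ^+ 2 - k ^+ 2) * p) * r + p1 * (- s * r1)) + (p1 * (- s * r1) + p * (- s * (- s * r2))) in
  let Q := 36 * Cr * Cw ^+ 2 * (2 + 4 * l) in
  [/\ `|P2 + (s ^+ 2 - k ^+ 2 * w ^+ 2) * P| <= Q * (`|g| + s ^+ 2 * J),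
      `|k ^+ 2 * w1 ^+ 2 * P| <= Q * (s ^+ 2 * J) &
      `|k * (2 * P1 * w1 + P * w2)| <= Q * (s ^+ 2 * J)].
Proof.
move=> Cr1 Cw1 l0 J0 s1 /andP[k0 ks] hr hr1 hr2 hw hw1 hw2 hp hp1 P P1 P2 Q.
pose D := 2 + 4 * l.
have s0 : 0 <= s by exact: le_trans s1.
have D1 : 1 <= D by rewrite /D; clear - l0; lra.
have D0 : 0 <= D by exact: le_trans D1.
have Cr0 : 0 <= Cr by exact: le_trans Cr1.
have Cw0 : 0 <= Cw by exact: le_trans Cw1.
have Cww : 1 <= Cw ^+ 2 by exact: exprn_ege1.
have CwC : Cw <= Cw ^+ 2 by rewrite expr2 ler_peMr.
have pD : `|p| <= D * J by apply: le_trans hp _; apply: ler_wpM2r => //; rewrite /D; clear - l0; lra.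
have p1D : `|p1| <= D * (s * J).
  apply: le_trans hp1 _; rewrite mulrA; apply: ler_wpM2r => //; rewrite /D [leRHS]mulrDl.
  by apply: lerD; [rewrite ler_peMr|rewrite mulrAC].
have DJ : 0 <= D * J by exact: mulr_ge0.
have ss : 1 <= s ^+ 2 by exact: exprn_ege1.
have ssle : s <= s ^+ 2 by rewrite expr2 ler_peMr.
have kk : k ^+ 2 <= 16 * s ^+ 2.
  by rewrite -[16 * _]/(_) (_ : 16 * s ^+ 2 = (4 * s) ^+ 2); [apply: sqr_le_norm; rewrite ger0_norm|ring].
have kk0 : 0 <= k ^+ 2 by exact: sqr_ge0.
have lamb : `|s ^+ 2 - k ^+ 2| <= 16 * s ^+ 2.
  by rewrite ler_norml; apply/andP; split; clear - kk kk0 ss; lra.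
have ww2 : w ^+ 2 <= Cw ^+ 2 by exact: sqr_le_norm.
have w12 : w1 ^+ 2 <= Cw ^+ 2 by exact: sqr_le_norm.
have PB : `|P| <= D * J * Cr by rewrite normrM; exact: ler_pM.
pose X := D * Cr * Cw ^+ 2 * (s ^+ 2 * J).
have sJ : 0 <= s ^+ 2 * J by apply: mulr_ge0 => //; exact: le_trans ss.
have X1 : D * Cr * (s ^+ 2 * J) <= X.
  by rewrite /X; apply: ler_wpM2r => //; rewrite ler_peMr// mulr_ge0.
have DCJ : 0 <= D * Cr * J by rewrite !mulr_ge0.
have DCsJ : D * Cr * J <= D * Cr * (s ^+ 2 * J).
  by rewrite -mulrA -[leRHS]mulrA; apply: ler_wpM2l => //; apply: ler_wpM2l => //; rewrite ler_peMl.
have X0 : 0 <= X by apply: le_trans X1; rewrite mulr_ge0// mulr_ge0.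
have QX : Q * (s ^+ 2 * J) = 36 * X by rewrite /Q /X -/D; ring.
have P1B : `|P1| <= 2 * (D * Cr * (s * J)).
  apply: le_trans (ler_normD _ _) _.
  have a1 : `|p1 * r| <= D * (s * J) * Cr by rewrite normrM; exact: ler_pM.
  have a2 : `|p * (- s * r1)| <= D * J * (s * Cr).
    rewrite normrM; apply: ler_pM => //; rewrite normrM normrN (ger0_norm s0).
    exact: ler_wpM2l.
  by apply: le_trans (lerD a1 a2) _; rewrite le_eqVlt; apply/orP; left; apply/eqP; ring.
(* The [19] is [16] from [|s^2 - k^2|], [2] from the two mixed terms and [1] from the second
   derivative of the cutoff. *)
have P2B : `|P2| <= Cr * `|g| + 19 * (D * Cr * (s ^+ 2 * J)).
  have a2 : `|p1 * (- s * r1)| <= D * (s * J) * (s * Cr).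
    rewrite normrM; apply: ler_pM => //; rewrite normrM normrN (ger0_norm s0).
    exact: ler_wpM2l.
  have a3 : `|p * (- s * (- s * r2))| <= D * J * (s * (s * Cr)).
    rewrite normrM; apply: ler_pM => //; rewrite !normrM !normrN (ger0_norm s0).
    by do 2 apply: ler_wpM2l => //.
  have a1 : `|(g - (s ^+ 2 - k ^+ 2) * p) * r| <= (`|g| + 16 * s ^+ 2 * (D * J)) * Cr.
    rewrite normrM; apply: ler_pM => //; apply: le_trans (ler_normB _ _) _.
    by apply: lerD => //; rewrite normrM; exact: ler_pM.
  apply: le_trans (ler_normD _ _) _.
  apply: le_trans (lerD (le_trans (ler_normD _ _) (lerD a1 a2)) (le_trans (ler_normD _ _) (lerD a2 a3))) _.
  by rewrite le_eqVlt; apply/orP; left; apply/eqP; ring.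
split.
- have b1 : `|s ^+ 2 - k ^+ 2 * w ^+ 2| <= 16 * (s ^+ 2 * Cw ^+ 2).
    have q1 : k ^+ 2 * w ^+ 2 <= 16 * s ^+ 2 * Cw ^+ 2 by apply: ler_pM => //; exact: sqr_ge0.
    have q2 : 0 <= k ^+ 2 * w ^+ 2 by apply: mulr_ge0 => //; exact: sqr_ge0.
    have q3 : s ^+ 2 <= s ^+ 2 * Cw ^+ 2 by rewrite ler_peMr// sqr_ge0.
    have q4 : 0 <= s ^+ 2 by exact: sqr_ge0.
    by rewrite ler_norml; apply/andP; split; clear - q1 q2 q3 q4; lra.
  have b2 : `|(s ^+ 2 - k ^+ 2 * w ^+ 2) * P| <= 16 * X.
    rewrite normrM; apply: le_trans (ler_pM _ _ b1 PB) _ => //.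
    by rewrite le_eqVlt; apply/orP; left; apply/eqP; rewrite /X; ring.
  apply: le_trans (ler_normD _ _) _; rewrite mulrDr QX.
  have b3 : Cr * `|g| <= Q * `|g|.
    apply: ler_wpM2r => //; rewrite /Q -/D.
    have : Cr <= Cr * (Cw ^+ 2 * D) by rewrite ler_peMr// (le_trans Cww)// ler_peMr// (le_trans _ Cww).
    have -> : 36 * Cr * Cw ^+ 2 * D = 36 * (Cr * (Cw ^+ 2 * D)) by ring.
    move: (Cr * _) => Z h; have := le_trans Cr0 h; clear - h; lra.
  by apply: le_trans (lerD P2B b2) _; clear - b3 X1 X0; lra.
- have b1 : `|k ^+ 2 * w1 ^+ 2| <= 16 * s ^+ 2 * Cw ^+ 2.
    by rewrite normrM ![`|_ ^+ 2|]ger0_norm ?sqr_ge0//; apply: ler_pM => //; exact: sqr_ge0.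
  rewrite normrM; apply: le_trans (ler_pM _ _ b1 PB) _ => //; rewrite QX.
  move: X0.
  have -> : 16 * s ^+ 2 * Cw ^+ 2 * (D * J * Cr) = 16 * X by rewrite /X; ring.
  clear; lra.
- have b1 : `|2 * P1 * w1 + P * w2| <= 5 * (D * Cr * (s * J)) * Cw.
    apply: le_trans (ler_normD _ _) _.
    have c1 : `|2 * P1 * w1| <= 2 * (2 * (D * Cr * (s * J))) * Cw.
      rewrite normrM; apply: ler_pM => //; rewrite normrM ger0_norm//.
      exact: ler_wpM2l.
    have c2 : `|P * w2| <= D * Cr * (s * J) * Cw.
      rewrite normrM; apply: ler_pM => //; apply: le_trans PB _.
      rewrite mulrAC; apply: ler_wpM2l; first exact: mulr_ge0.
      by rewrite ler_peMl.
    clear - c1 c2; lra.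
  have b2 : `|k| <= 4 * s by rewrite ger0_norm.
  rewrite normrM; apply: le_trans (ler_pM _ _ b2 b1) _ => //; rewrite QX.
  have -> : 4 * s * (5 * (D * Cr * (s * J)) * Cw) = 20 * (D * Cr * Cw * (s ^+ 2 * J)) by ring.
  have : D * Cr * Cw * (s ^+ 2 * J) <= X.
    by rewrite /X; apply: ler_wpM2r => //; apply: ler_wpM2l => //; exact: mulr_ge0.
  move: X0.
  clear; lra.
Qed.


(** [lap_trial] sorted by its dependence on the ordinate: on a fibre, the sum over the modes
    consists of three trigonometric sums with the common weights [1], [y^2] and [y]. *)
Definition wing_mode {R : realType} (L0 k : R) (A B C : R -> R) (p : R * R) : R :=
  A p.1 * sin (k * (p.2 * dil L0 0 p.1)) - p.2 ^+ 2 * (B p.1 * sin (k * (p.2 * dil L0 0 p.1)))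
  + p.2 * (C p.1 * cos (k * (p.2 * dil L0 0 p.1))).


Lemma cint_abs_sqr {R : realType} (G : R -> R) a b : a <= b -> continuous G ->
  cint a b (fun y => `|G y|) ^+ 2 <= (b - a) * cint a b (fun y => G y ^+ 2).
Proof.
move=> ab cG; have := cint_CS ab (cont_norm cG) (@cont_cst R 1).
have -> : cint a b (fun x => `|G x| * 1) = cint a b (fun y => `|G y|).
  by apply: eq_cint => x _; rewrite mulr1.
have -> : cint a b (fun x => `|G x| ^+ 2) = cint a b (fun y => G y ^+ 2).
  by apply: eq_cint => x _; rewrite real_normK ?num_real.
have -> : cint a b (fun=> (1 : R) ^+ 2) = b - a.
  by rewrite cint_cst// expr1n mul1r.
by rewrite mulrC.
Qed.

(* [A], [B], [C] extend the resonance of the mode [k] with coefficient [G] into the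
   wing: [wing_mode] is the value of [Laplacian + E], with [E = s^2], on the correction. *)
Definition wing_correction {R : realType} (B0 L0 c s k : R) (G A B C : R -> R) : Prop :=
  [/\ smooth2 (wing_mode L0 k A B C),
      forall x : R, s^-1 < x -> [/\ A x = 0, B x = 0 & C x = 0],
      forall x : R, 0 <= x <= s^-1 -> A x ^+ 2 + L0 ^+ 4 * B x ^+ 2 + L0 ^+ 2 * C x ^+ 2
        <= c * (G x ^+ 2 + s ^+ 4 * cint (- B0) L0 (fun t => G t ^+ 2)) &
      forall v vx vy u, weak_solution B0 L0 (s ^+ 2) v vx vy u ->
        ip v (fun p => \1_[set p : R * R | p.1 < 0] p * (G p.1 * sin (k * p.2))
          + (1 - \1_[set p : R * R | p.1 < 0] p) * wing_mode L0 k A B C p) = 0].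

(** The solution of [ode_solution] on [[- B0, L0]], cut off between [0] and [1 / s], is fed into
    [weak_identity]. The parameter [s^2 - k^2] may be negative, but not below [- (4 s)^2], whence
    [Lam = 4 s]. *)
Lemma mode_exists {R : realType} (B0 L0 : R) : 0 < B0 -> 0 < L0 ->
  exists2 c : R, 0 <= c & forall (s k : R) (G : R -> R),
  1 <= s -> 2 / L0 < s -> 0 <= k <= 4 * s -> sin (k * L0) = 0 -> smooth1 G ->
  exists A B C : R -> R, wing_correction B0 L0 c s k G A B C.
Proof.
move=> hB0 hL0.
have [Cr Cr1 HCr] := @rho_bound R; have [Cw Cw1 HCw] := dil_bounds hL0 hB0.
pose l := L0 - - B0.
have l0 : 0 <= l by rewrite /l opprK addr_ge0// ltW.
pose Q := 36 * Cr * Cw ^+ 2 * (2 + 4 * l).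
pose c := Q ^+ 2 * (2 + L0 ^+ 4 + L0 ^+ 2) * (1 + l).
have c0 : 0 <= c.
  apply: mulr_ge0; last exact: addr_ge0.
  apply: mulr_ge0; first exact: sqr_ge0.
  by apply: addr_ge0; [apply: addr_ge0 => //|]; exact: exprn_even_ge0.
exists c => // s k G s1 sL /andP[k0 ks] kL sG.
have s0 : 0 < s by exact: lt_le_trans s1.
have cG := smooth1_continuous sG.
have ac : - B0 <= L0 by rewrite -subr_ge0.
have Lam1 : 1 <= 4 * s by move: s1; clear; lra.
have kk : k ^+ 2 <= 16 * s ^+ 2.
  by rewrite (_ : 16 * s ^+ 2 = (4 * s) ^+ 2); [apply: sqr_le_norm; rewrite ger0_norm|ring].
have lamb : - (4 * s) ^+ 2 <= s ^+ 2 - k ^+ 2.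
  have := sqr_ge0 s; rewrite exprMn; move: kk; clear.
  by rewrite (_ : 4 ^+ 2 = 16 :> R); [lra|ring].
have [psi [psi' [spsi dpsi dpsi' psiB psiN]]] := ode_solution ac Lam1 lamb sG.
(* This cutoff is [1] for [x <= 0] and [0] for [x >= 1 / s]. *)
pose r := fun x => rho (- s * x + 1); pose r1 := fun x => - s * drho (- s * x + 1).
pose r2 := fun x => - s * (- s * ddrho (- s * x + 1)).
have dr : der r r1 by exact: rho_affine.
have dr1 : der r1 r2.
  by apply: der_eq (derZ (- s) (der_comp drho_der (der_affine (- s) 1))) _ => x; rewrite /r2 (mulrC (ddrho _)).
pose P x := psi x * r x; pose P1 x := psi' x * r x + psi x * r1 x.
pose P2 x := ((G x - (s ^+ 2 - k ^+ 2) * psi x) * r x + psi' x * r1 x) + (psi' x * r1 x + psi x * r2 x).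
have dP : der P P1 := derM dpsi dr.
have dP1 : der P1 P2 := derD (derM dpsi' dr) (derM dpsi dr1).
have sr : smooth1 r by exact: smooth1_rho_affine.
have sP : smooth1 P by exact: smooth1M.
have sP1 := smooth1_of_der sP dP.
have PB : P (- B0) = 0 by rewrite /P psiB mul0r.
have Pout x : s^-1 < x -> [/\ P x = 0, P1 x = 0 & P2 x = 0].
  rewrite -[s^-1]mulr1 mulrC ltr_pdivrMr// => xs.
  have z0 : - s * x + 1 < 0 by rewrite mulNr addrC subr_lt0 mulrC.
  rewrite /P /P1 /P2 /r /r1 /r2 rho0 ?ltW// drho0 ?z0// ddrho0 ?z0//.
  by split; ring.
have Pin x : x < 0 -> P2 x + (s ^+ 2 - k ^+ 2) * P x = G x.
  move=> x0; have z1 : 1 < - s * x + 1 by rewrite ltrDr mulNr -mulrN mulr_gt0// oppr_gt0.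
  rewrite /P /P1 /P2 /r /r1 /r2 rho1 ?ltW// drho0 ?z1 ?orbT// ddrho0 ?z1 ?orbT//.
  by ring.
have sV0 : 0 < s^-1 by rewrite invr_gt0.
have sVL : s^-1 < L0 / 2 by rewrite -[L0 / 2]invrK ltf_pV2 ?posrE ?invr_gt0 ?divr_gt0// invf_div.
pose A x := P2 x + (s ^+ 2 - k ^+ 2 * dil L0 0 x ^+ 2) * P x.
pose B x := k ^+ 2 * ddil L0 0 x ^+ 2 * P x.
pose C x := k * (2 * P1 x * ddil L0 0 x + P x * dddil L0 0 x).
have lapE p : lap_trial L0 (s ^+ 2) k P P1 P2 0 p = wing_mode L0 k A B C p.
  by rewrite /lap_trial /trialxx /trialyy /trial /wing_mode /A /B /C; ring.
exists A, B, C; split.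
- have := @lap_trial_smooth R L0 hL0 (s ^+ 2) k P P1 P2 sP dP dP1 0.
  by congr smooth2; apply/funext => p; exact: lapE.
- move=> x /Pout[e0 e1 e2]; rewrite /A /B /C e0 e1 e2.
  by split; ring.
- move=> x /andP[x0 xs]; set T := cint _ _ (fun t => G t ^+ 2); set g := G x.
  pose J := cint (- B0) L0 (fun y => `|G y|).
  have J0 : 0 <= J by apply: cint_ge0.
  (* Cauchy-Schwarz trades the [L^1] norm of [G] for its square norm, which can be summed over the
     modes. *)
  have JT : J ^+ 2 <= l * T by exact: cint_abs_sqr.
  have xin : - B0 <= x < L0 / 2.
    by rewrite (le_trans _ x0) ?oppr_le0 ?ltW//=; exact: le_lt_trans sVL.
  have xin' : - B0 <= x <= L0.
    case/andP: xin => -> xl /=; apply: ltW; apply: lt_trans xl _; move: hL0; clear; lra.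
  have [b1 b2 b3] := HCw 0 x xin; have w1 := dil_ge1 hL0 0 x.
  have b1' : `|dil L0 0 x| <= Cw by rewrite ger0_norm ?(le_trans _ w1).
  have [p0 p1] := psiN x xin'; have [q0 q1 q2] := HCr (- s * x + 1).
  have kks : 0 <= k <= 4 * s by rewrite k0.
  have [hA hB hC] := @mode_bound R Cr Cw l g J s _ _ _ _ _ _ _ _ k Cr1 Cw1 l0 J0 s1 kks q0 q1 q2 b1' b2 b3 p0 p1.
  pose Y := s ^+ 2 * J.
  have g0 := sqr_ge0 g; have Y0 := sqr_ge0 Y; have Q20 := sqr_ge0 Q.
  have L40 : 0 <= L0 ^+ 4 by exact: exprn_even_ge0.
  have L20 := sqr_ge0 L0.
  have a2 : A x ^+ 2 <= Q ^+ 2 * (2 * (g ^+ 2 + Y ^+ 2)).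
    apply: le_trans (sqr_le_norm hA) _; rewrite exprMn; apply: ler_wpM2l => //.
    rewrite -[g ^+ 2]real_normK ?num_real// -/Y.
    have := sqr_ge0 (`|g| - Y); clear; rewrite sqrrB sqrrD; lra.
  have b2' : B x ^+ 2 <= Q ^+ 2 * Y ^+ 2 by rewrite -exprMn; exact: sqr_le_norm.
  have c2 : C x ^+ 2 <= Q ^+ 2 * Y ^+ 2 by rewrite -exprMn; exact: sqr_le_norm.
  have T0 : 0 <= T by apply: cint_ge0 => t _; exact: sqr_ge0.
  have YT : Y ^+ 2 <= l * (s ^+ 4 * T).
    rewrite /Y exprMn -exprM [leRHS]mulrCA; apply: ler_wpM2l => //; exact: exprn_even_ge0.
  have sT : 0 <= s ^+ 4 * T by apply: mulr_ge0 => //; exact: exprn_even_ge0.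
  apply: le_trans (_ : Q ^+ 2 * ((2 + L0 ^+ 4 + L0 ^+ 2) * (g ^+ 2 + Y ^+ 2)) <= _).
    apply: le_trans (lerD (lerD a2 (ler_wpM2l L40 b2')) (ler_wpM2l L20 c2)) _.
    rewrite [leLHS](_ : _ = Q ^+ 2 * (2 * (g ^+ 2 + Y ^+ 2) + L0 ^+ 4 * Y ^+ 2 + L0 ^+ 2 * Y ^+ 2)); last by ring.
    apply: ler_wpM2l => //.
    have h1 := mulr_ge0 L40 g0; have h2 := mulr_ge0 L20 g0.
    rewrite [leRHS](_ : _ = 2 * (g ^+ 2 + Y ^+ 2) + L0 ^+ 4 * Y ^+ 2 + L0 ^+ 2 * Y ^+ 2 + (L0 ^+ 4 * g ^+ 2 + L0 ^+ 2 * g ^+ 2)); last by ring.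
    by rewrite lerDl addr_ge0.
  rewrite (_ : c * _ = Q ^+ 2 * ((2 + L0 ^+ 4 + L0 ^+ 2) * ((1 + l) * (g ^+ 2 + s ^+ 4 * T)))); last by rewrite /c; ring.
  apply: ler_wpM2l => //; apply: ler_wpM2l.
    by move: L40 L20; clear; lra.
  have h1 := mulr_ge0 l0 g0; rewrite mulrDl mul1r mulrDr.
  move: YT h1 sT; clear; lra.
- move=> v vx vy u ws.
  have := @weak_identity R B0 L0 hB0 hL0 (s ^+ 2) k s^-1 P P1 P2 G k0 kL sV0 sVL sP dP dP1 PB Pout Pin cG v vx vy u ws.
  by move=> h; rewrite -[RHS]h; apply: eq_ip => p; rewrite /limit_fun lapE.
Qed.

(** * Fourier coefficients of a test function on the vertical fibres *)

Section Coefficients.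
Context {R : realType}.
Local Notation mu := (@lebesgue2 R).
Variables (B0 L0 : R) (hB0 : 0 < B0) (hL0 : 0 < L0) (K : nat) (u : R * R -> R).
Hypothesis tu : test_function (stadium B0 L0) u.

Let su : smooth2 u. Proof. by case: tu. Qed.
Let cu : continuous u. Proof. exact: smooth2_continuous. Qed.

(** The segment [[0, L0]] is kept also where the stadium is lower, since the test function vanishes
    above it. *)
Definition coef (k : nat) (x : R) : R := cint 0 L0 (fun y => u (x, y) * sin (kap L0 k * y)).
Local Notation rect := (\1_(box (- B0) 0 0 L0) : R * R -> R).

Lemma coef_smooth2 k : smooth2 (fun p => u p * sin (kap L0 k * p.2)).
Proof. exact: (smooth2M su (@smooth2_snd R _ (@smooth1_sinM R (kap L0 k)))). Qed.

Lemma smooth1_coef k : smooth1 (coef k).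
Proof. exact: (smooth1_cint (@coef_smooth2 k)). Qed.

Lemma cont_coef k : continuous (coef k).
Proof. exact/smooth1_continuous/smooth1_coef. Qed.

Definition trig_sum (p : R * R) : R := \sum_(i < K) coef i p.1 * sin (kap L0 i * p.2).

Lemma smooth2_sum n (f : 'I_n -> R * R -> R) : (forall i, smooth2 (f i)) -> smooth2 (fun p => \sum_i f i p).
Proof.
elim: n f => [|n IH] f sf.
  by under eq_fun do rewrite big_ord0; exact: smooth2_cst.
under eq_fun do rewrite big_ord_recl; apply: smooth2D => //.
exact: IH.
Qed.

Lemma trig_sum_smooth2 : smooth2 trig_sum.
Proof.
apply: smooth2_sum => i.
exact: (smooth2M (@smooth2_fst R _ (@smooth1_coef i)) (@smooth2_snd R _ (@smooth1_sinM R (kap L0 i)))).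
Qed.

Definition rect_energy : R := \sum_(i < K) cint (- B0) 0 (fun x => coef i x ^+ 2).

Lemma rect_energy_cint : rect_energy = cint (- B0) 0 (fun x => \sum_(i < K) coef i x ^+ 2).
Proof. by rewrite cint_sum// => i; exact/contX/cont_coef. Qed.

Lemma ip_trig_sum : ip u (fun p => rect p * trig_sum p) = rect_energy.
Proof.
rewrite rect_energy_cint.
have cf : continuous (fun p => u p * trig_sum p).
  exact/smooth2_continuous/(smooth2M su)/trig_sum_smooth2.
rewrite (_ : ip u _ = \int[mu]_p (rect p * (u p * trig_sum p))); last first.
  by apply: eq_Rintegral => p _; rewrite mulrCA.
rewrite fub//; apply: eq_cint => x _; rewrite /trig_sum /=.
rewrite (@cint_mul_comb R L0 K (fun i y => sin (kap L0 i * y)) _ (fun i => coef i x) (fun y => u (x, y))).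
- by apply: eq_bigr => i _; rewrite expr2.
- by move=> i; exact: cont_sinM.
- exact: (@cont_slice2 R u x).
Qed.

Lemma ip_trig_sum_self :
  ip (fun p => rect p * trig_sum p) (fun p => rect p * trig_sum p) = L0 / 2 * rect_energy.
Proof.
have cf : continuous (fun p => trig_sum p ^+ 2).
  by apply: smooth2_continuous; apply: smooth2M; exact: trig_sum_smooth2.
rewrite (_ : ip _ _ = \int[mu]_p (rect p * trig_sum p ^+ 2)); last first.
  apply: eq_Rintegral => p _; rewrite expr2 mulrACA; congr (_ * _).
  by rewrite indicE; case: (_ \in _); rewrite !(mulr1, mulr0).
rewrite fub// rect_energy_cint -cintZ; last by apply: cont_sum => i; exact/contX/cont_coef.
apply: eq_cint => x _; rewrite /trig_sum /=.
rewrite (@cint_sqr_comb R L0 K (fun i y => sin (kap L0 i * y)))//.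
- by move=> i; exact: cont_sinM.
- exact: sin_gram.
Qed.

Lemma coef_bessel : \sum_(i < K) cint (- B0) L0 (fun x => coef i x ^+ 2) <= L0 / 2 * ip u u.
Proof.
have cu2 : continuous (fun p => u p ^+ 2) by apply: smooth2_continuous; exact: smooth2M.
rewrite -cint_sum; last by move=> i; exact/contX/cont_coef.
have ci := @cont_cint R (fun p => u p ^+ 2) 0 L0 cu2.
apply: le_trans (_ : L0 / 2 * cint (- B0) L0 (fun x => cint 0 L0 (fun y => u (x, y) ^+ 2)) <= _).
  rewrite -cintZ//; apply: cint_le.
  - by apply: cont_sum => i; exact/contX/cont_coef.
  - by apply: contM => //; exact: cont_cst.
  - move=> x _; apply: (@bessel R L0 K (fun i y => sin (kap L0 i * y))) => //.
    + by move=> i; exact: cont_sinM.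
    + exact: sin_gram.
    + exact: (@cont_slice2 R u x).
apply: ler_wpM2l; first by rewrite divr_ge0// ltW.
rewrite -(@fub R (fun p => u p ^+ 2))//; apply: le_Rintegral => //.
- exact: intble_box.
- by have [_ h] := sqi_test hB0 hL0 tu.
- by move=> p _; rewrite ler_piMl ?sqr_ge0// ind_le1.
Qed.

Lemma rect_energy_le : rect_energy <= L0 / 2 * ip u u.
Proof.
apply: le_trans coef_bessel; apply: ler_sum => i _.
have c2 : continuous (fun x => coef i x ^+ 2) by exact/contX/cont_coef.
have -> : cint (- B0) L0 (fun x => coef i x ^+ 2) =
  cint (- B0) 0 (fun x => coef i x ^+ 2) + cint 0 L0 (fun x => coef i x ^+ 2).
  by apply: cint_cat => //; rewrite ?oppr_le0 ltW.
rewrite lerDl; by apply: cint_ge0 => x _; exact: sqr_ge0.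
Qed.

(** [poincare_fourier] on each fibre of the rectangle, at both ends of which [u] vanishes; the
    integral of [dy u] squared is then enlarged to the plane. *)
Lemma rect_poincare (m : R) : m = (K%:R + 2^-1) * pi / L0 ->
  m ^+ 2 * ip (fun p => rect p * u p) u <= ip (dy u) (dy u) + m ^+ 2 * (2 / L0 * rect_energy).
Proof.
move=> mE.
have sdy := smooth2_dy su.
have cu2 : continuous (fun p => u p ^+ 2) by apply: smooth2_continuous; exact: smooth2M.
have cd2 : continuous (fun p => dy u p ^+ 2) by apply: smooth2_continuous; exact: smooth2M.
have ci := @cont_cint R (fun p => u p ^+ 2) 0 L0 cu2.
have cd := @cont_cint R (fun p => dy u p ^+ 2) 0 L0 cd2.
have cs : continuous (fun x => \sum_(i < K) coef i x ^+ 2) by apply: cont_sum => i; exact/contX/cont_coef.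
rewrite (_ : ip _ u = \int[mu]_p (rect p * u p ^+ 2)); last first.
  by apply: eq_Rintegral => p _; rewrite -mulrA.
rewrite fub// -cintZ//.
apply: le_trans (_ : cint (- B0) 0 (fun x => cint 0 L0 (fun y => dy u (x, y) ^+ 2)
   + m ^+ 2 * (2 / L0) * \sum_(i < K) coef i x ^+ 2) <= _).
  apply: cint_le.
  - by apply: contM => //; exact: cont_cst.
  - by apply: contD => //; apply: contM => //; exact: cont_cst.
  - move=> x _; rewrite -[_ * _ * \sum_(i < K) _]mulrA.
    exact: (poincare_fourier hL0 mE (smooth2_dery su x)
      (@cont_slice2 R _ x (smooth2_continuous sdy)) (test_bottom x tu) (test_top hL0 x tu)).
rewrite cintD//; last by apply: contM => //; exact: cont_cst.
apply: lerD; last first.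
  by rewrite cintZ// rect_energy_cint -mulrA.
rewrite -(@fub R (fun p => dy u p ^+ 2))//; apply: le_Rintegral => //.
- exact: intble_box.
- by have [_ h] := sqi_test hB0 hL0 (test_dy tu).
- by move=> p _; rewrite ler_piMl ?sqr_ge0// ind_le1.
Qed.

End Coefficients.

(** The difference of the two sides is [(a + b)^2 + (a - c)^2 + (b + c)^2]. *)
Lemma three_sqr {R : realType} (a b c : R) :
  (a - b + c) ^+ 2 <= 3 * (a ^+ 2 + b ^+ 2 + c ^+ 2).
Proof.
have := sqr_ge0 (a + b); have := sqr_ge0 (a - c); have := sqr_ge0 (b + c).
rewrite !(sqrrD, sqrrB) mulrBl; lra.
Qed.

(** * Square norm of the summed corrections over the wing *)

Section WingSum.
Context {R : realType}.
Local Notation RR := (measurableTypeR R * measurableTypeR R)%type.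
Local Notation leb := (@lebesgue_measure R).
Variables (B0 L0 : R) (hB0 : 0 < B0) (hL0 : 0 < L0).
Local Notation M := (B0 + L0 + 1).
Local Notation bx := (\1_(box (- M) M (- M) M) : R * R -> R).

Lemma smooth2_mfun2 (f : R * R -> R) : smooth2 f -> mfun2 f.
Proof. by move=> sf; exact: (cont_mfun2 (smooth2_continuous sf)). Qed.

Lemma meas2_gt0 (f : R * R -> R) : mfun2 f -> meas2 [set p | 0 < f p].
Proof.
move=> mf; rewrite (_ : [set p | _] = (f : RR -> R) @^-1` `]0, +oo[).
  by rewrite -[X in meas2 X]setTI; apply: mf => //; exact: measurable_itv.
by apply/seteqP; split => p /=; rewrite in_itv /= andbT.
Qed.

(** Described by the smoothed dilation; it agrees with the part of [split_stadium] in the wing up to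
    [L0 / 2], which contains the support of the modes in the wing. *)
Definition wing_part : set (R * R) :=
  [set p | [/\ 0 < p.1, 0 < p.2 & 0 < L0 - p.2 * dil L0 0 p.1]].

Lemma meas2_wing : meas2 wing_part.
Proof.
rewrite (_ : wing_part = [set p | 0 < p.1] `&` ([set p | 0 < p.2] `&` [set p | 0 < L0 - p.2 * dil L0 0 p.1])).
  apply: measurableI; [|apply: measurableI].
  - apply: (@meas2_gt0 (fun p => p.1)); apply: smooth2_mfun2.
    exact: (@smooth2_fst R (fun x => x) smooth1_id).
  - apply: (@meas2_gt0 (fun p => p.2)); apply: smooth2_mfun2.
    exact: (@smooth2_snd R (fun x => x) smooth1_id).
  - apply: (@meas2_gt0 (fun p => L0 - p.2 * dil L0 0 p.1)); apply: mfun2B; first exact: mfun2_cst.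
    exact: (smooth2_mfun2 (smooth2_arg hL0 0)).
by apply/seteqP; split => p /= => [[a b c]|[a [b c]]].
Qed.

Variables (K : nat) (s : R) (A B C : 'I_K -> R -> R) (N : R -> R).
Hypotheses (s1 : 1 <= s) (sL : 2 / L0 < s).
Local Notation mode i := (wing_mode L0 (kap L0 (nat_of_ord i)) (A i) (B i) (C i)).
Hypothesis sm : forall i, smooth2 (mode i).
Hypothesis out : forall i x, s^-1 < x -> [/\ A i x = 0, B i x = 0 & C i x = 0].
Hypotheses (cN : continuous N) (N0 : forall x, 0 <= N x).
Hypothesis HN : forall x : R, 0 <= x <= s^-1 ->
  \sum_i (A i x ^+ 2 + L0 ^+ 4 * B i x ^+ 2 + L0 ^+ 2 * C i x ^+ 2) <= N x.

Definition wing_sum (p : R * R) : R := \1_wing_part p * \sum_i mode i p.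

Let s0 : 0 < s. Proof. exact: lt_le_trans s1. Qed.
Let sV0 : 0 < s^-1. Proof. by rewrite invr_gt0. Qed.
Let sVL : s^-1 < L0 / 2.
Proof. by rewrite -[L0 / 2]invrK ltf_pV2 ?posrE ?invr_gt0 ?divr_gt0// invf_div. Qed.

Lemma mode_out i p : s^-1 < p.1 -> mode i p = 0.
Proof. by move=> /(out i)[a b c]; rewrite /wing_mode a b c; ring. Qed.

Lemma wing_sum_in p : wing_sum p != 0 -> wing_part p /\ p.1 <= s^-1.
Proof.
rewrite /wing_sum => h; split.
  by apply: contrapT => nW; move: h; rewrite indF// mul0r eqxx.
rewrite leNgt; apply/negP => xs; move: h.
by rewrite big1 ?mulr0 ?eqxx// => i _; exact: mode_out.
Qed.

Lemma smooth2_modes : smooth2 (fun p => \sum_i mode i p).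
Proof. exact: smooth2_sum. Qed.

Lemma sqi_wing_sum : sqi wing_sum.
Proof.
rewrite (_ : wing_sum = (fun p => (bx p * \sum_i mode i p) * \1_wing_part p)); last first.
  apply/funext => p; have [h|h] := eqVneq (wing_sum p) 0.
    rewrite -mulrA [_ * \1__ _]mulrC; move: h; rewrite /wing_sum => ->.
    by rewrite mulr0.
  have [[x0 y0 yw] xs] := wing_sum_in h; rewrite indT ?mul1r; first by rewrite mulrC.
  have yL : p.2 < L0.
    move: yw; rewrite subr_gt0; apply: le_lt_trans.
    by apply: ler_peMr; [exact: ltW|exact: dil_ge1].
  have := lt_trans sVL (_ : L0 / 2 < L0); move: hL0 hB0 => hL hB.
  move=> /(_ ltac:(lra)) sL0.
  by apply/boxP; split; apply/andP; split; lra.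
apply: (@sqi_mulb _ 1).
- apply: sqi_bx; exact: (smooth2_continuous smooth2_modes).
- exact: (mfun2_ind meas2_wing).
- by move=> p _; rewrite ger0_norm ?ind_ge0// ind_le1.
Qed.

(** The stretched sines are the Dirichlet sines of a fibre of height [L0 / dil L0 0 x], so
    [sin_gram] and [cos_gram] hold on that fibre. *)
Lemma kap_scale i x : kap L0 i * dil L0 0 x = kap (L0 / dil L0 0 x) i.
Proof. by rewrite /kap invf_div [dil _ _ _ / _]mulrC !mulrA. Qed.

(** The [3] comes from [three_sqr], the factor [H / 2 <= L0 / 2] from the norm of a sine or cosine
    on the fibre, and [y <= L0] turns the weights [y^4] and [y^2] into [L0^4] and [L0^2]. *)
Lemma wing_section (x : R) : 0 <= x <= s^-1 ->
  (\int[leb]_y (wing_sum (x, y) ^+ 2)%:E <= (3 / 2 * L0 * N x)%:E)%E.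
Proof.
move=> xs; pose w := dil L0 0 x; pose H := L0 / w.
have w1 : 1 <= w by exact: dil_ge1.
have w0 : 0 < w by exact: lt_le_trans w1.
have H0 : 0 < H by rewrite divr_gt0.
have HL : H <= L0 by rewrite ler_pdivrMr// ler_peMr// ltW.
have cm : continuous (fun y => \sum_i mode i (x, y)).
  exact: (@cont_slice2 R _ x (smooth2_continuous smooth2_modes)).
have cm2 : continuous (fun y => (\sum_i mode i (x, y)) ^+ 2) by exact: contX.
apply: (@le_trans _ _ (cint 0 H (fun y => (\sum_i mode i (x, y)) ^+ 2))%:E).
  rewrite -cint_EFin//.
  rewrite [leRHS]integral_mkcond; apply: ge0_le_integral => //.
  - by move=> y _; rewrite lee_fin sqr_ge0.
  - apply/measurable_EFinP; apply: measurable_funX.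
    have [mw _] := sqi_wing_sum.
    exact: (measurableT_comp mw (measurable_pair1 x)).
  - have mH : measurable (`[0, H]%classic : set (measurableTypeR R)) by exact: measurable_itv.
    apply/(measurable_restrictT _ mH).
    by apply/measurable_EFinP; apply: measurable_funTS; exact: continuous_measurable_fun.
  - move=> y _; rewrite patchE; case: ifPn => [yH|yH].
      rewrite lee_fin /wing_sum exprMn; apply: ler_piMl; first exact: sqr_ge0.
      by apply: exprn_ile1; [exact: ind_ge0|exact: ind_le1].
    rewrite lee_fin /wing_sum indF ?mul0r ?expr0n// => -[/= x0 y0 yw].
    move/negP: yH; apply; rewrite inE /= in_itv /= ltW//= /H ler_pdivlMr//.
    by move: yw; rewrite subr_gt0 => /ltW.
rewrite lee_fin.
pose As y := \sum_i A i x * sin (kap H i * y).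
pose Bs y := \sum_i B i x * sin (kap H i * y).
pose Cs y := \sum_i C i x * cos (kap H i * y).
have cA : continuous As by apply: cont_comb => i; exact: cont_sinM.
have cB : continuous Bs by apply: cont_comb => i; exact: cont_sinM.
have cC : continuous Cs by apply: cont_comb => i; exact: cont_cosM.
have cA2 : continuous (fun y => As y ^+ 2) by exact: contX.
have cB2 : continuous (fun y => Bs y ^+ 2) by exact: contX.
have cC2 : continuous (fun y => Cs y ^+ 2) by exact: contX.
have modeE y : \sum_i mode i (x, y) = As y - y ^+ 2 * Bs y + y * Cs y.
  rewrite /As /Bs /Cs !mulr_sumr -sumrB -big_split; apply: eq_bigr => i _ /=.
  by rewrite /wing_mode /= mulrCA (mulrC y) mulrA -/w [kap L0 i * w]kap_scale; ring.
have cLB : continuous (fun y => L0 ^+ 4 * Bs y ^+ 2) by apply: contM => //; exact: cont_cst.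
have cLC : continuous (fun y => L0 ^+ 2 * Cs y ^+ 2) by apply: contM => //; exact: cont_cst.
have cAB := contD cA2 cLB; have cABC := contD cAB cLC.
apply: (@le_trans _ _ (cint 0 H (fun y => 3 * (As y ^+ 2 + L0 ^+ 4 * Bs y ^+ 2 + L0 ^+ 2 * Cs y ^+ 2)))).
  apply: cint_le => //; first by apply: contM => //; exact: cont_cst.
  move=> y /andP[y0 yH]; rewrite modeE.
  have yL : y <= L0 by exact: le_trans HL.
  have y2 : y ^+ 2 <= L0 ^+ 2 by rewrite ler_sqr ?nnegrE// ltW.
  have y4 : y ^+ 4 <= L0 ^+ 4 by rewrite lerXn2r ?nnegrE// ltW.
  have h1 := ler_wpM2r (sqr_ge0 (Bs y)) y4.
  have h2 := ler_wpM2r (sqr_ge0 (Cs y)) y2.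
  have := three_sqr (As y) (y ^+ 2 * Bs y) (y * Cs y).
  move/le_trans; apply; apply: ler_wpM2l => //; apply: lerD; first apply: lerD => //.
    by rewrite exprMn -exprM.
  by rewrite exprMn.
rewrite cintZ// !cintD// !cintZ// /As /Bs /Cs.
rewrite (@cint_sqr_comb R H K (fun i y => sin (kap H i * y)))//; last 2 first.
- by move=> i; exact: cont_sinM.
- exact: sin_gram.
rewrite (@cint_sqr_comb R H K (fun i y => sin (kap H i * y)))//; last 2 first.
- by move=> i; exact: cont_sinM.
- exact: sin_gram.
rewrite (@cint_sqr_comb R H K (fun i y => cos (kap H i * y)))//; last 2 first.
- by move=> i; exact: cont_cosM.
- exact: cos_gram.
set S := \sum_i (A i x ^+ 2 + L0 ^+ 4 * B i x ^+ 2 + L0 ^+ 2 * C i x ^+ 2).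
have S0 : 0 <= S.
  apply: sumr_ge0 => i _; apply: addr_ge0; first apply: addr_ge0.
  - exact: sqr_ge0.
  - by apply: mulr_ge0; [exact: exprn_even_ge0|exact: sqr_ge0].
  - by apply: mulr_ge0; exact: sqr_ge0.
apply: (@le_trans _ _ (3 / 2 * H * S)); last first.
  apply: ler_pM => //; [by rewrite mulr_ge0// ltW| |exact: HN].
  exact: ler_wpM2l.
by rewrite /S !big_split /= -!mulr_sumr le_eqVlt; apply/orP; left; apply/eqP; field.
Qed.

Lemma wing_sum_bound : ip wing_sum wing_sum <= 3 / 2 * L0 * cint 0 s^-1 N.
Proof.
have cB : continuous (fun x => 3 / 2 * L0 * N x) by apply: contM => //; exact: cont_cst.
rewrite -cintZ//; apply: ip_le_iter => //.
- by have [] := sqi_wing_sum.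
- by move=> x; rewrite mulr_ge0// mulr_ge0// ltW.
- by move=> p /wing_sum_in[[x0 _ _] xs]; rewrite ltW.
- by move=> x; exact: wing_section.
Qed.

End WingSum.

Lemma mode_count {R : realType} (L0 s : R) : 0 < L0 -> 1 <= s -> exists K : nat,
  (forall k, (k < K)%N -> 0 <= kap L0 k <= 4 * s) /\ 2 * s <= (K%:R + 2^-1) * pi / L0.
Proof.
move=> hL0 s1; have s0 : 0 <= s by exact: le_trans s1.
have pi0 := @pi_gt0 R.
have z0 : 0 <= 4 * s * L0 / pi by rewrite divr_ge0 ?mulr_ge0 ?(ltW hL0) ?(ltW pi0).
(* The largest [K] with [K pi / L0 <= 4 s]. *)
exists (Num.truncn (4 * s * L0 / pi)); set K := Num.truncn _.
have [K1 K2] : K%:R <= 4 * s * L0 / pi /\ 4 * s * L0 / pi < K.+1%:R.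
  by split; [by rewrite truncn_le|exact: truncnS_gt].
split.
  move=> k kK; rewrite (ltW (kap_gt0 hL0 _)) /=.
  rewrite /kap ler_pdivrMr// -ler_pdivlMr//; apply: le_trans K1.
  by rewrite ler_nat.
rewrite ler_pdivlMr//; move: K2; rewrite ltr_pdivrMr// => K2.
(* [K + 1 / 2] is the mean of [K] and [K + 1], and half of [(K + 1) pi > 4 s L0] already
   suffices. *)
rewrite (_ : (K%:R + 2^-1) * pi = 2^-1 * (K.+1%:R * pi) + 2^-1 * (K%:R * pi)).
  by have := mulr_ge0 (ler0n R K) (ltW pi0); move: K2; clear; lra.
by rewrite -(natr1 K); field.
Qed.


(** * The resonance identity summed over the modes *)

Section Core.
Context {R : realType}.
Variables (B0 L0 : R) (hB0 : 0 < B0) (hL0 : 0 < L0).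
Local Notation M := (B0 + L0 + 1).
Local Notation bx := (\1_(box (- M) M (- M) M) : R * R -> R).
Local Notation rect := (\1_(box (- B0) 0 0 L0) : R * R -> R).
Local Notation O := (split_stadium B0 L0).

Definition right_part (v : R * R -> R) (p : R * R) : R := \1_[set p : R * R | 0 < p.1] p * v p.

Lemma cint_mono (f : R -> R) (a b : R) : continuous f -> (forall x, 0 <= f x) ->
  - B0 <= a -> a <= b -> b <= L0 -> cint a b f <= cint (- B0) L0 f.
Proof.
move=> cf f0 h1 h2 h3.
have -> : cint (- B0) L0 f = cint (- B0) a f + (cint a b f + cint b L0 f).
  rewrite -(cint_cat (b := b) (a := a) (c := L0))// -cint_cat//.
  exact: le_trans h3.
have := @cint_ge0 R (- B0) a f (fun x _ => f0 x).
have := @cint_ge0 R b L0 f (fun x _ => f0 x).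
move: (cint _ _ f) (cint _ _ f) (cint _ _ f) => x y z; lra.
Qed.

Lemma box_rect p : box (- B0) 0 0 L0 p -> box (- M) M (- M) M p.
Proof.
move=> /boxP[/andP[a b] /andP[c d]]; have := hB0; have := hL0 => *.
by apply/boxP; split; apply/andP; split; lra.
Qed.

Lemma sqi_rect f : continuous f -> sqi (fun p => rect p * f p).
Proof.
move=> cf; rewrite (_ : (fun p => _) = (fun p => (bx p * f p) * rect p)); last first.
  apply/funext => p; have [rp|rp] := pselect (box (- B0) 0 0 L0 p).
    by rewrite (indT rp) (indT (box_rect rp)) mulr1.
  by rewrite (indF rp) mul0r mulr0.
apply: (@sqi_mulb _ 1); first exact: sqi_bx.
- exact: (mfun2_ind (meas2_box _ _ _ _)).
- by move=> p _; rewrite ger0_norm ?ind_ge0// ind_le1.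
Qed.

Lemma sqi_bx_left (f g : R * R -> R) : continuous f -> continuous g ->
  sqi (fun p => bx p * (\1_[set p : R * R | p.1 < 0] p * f p + (1 - \1_[set p : R * R | p.1 < 0] p) * g p)).
Proof.
move=> cf cg; pose I := \1_[set p : R * R | p.1 < 0] : R * R -> R.
have mI : mfun2 I by exact: (mfun2_ind meas2_left).
rewrite (_ : (fun p => _) = (fun p => (bx p * f p) * I p + (bx p * g p) * (1 - I p))); last first.
  by apply/funext => p; rewrite /I; ring.
apply: sqiD; apply: (@sqi_mulb _ 1); try exact: sqi_bx; try by [].
- by move=> p _; rewrite ger0_norm ?ind_ge0// ind_le1.
- by apply: mfun2B => //; exact: mfun2_cst.
- move=> p _; have := ind_ge0 [set p : R * R | p.1 < 0] p.
  have := ind_le1 [set p : R * R | p.1 < 0] p; rewrite -/(I p).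
  by move=> h1 h0; rewrite ger0_norm ?subr_ge0// gerBl.
Qed.

Lemma rect_indE p : O p -> rect p = \1_[set p : R * R | p.1 < 0] p.
Proof.
move=> [/andP[h1 h2] x0 /andP[h3 h4]]; have [xn|xp] := ltP p.1 0.
  rewrite (indT xn) indT//; apply/boxP; split; first by rewrite !ltW.
  by rewrite ltW//= ltW// (lt_le_trans h4)// height_le.
rewrite !indF// => [|/boxP[/andP[_ h] _]]; first by apply/negP; rewrite -leNgt.
by move/negP: x0; apply; rewrite eq_le h.
Qed.

Lemma wing_indE p : O p -> p.1 < L0 / 2 -> \1_(wing_part L0) p = 1 - \1_[set p : R * R | p.1 < 0] p :> R.
Proof.
move=> [/andP[h1 h2] x0 /andP[h3 h4]] xL; have [xn|xp] := ltP p.1 0.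
  rewrite (indT xn) subrr indF// => -[h _ _].
  by have := lt_trans xn h; rewrite ltxx.
rewrite [X in 1 - X]indF ?subr0; last by apply/negP; rewrite -leNgt.
rewrite indT//; split=> //; first by rewrite lt_def x0.
rewrite dilR ?xp// subr_gt0 mulrA ltr_pdivrMr; last exact: lt_trans h4.
by rewrite mulrC ltr_pM2l.
Qed.

Lemma right_partE p (v : R * R -> R) : (v p != 0 -> O p) -> rect p * v p + right_part v p = v p.
Proof.
move=> vO; have [v0|/vO Op] := eqVneq (v p) 0; first by rewrite /right_part v0 !mulr0 addr0.
rewrite rect_indE// /right_part -mulrDl; case: Op => _ x0 _.
have [xn|xp] := ltP p.1 0.
  rewrite indT// indF ?addr0 ?mul1r// => h.
  by have := lt_trans xn h; rewrite ltxx.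
rewrite indF ?add0r; last by apply/negP; rewrite -leNgt.
by rewrite indT ?mul1r//= lt_def x0.
Qed.

(** The product of [3 / 2 * L0] from [wing_sum_bound], of [2 * c * s ^+ 3] from integrating [N] over
    [[0, 1 / s]], and of [L0 / 2] from Bessel's inequality. *)
Definition wing_const (c s : R) : R := 3 / 2 * L0 ^+ 2 * c * s ^+ 3.

(** The solution [v] is paired with the low modes of the test function [w]: when [w] is close to
    [v], the left side is close to the energy of these modes on the rectangle. *)
Lemma resonant_identity : exists2 c : R, 0 <= c & forall s v vx vy u w K,
  1 <= s -> 2 / L0 < s -> (forall k, (k < K)%N -> 0 <= kap L0 k <= 4 * s) ->
  weak_solution B0 L0 (s ^+ 2) v vx vy u -> test_function (stadium B0 L0) w ->
  exists2 F : R * R -> R, sqi F /\ ip F F <= wing_const c s * ip w w &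
    ip v (fun p => rect p * trig_sum L0 K w p) = - ip (right_part v) F.
Proof.
have [c c0 Hc] := mode_exists hB0 hL0.
exists c => // s v vx vy u w K s1 sL Kk ws tw.
have s0 : 0 < s by exact: lt_le_trans s1.
have sV0 : 0 < s^-1 by rewrite invr_gt0.
have sVL : s^-1 < L0 / 2 by rewrite -[L0 / 2]invrK ltf_pV2 ?posrE ?invr_gt0 ?divr_gt0// invf_div.
have sc k : smooth1 (coef L0 w k) by exact: smooth1_coef tw k.
have cc k : continuous (coef L0 w k) by exact: cont_coef tw k.
have /choice[f Hf] : forall i : 'I_K, exists t : (R -> R) * (R -> R) * (R -> R),
    wing_correction B0 L0 c s (kap L0 i) (coef L0 w i) t.1.1 t.1.2 t.2.
  move=> i; have [A [B [C H]]] := Hc s (kap L0 i) (coef L0 w i) s1 sL (Kk i (ltn_ord i)) (sin_kapL hL0 i) (sc i).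
  by exists (A, B, C).
pose A i := (f i).1.1; pose B i := (f i).1.2; pose C i := (f i).2.
have sm (i : 'I_K) : smooth2 (wing_mode L0 (kap L0 i) (A i) (B i) (C i)) by have [] := Hf i.
have out (i : 'I_K) (x : R) : s^-1 < x -> [/\ A i x = 0, B i x = 0 & C i x = 0] by have [_ h _ _] := Hf i; exact: h.
pose T := \sum_(i < K) cint (- B0) L0 (fun t => coef L0 w i t ^+ 2).
pose G2 x := \sum_(i < K) coef L0 w i x ^+ 2.
pose N x := c * (G2 x + s ^+ 4 * T).
have cG2 : continuous G2 by apply: cont_sum => i; exact: contX.
have G20 x : 0 <= G2 x by apply: sumr_ge0 => i _; exact: sqr_ge0.
have T0 : 0 <= T by apply: sumr_ge0 => i _; apply: cint_ge0 => x _; exact: sqr_ge0.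
have s40 : 0 <= s ^+ 4 by exact: exprn_even_ge0.
have cN : continuous N.
  by apply: contM; [exact: cont_cst|apply: contD => //; exact: cont_cst].
have N0 x : 0 <= N x by apply: mulr_ge0 => //; apply: addr_ge0 => //; exact: mulr_ge0.
have HN (x : R) : 0 <= x <= s^-1 ->
    \sum_i (A i x ^+ 2 + L0 ^+ 4 * B i x ^+ 2 + L0 ^+ 2 * C i x ^+ 2) <= N x.
  move=> xs; rewrite /N /G2 /T mulr_sumr -big_split mulr_sumr /=.
  by apply: ler_sum => i _; have [_ _ h _] := Hf i; exact: h.
have TE : T = cint (- B0) L0 G2 by rewrite /T /G2 cint_sum// => i; exact: contX.
pose F := wing_sum L0 A B C.
have sF : sqi F by exact: (sqi_wing_sum hB0 hL0 s1 sL sm out).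
have Oin p : v p != 0 -> O p by exact: (ws_in ws).
have [bv _ _] := ws_box hB0 hL0 ws.
have [[sv _ _] _ _ _ _] := ws.
exists F; first split=> //.
  apply: le_trans (wing_sum_bound hB0 hL0 s1 sL sm out cN N0 HN) _.
  have G2l : cint 0 s^-1 G2 <= T.
    rewrite TE; apply: cint_mono => //; first by rewrite oppr_le0 ltW.
      exact: ltW.
    by apply: ltW; apply: lt_trans sVL _; move: hL0 => h; lra.
  (* [s^4 T] is constant in [x] and the interval has length [1 / s], which turns [s^4] into
     [s^3]. *)
  have -> : cint 0 s^-1 N = c * (cint 0 s^-1 G2 + s ^+ 3 * T).
    rewrite /N cintZ; last by apply: contD => //; exact: cont_cst.
    rewrite cintD//; last exact: cont_cst.
    rewrite cint_cst ?ltW// subr0; congr (_ * (_ + _)).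
    by field; exact: lt0r_neq0.
  have TU : T <= L0 / 2 * ip w w by exact: coef_bessel.
  have s31 : 1 <= s ^+ 3 by exact: exprn_ege1.
  apply: (@le_trans _ _ (3 / 2 * L0 * (c * (2 * (s ^+ 3 * (L0 / 2 * ip w w)))))); last first.
    by rewrite /wing_const le_eqVlt; apply/orP; left; apply/eqP; field.
  apply: ler_wpM2l; first by rewrite mulr_ge0// ltW.
  apply: ler_wpM2l => //; rewrite mulr2n mulrDl mul1r; apply: lerD.
    apply: le_trans G2l _; apply: le_trans (TU) _.
    by apply: ler_peMl => //; exact: le_trans TU.
  by apply: ler_wpM2l => //; exact: le_trans s31.
pose I := \1_[set p : R * R | p.1 < 0] : R * R -> R.
pose m (i : 'I_K) := wing_mode L0 (kap L0 (nat_of_ord i)) (A i) (B i) (C i).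
pose g (i : 'I_K) := fun p : R * R => coef L0 w (nat_of_ord i) p.1 * sin (kap L0 (nat_of_ord i) * p.2).
have cg i : continuous (g i).
  apply: smooth2_continuous.
  exact: (smooth2M (@smooth2_fst R _ (sc i)) (@smooth2_snd R _ (@smooth1_sinM R (kap L0 i)))).
have cm i : continuous (m i) by exact: (smooth2_continuous (sm i)).
have sh (i : 'I_K) : sqi (fun p => bx p * (I p * g i p + (1 - I p) * m i p)) by exact: sqi_bx_left.
have ct : continuous (trig_sum L0 K w) by apply: smooth2_continuous; exact: (trig_sum_smooth2 K tw).
(* On [O] the rectangle is [p.1 < 0], and its complement agrees with [wing_part] up to [1 / s],
   beyond which all the modes vanish. *)
have sum0 : ip v (fun p => rect p * trig_sum L0 K w p + F p) = 0.
  transitivity (ip v (fun p => \sum_(i < K) bx p * (I p * g i p + (1 - I p) * m i p))); last first.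
    rewrite ip_sumr// big1// => i _; rewrite -(ip_bx _ bv).
    by have [_ _ _ h] := Hf i; exact: (h _ _ _ _ ws).
  apply: eq_ip => p; have [->|vp] := eqVneq (v p) 0; first by rewrite !mul0r.
  have Op := Oin p vp; congr (_ * _); rewrite -mulr_sumr (indT (bv p vp)) mul1r.
  rewrite big_split /= -!mulr_sumr rect_indE// /F /wing_sum; congr (_ + _).
  have [xs|xs] := leP p.1 s^-1; first by rewrite wing_indE// (le_lt_trans xs).
  by rewrite big1 ?mulr0// => i _; exact: (mode_out L0 out).
move: sum0; rewrite ipDr//; last exact: sqi_rect.
move=> /eqP; rewrite addr_eq0 => /eqP ->; congr (- _).
apply: eq_ip => p; rewrite /right_part.
have [->|/(wing_sum_in out)[[x0 _ _] _]] := eqVneq (F p) 0; first by rewrite !mulr0.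
by rewrite indT// mul1r.
Qed.

End Core.

Lemma sqi_ind {R : realType} (A : set (R * R)) (v : R * R -> R) : meas2 A -> sqi v ->
  sqi (fun p => \1_A p * v p) /\ ip (fun p => \1_A p * v p) (fun p => \1_A p * v p) <= ip v v.
Proof.
move=> mA sv.
have s1 : sqi (fun p => \1_A p * v p).
  rewrite (_ : (fun p => _) = (fun p => v p * \1_A p)); last by apply/funext => p; rewrite mulrC.
  apply: (@sqi_mulb _ 1) => //; first exact: mfun2_ind.
  by move=> p _; rewrite ger0_norm ?ind_ge0 ?ind_le1.
split=> //; apply: le_Rintegral => //; [exact: sqi_mul|exact: sqi_mul|].
move=> p _; have [h|h] := pselect (A p); first by rewrite indT// !mul1r.
by rewrite indF// !mul0r -expr2 sqr_ge0.
Qed.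

(** As [b <= a], one factor [a] can be divided out, leaving [3 a <= 4 (x + 1) b]; then
    [(x + 1)^2 <= 2 (x^2 + 1)], and [32 / 9 <= 4]. *)
Lemma quad_absorb {R : realType} (a b x : R) : 0 <= a -> 0 <= x ->
  b <= a -> 0 <= b -> 3 * a ^+ 2 <= 4 * (x * b * a + b ^+ 2) -> a ^+ 2 <= 4 * (x ^+ 2 + 1) * b ^+ 2.
Proof.
move=> a0 x0 ba b0 h.
have [->|an] := eqVneq a 0; first by rewrite expr0n /= !mulr_ge0 ?addr_ge0 ?sqr_ge0.
have ap : 0 < a by rewrite lt_def an.
have h1 : 3 * a <= 4 * ((x + 1) * b).
  rewrite -(ler_pM2r ap) (_ : 3 * a * a = 3 * a ^+ 2); last by ring.
  apply: le_trans h _; rewrite (_ : 4 * ((x + 1) * b) * a = 4 * (x * b * a + b * a)); last by ring.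
  by apply: ler_wpM2l => //; apply: lerD => //; rewrite expr2; exact: ler_wpM2l.
have h2 : (3 * a) ^+ 2 <= (4 * ((x + 1) * b)) ^+ 2.
  by rewrite ler_sqr// nnegrE; do ?apply: mulr_ge0 => //; exact: addr_ge0.
have h3 : (x + 1) ^+ 2 <= 2 * (x ^+ 2 + 1).
  by have := sqr_ge0 (x - 1); rewrite sqrrB sqrrD; clear; lra.
have h4 := ler_wpM2r (sqr_ge0 b) h3.
have h5 : 0 <= (x ^+ 2 + 1) * b ^+ 2 by rewrite mulr_ge0 ?addr_ge0 ?sqr_ge0.
have e1 : (3 * a) ^+ 2 = 9 * a ^+ 2 by ring.
have e2 : (4 * ((x + 1) * b)) ^+ 2 = 16 * ((x + 1) ^+ 2 * b ^+ 2) by ring.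
move: h2 h4 h5; rewrite e1 e2 -[2 * _ * _]mulrA -[4 * _ * _]mulrA.
move: (a ^+ 2) ((x + 1) ^+ 2 * b ^+ 2) ((x ^+ 2 + 1) * b ^+ 2) => y z t; clear; lra.
Qed.

(** * The estimate for weak solutions *)

Section Estimate.
Context {R : realType}.
Variables (B0 L0 : R) (hB0 : 0 < B0) (hL0 : 0 < L0).
Local Notation rect := (\1_(box (- B0) 0 0 L0) : R * R -> R).

Lemma meas2_right : meas2 [set p : R * R | 0 < p.1].
Proof.
apply: (@meas2_gt0 R (fun p => p.1)); apply: smooth2_mfun2.
exact: (@smooth2_fst R (fun x => x) smooth1_id).
Qed.

(** A stage between [v] and [w]: Poincare's inequality is applied to [w], the resonance identity to
    [v], and the norm of [w - v] records the mismatch. *)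
Lemma test_estimate : exists2 c : R, 0 <= c & forall s v vx vy u w,
  1 <= s -> 2 / L0 < s -> weak_solution B0 L0 (s ^+ 2) v vx vy u -> test_function (stadium B0 L0) w ->
  ip (fun p => rect p * w p) w <= (4 * s ^+ 2)^-1 * ip (dy w) (dy w) +
    (2 / L0 * Num.sqrt (c * s ^+ 3) * Num.sqrt (ip (right_part v) (right_part v)) +
     Num.sqrt (ip (fun p => w p - v p) (fun p => w p - v p))) * Num.sqrt (ip w w).
Proof.
have [c c0 H] := resonant_identity hB0 hL0.
exists (3 / 2 * L0 ^+ 2 * c) => [|s v vx vy u w s1 sL ws tw].
  by apply: mulr_ge0 => //; apply: mulr_ge0 => //; exact: sqr_ge0.
have s0 : 0 < s by exact: lt_le_trans s1.
have [K [Kk Km]] := mode_count hL0 s1.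
have [F [sF Fb] Fi] := H s v vx vy u w K s1 sL Kk ws tw.
have [[sv _ _] _ _ _ _] := ws.
have [sr _] := sqi_ind meas2_right sv.
have sw := sqi_test hB0 hL0 tw.
set m := _ * pi / L0 in Km.
have m0 : 0 < m by apply: lt_le_trans Km; exact: mulr_gt0.
pose S := rect_energy B0 L0 K w.
have ct : continuous (trig_sum L0 K w) by apply: smooth2_continuous; exact: (trig_sum_smooth2 K tw).
have sT := sqi_rect hB0 hL0 ct.
set T := fun p => rect p * trig_sum L0 K w p in sT Fi.
(* [ip w T] is exactly [S]; splitting [w] into [w - v] and [v] lets the resonance identity act on
   the second part. *)
have ST : S = ip (fun p => w p - v p) T - ip (right_part v) F.
  by rewrite ipBl// -Fi addrNK /T ip_trig_sum.
have wd : sqi (fun p => w p - v p) by exact: sqiB.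
have TT : ip T T = L0 / 2 * S by exact: ip_trig_sum_self.
have S1 : S <= L0 / 2 * ip w w by exact: rect_energy_le.
have hL : 0 <= L0 / 2 by rewrite divr_ge0// ltW.
have b1 : ip (fun p => w p - v p) T <= Num.sqrt (ip (fun p => w p - v p) (fun p => w p - v p)) * (L0 / 2 * Num.sqrt (ip w w)).
  apply: le_trans (ler_norm _) _; apply: le_trans (ip_CS_sqrt wd sT) _.
  apply: ler_wpM2l; first exact: sqrtr_ge0.
  rewrite TT -[X in X * Num.sqrt _]ger0_norm// -sqrtr_sqr -sqrtrM ?sqr_ge0//.
  apply: ler_wsqrtr; rewrite (_ : (L0 / 2) ^+ 2 * ip w w = L0 / 2 * (L0 / 2 * ip w w)); last by ring.
  exact: ler_wpM2l.
have b2 : - ip (right_part v) F <= Num.sqrt (ip (right_part v) (right_part v)) *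
    (Num.sqrt (3 / 2 * L0 ^+ 2 * c * s ^+ 3) * Num.sqrt (ip w w)).
  apply: le_trans (ler_norm _) _; rewrite normrN; apply: le_trans (ip_CS_sqrt sr sF) _.
  apply: ler_wpM2l; first exact: sqrtr_ge0.
  rewrite -sqrtrM; first exact: ler_wsqrtr.
  apply: mulr_ge0; last by rewrite exprn_ge0// ltW.
  by apply: mulr_ge0 => //; apply: mulr_ge0 => //; exact: sqr_ge0.
have SE : 2 / L0 * S <= (2 / L0 * Num.sqrt (3 / 2 * L0 ^+ 2 * c * s ^+ 3) * Num.sqrt (ip (right_part v) (right_part v)) +
     Num.sqrt (ip (fun p => w p - v p) (fun p => w p - v p))) * Num.sqrt (ip w w).
  have h0 : 0 <= 2 / L0 by rewrite divr_ge0// ltW.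
  have := ler_wpM2l h0 (lerD b1 b2); rewrite -ST.
  move/le_trans; apply; rewrite le_eqVlt; apply/orP; left; apply/eqP.
  by field; exact: lt0r_neq0.
have := rect_poincare hB0 hL0 tw (erefl m); rewrite -/S => P.
have m20 : 0 < m ^+ 2 by exact: exprn_gt0.
have s20 : 0 < 4 * s ^+ 2 by rewrite mulr_gt0 ?exprn_gt0.
have ms : 4 * s ^+ 2 <= m ^+ 2.
  rewrite (_ : 4 * s ^+ 2 = (2 * s) ^+ 2); last by ring.
  by apply: sqr_le_norm; rewrite ger0_norm// mulr_ge0// ltW.
apply: le_trans (_ : (m ^+ 2)^-1 * ip (dy w) (dy w) + 2 / L0 * S <= _).
  rewrite -(ler_pM2l m20) mulrDr mulrA mulfV ?mul1r//; exact: lt0r_neq0.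
apply: lerD => //; apply: ler_wpM2r; first exact: ip_ge0.
by rewrite lef_pV2.
Qed.

(** [test_estimate] with [w = u n], in the limit. The energy identity bounds the term in [vy] by a
    quarter of [ip v v], which is then absorbed. *)
Lemma core_estimate : exists2 c : R, 0 <= c & forall s v vx vy u,
  1 <= s -> 2 / L0 < s -> weak_solution B0 L0 (s ^+ 2) v vx vy u ->
  ip v v <= c * s ^+ 3 * ip (right_part v) (right_part v).
Proof.
have [c c0 H] := test_estimate.
exists (4 * ((2 / L0) ^+ 2 * c + 1)) => [|s v vx vy u s1 sL ws].
  by apply: mulr_ge0 => //; apply: addr_ge0 => //; apply: mulr_ge0 => //; exact: sqr_ge0.
have s0 : 0 < s by exact: lt_le_trans s1.
have [[sv svx svy] _ tu [cu cux cuy] _] := ws.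
have su n := sqi_test hB0 hL0 (tu n); have suy n := sqi_test hB0 hL0 (test_dy (tu n)).
have mr : meas2 (box (- B0) 0 0 L0) by exact: meas2_box.
pose rv := right_part v; pose W := ip rv rv.
have [srv Wv] : sqi rv /\ W <= ip v v by exact: (sqi_ind meas2_right sv).
pose X := Num.sqrt (c * s ^+ 3).
have lim1 : (fun n => ip (fun p => rect p * u n p) (u n)) @ \oo --> ip (fun p => rect p * v p) v.
  apply: ip_cvg => //; try by move=> n; exact: (sqi_ind mr _).1.
  - exact: (sqi_ind mr sv).1.
  - apply: (squeeze_cvgr _ _ cu); last exact: cvg_cst.
    near=> n; rewrite ip_ge0 /=.
    rewrite (_ : (fun p => _) = (fun p => rect p * (u n p - v p))); last by apply/funext => p; rewrite mulrBr.
    by apply: (sqi_ind mr _).2; exact: sqiB.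
have lim2 : (fun n => ip (u n) (u n)) @ \oo --> ip v v by exact: ip_cvg.
have lim3 : (fun n => ip (dy (u n)) (dy (u n))) @ \oo --> ip vy vy by exact: ip_cvg.
have lim4 : (fun n => Num.sqrt (ip (u n) (u n))) @ \oo --> Num.sqrt (ip v v).
  by apply: (cvg_comp _ _ lim2); exact: sqrt_continuous.
have lim5 := sqrt_cvg0 cu.
have lim6 : (fun n => (4 * s ^+ 2)^-1 * ip (dy (u n)) (dy (u n)) +
    (2 / L0 * X * Num.sqrt W + Num.sqrt (ip (fun p => u n p - v p) (fun p => u n p - v p))) * Num.sqrt (ip (u n) (u n))) @ \oo
   --> (4 * s ^+ 2)^-1 * ip vy vy + (2 / L0 * X * Num.sqrt W + 0) * Num.sqrt (ip v v).
  apply: cvgD; first by apply: cvgM => //; exact: cvg_cst.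
  by apply: cvgM => //; apply: cvgD => //; exact: cvg_cst.
have le1 : ip (fun p => rect p * v p) v <= (4 * s ^+ 2)^-1 * ip vy vy + (2 / L0 * X * Num.sqrt W + 0) * Num.sqrt (ip v v).
  apply: (ler_cvg_to lim1 lim6); apply: nearW => n.
  exact: (H s v vx vy u (u n) s1 sL ws (tu n)).
have le2 : (4 * s ^+ 2)^-1 * ip vy vy <= 4^-1 * ip v v.
  have := ws_energy hB0 hL0 ws; have := ip_ge0 vx => x0 e.
  have : ip vy vy <= s ^+ 2 * ip v v by rewrite -e lerDr.
  move=> h; rewrite invfM -[_ * ip vy vy]mulrA; apply: ler_wpM2l => //.
  by rewrite -(ler_pM2l (exprn_gt0 2 s0)) mulrA mulfV ?mul1r// expf_neq0// lt0r_neq0.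
have sum : ip v v = ip (fun p => rect p * v p) v + W.
  have [_ O0 _ _ _] := ws.
  have -> : W = ip rv v.
    apply: eq_ip => p; rewrite /rv /right_part.
    have [h|h] := pselect ([set p : R * R | 0 < p.1] p); first by rewrite indT// !mul1r.
    by rewrite indF// !mul0r.
  rewrite -ipDl//; last exact: (sqi_ind mr sv).1.
  apply: eq_ip => p; congr (_ * _); rewrite right_partE//.
  exact: (ws_in ws).
pose a := Num.sqrt (ip v v); pose b := Num.sqrt W.
have a2 : a ^+ 2 = ip v v by rewrite sqr_sqrtr// ip_ge0.
have b2 : b ^+ 2 = W by rewrite sqr_sqrtr// ip_ge0.
have X0 : 0 <= c * s ^+ 3 by rewrite mulr_ge0// exprn_ge0// ltW.
have X2 : X ^+ 2 = c * s ^+ 3 by rewrite sqr_sqrtr.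
have l0 : 0 <= 2 / L0 by rewrite divr_ge0// ltW.
(* With [a] and [b] the norms of [v] on the plane and on the wing, [sum], [le1] and [le2] give
   [a^2 <= a^2 / 4 + (2 / L0) X b a + b^2]. *)
have key : a ^+ 2 <= 4 * ((2 / L0 * X) ^+ 2 + 1) * b ^+ 2.
  apply: quad_absorb; [exact: sqrtr_ge0| | |exact: sqrtr_ge0|].
  - by rewrite mulr_ge0// sqrtr_ge0.
  - exact: ler_wsqrtr.
  - move: le1 le2 sum; rewrite -/a -/b a2 b2 addr0.
    move: (ip v v) (ip _ v) (_^-1 * ip vy vy) (_ * b * a) => x y z t; clear; lra.
rewrite -/W -a2 -b2; apply: le_trans key _; apply: ler_wpM2r; first exact: sqr_ge0.
rewrite -[leRHS]mulrA; apply: ler_wpM2l => //; rewrite exprMn X2.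
rewrite (_ : (_ + 1) * s ^+ 3 = (2 / L0) ^+ 2 * (c * s ^+ 3) + s ^+ 3); last by ring.
rewrite lerD2l.
exact: exprn_ege1.
Unshelve. all: by end_near. Qed.

End Estimate.

(** * Eigenfunctions as weak solutions *)

Section Conversion.
Context {R : realType}.
Local Notation RR := (measurableTypeR R * measurableTypeR R)%type.
Local Notation mu := (@lebesgue2 R).
Local Notation leb := (@lebesgue_measure R).
Variables (B0 L0 : R) (hB0 : 0 < B0) (hL0 : 0 < L0).
Local Notation D := (stadium B0 L0).
Local Notation O := (split_stadium B0 L0).

Lemma mfun2_fst : mfun2 (fun p : R * R => p.1).
Proof. exact: (smooth2_mfun2 (@smooth2_fst R (fun x => x) smooth1_id)). Qed.
Lemma mfun2_snd : mfun2 (fun p : R * R => p.2).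
Proof. exact: (smooth2_mfun2 (@smooth2_snd R (fun x => x) smooth1_id)). Qed.

Lemma meas2_lt (f g : R * R -> R) : mfun2 f -> mfun2 g -> meas2 [set p | f p < g p].
Proof.
move=> mf mg; rewrite (_ : [set p | _] = [set p | 0 < g p - f p]).
  by apply: meas2_gt0; exact: mfun2B.
by apply/seteqP; split => p /=; rewrite subr_gt0.
Qed.

Lemma meas2_le (f g : R * R -> R) : mfun2 f -> mfun2 g -> meas2 [set p | f p <= g p].
Proof.
move=> mf mg; rewrite (_ : [set p | _] = ~` [set p | g p < f p]).
  by apply: measurableC; exact: meas2_lt.
by apply/seteqP; split => p /=; rewrite leNgt => /negP.
Qed.

Lemma mfun2_height : mfun2 (fun p => stadium_height L0 p.1).
Proof.
rewrite (_ : (fun p => _) = (fun p : R * R => \1_[set p : R * R | p.1 <= 0] p * L0 +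
   (1 - \1_[set p : R * R | p.1 <= 0] p) * Num.sqrt (L0 ^+ 2 - p.1 ^+ 2))).
  have mi : mfun2 (\1_[set p : R * R | p.1 <= 0]).
    by apply: mfun2_ind; apply: meas2_le; [exact: mfun2_fst|exact: mfun2_cst].
  apply: mfun2D; apply: mfun2M => //; [exact: mfun2_cst|by apply: mfun2B => //; exact: mfun2_cst|].
  have ms : measurable_fun [set: measurableTypeR R] (Num.sqrt : R -> R).
    by apply: continuous_measurable_fun; exact: sqrt_continuous.
  apply: (measurableT_comp ms); apply: mfun2B; first exact: mfun2_cst.
  by apply: (@mfun2M R (fun p => p.1) (fun p => p.1)); exact: mfun2_fst.
apply/funext => p; rewrite /stadium_height; case: ifPn => h.
  by rewrite indT//; ring.
by rewrite indF/=; [ring|exact/negP].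
Qed.

Lemma meas2_stadium : meas2 D.
Proof.
rewrite (_ : D = ([set p | - B0 <= p.1] `&` [set p | p.1 <= L0]) `&`
   ([set p | 0 <= p.2] `&` [set p | p.2 <= stadium_height L0 p.1])).
  have := (mfun2_fst, mfun2_snd, mfun2_height, @mfun2_cst R) => -[[[m1 m2] m3] m4].
  by apply: measurableI; apply: measurableI; apply: meas2_le.
apply/seteqP; split => p /=; first by move=> [/andP[a b] /andP[c d]].
by move=> [[a b] [c d]]; split; rewrite ?a ?b ?c ?d.
Qed.

Lemma meas2_split : meas2 O.
Proof.
have := (mfun2_fst, mfun2_snd, mfun2_height, @mfun2_cst R) => -[[[m1 m2] m3] m4].
rewrite (_ : O = (([set p | - B0 < p.1] `&` [set p | p.1 < L0]) `&`
   ([set p | p.1 < 0] `|` [set p | 0 < p.1])) `&`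
   ([set p | 0 < p.2] `&` [set p | p.2 < stadium_height L0 p.1])).
  by apply: measurableI; [apply: measurableI; [apply: measurableI|apply: measurableU]|apply: measurableI]; apply: meas2_lt.
apply/seteqP; split => p /=.
  by move=> [/andP[a b] n /andP[c d]]; do ! split => //; apply/orP; rewrite -neq_lt.
by move=> [[[a b] /orP n] [c d]]; split; rewrite ?a ?b ?c ?d// neq_lt.
Qed.

(** The set meets every vertical line in at most two points, the three lines at [- B0], [0] and [L0]
    excepted. *)
Lemma null_skeleton : mu (D `\` O) = 0%E.
Proof.
have mN : measurable (D `\` O : set RR) by apply: measurableD; [exact: meas2_stadium|exact: meas2_split].
have s0 (x : R) : leb.-negligible [set x].
  by apply/negligibleP; [exact: measurable_set1|exact: lebesgue_measure_set1].
rewrite /lebesgue2 /= /product_measure1 /=.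
transitivity (\int[leb]_x (cst 0 x))%E; last exact: integral0.
apply: ge0_ae_eq_integral => //.
  exact: measurable_fun_xsection.
apply: (@negligibleS _ _ _ leb _ _ (_ : _ `<=` [set - B0] `|` ([set L0] `|` [set 0]))); last first.
  by apply: negligibleU => //; exact: negligibleU.
move=> x /= nx; apply: contrapT => nF; apply: nx => _.
apply/negligibleP; first exact: measurable_xsection.
apply: (@negligibleS _ _ _ leb ([set 0] `|` [set stadium_height L0 x])); last exact: negligibleU.
move=> y; rewrite xsectionE /= => -[[/= /andP[a b] /andP[c d]] nO].
apply: contrapT => ny; apply: nO; split => /=.
- apply/andP; split; rewrite lt_neqAle.
    by rewrite a andbT; apply/eqP => e; apply: nF; left.
  by rewrite b andbT; apply/eqP => e; apply: nF; right; left.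
- by apply/eqP => e; apply: nF; right; right.
- apply/andP; split; rewrite lt_neqAle.
    by rewrite c andbT; apply/eqP => e; apply: ny; left.
  by rewrite d andbT; apply/eqP => e; apply: ny; right.
Qed.

Lemma ae_int (F G : R * R -> R) : mfun2 F -> mfun2 G ->
  (forall p, ~ (D `\` O) p -> F p = G p) -> (\int[mu]_p (F p)%:E = \int[mu]_p (G p)%:E)%E.
Proof.
move=> mF mG FG; apply: ae_eq_integral => //; [exact/measurable_EFinP|exact/measurable_EFinP|].
exists (D `\` O); split.
- by apply: measurableD; [exact: meas2_stadium|exact: meas2_split].
- exact: null_skeleton.
- by move=> p /= np; apply: contrapT => nN; apply: np => _; rewrite FG.
Qed.

(** [Q0] is the square as it stands in the definition of the norm, [Q] the one formed with
    representatives that vanish on the skeleton. *)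
Lemma L2norm_ae (S : set (R * R)) (g Q0 Q : R * R -> R) :
  (forall p, (g \_ S) p ^+ 2 = Q0 p) -> mfun2 Q0 -> mfun2 Q -> (forall p, 0 <= Q p) ->
  mu.-integrable setT (EFin \o Q) -> (forall p, ~ (D `\` O) p -> Q0 p = Q p) ->
  L2norm S g = (Num.sqrt (\int[mu]_p Q p))%:E.
Proof.
move=> gQ m0 mQ Qp iQ QQ; rewrite /L2norm unlock /=.
transitivity ((\int[mu]_p (Q p)%:E) `^ 2^-1)%E.
  congr (_ `^ _)%E; rewrite -(ae_int m0 mQ QQ); apply: eq_integral => p _.
  by rewrite -gQ powR_mulrn ?normr_ge0// real_normK ?num_real.
rewrite -[X in (X `^ _)%E]fineK; last exact: integral_fune_fin_num.
rewrite -/(Rintegral _ _ _) poweR_EFin powR12_sqrt//.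
by apply: Rintegral_ge0.
Qed.

Lemma L2_sqi f : L2 D f -> sqi (f \_ D).
Proof.
move=> fL; split.
  by have := sub_Lfun_mfun fL; rewrite inE.
exact: Lfun2_integrable_sqr.
Qed.

(* A representative of [f] that vanishes on the null set [D] minus [O]. *)
Definition off_skeleton (f : R * R -> R) (p : R * R) : R := \1_O p * (f \_ D) p.

Lemma off_skeletonE f p : ~ (D `\` O) p -> off_skeleton f p = (f \_ D) p.
Proof.
move=> nN; rewrite /off_skeleton; have [Op|nO] := pselect (O p); first by rewrite indT ?mul1r.
rewrite indF// mul0r patchE; case: ifPn => // /set_mem Dp.
by exfalso; apply: nN.
Qed.

Lemma sqi_off f : L2 D f -> sqi (off_skeleton f).
Proof. by move=> /L2_sqi sf; have [] := sqi_ind meas2_split sf. Qed.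

Lemma ip_off f phi : L2 D f -> mfun2 phi ->
  \int[mu]_(p in D) (f p * phi p) = ip (off_skeleton f) phi.
Proof.
move=> fL mp; have [mf _] := L2_sqi fL; have [mv _] := sqi_off fL.
rewrite Rintegral_mkcond; transitivity (\int[mu]_p ((f \_ D) p * phi p)).
  apply: eq_Rintegral => p _; rewrite !patchE; case: ifPn => // _.
  by rewrite mul0r.
rewrite /ip /Rintegral; congr fine; apply: ae_int; [exact: mfun2M|exact: mfun2M|].
by move=> p nN; rewrite off_skeletonE.
Qed.

Lemma L2norm_test f phi : L2 D f -> test_function D phi ->
  L2norm D (phi \- f) = (Num.sqrt (ip (fun p => phi p - off_skeleton f p) (fun p => phi p - off_skeleton f p)))%:E.
Proof.
move=> fL tp; have [mf _] := L2_sqi fL; have sv := sqi_off fL.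
have sp := sqi_test hB0 hL0 tp; have [mp _] := sp.
have sd : sqi (fun p => phi p - off_skeleton f p) by exact: sqiB.
have [md _] := sd.
apply: (@L2norm_ae D _ (fun p => (phi p - (f \_ D) p) * (phi p - (f \_ D) p))).
- move=> p; rewrite -expr2 !patchE; case: ifPn => // /negP nD.
  rewrite subr0 (test_nD tp)// => Dp; apply: nD; exact/mem_set.
- by apply: mfun2M; exact: mfun2B.
- exact: mfun2M.
- by move=> p; rewrite -expr2 sqr_ge0.
- exact: sqi_mul.
- by move=> p nN; rewrite off_skeletonE.
Qed.

Lemma sqrt_EFin_cvg0 (a : nat -> R) : (forall n, 0 <= a n) ->
  (fun n => (Num.sqrt (a n))%:E) @ \oo --> 0%E -> a @ \oo --> (0 : R).
Proof.
move=> a0 /fine_cvg /= h.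
rewrite (_ : a = (fun n => Num.sqrt (a n) * Num.sqrt (a n))).
  by rewrite -[X in _ --> X](mulr0 (0 : R)); apply: cvgM.
by apply/funext => n; rewrite -expr2 sqr_sqrtr.
Qed.

(** The first order form of the equation comes from applying [weak_gradient] to [dx psi] and
    [dy psi], themselves test functions, and then [helmholtz] to [psi]. *)
Lemma weak_solution_exists E f : H10 D f -> helmholtz D E f ->
  exists vx vy u, weak_solution B0 L0 E (off_skeleton f) vx vy u.
Proof.
move=> [fL [gx [gy [gxL gyL wg [phi [tphi c0 cx cy]]]]]] hf.
exists (off_skeleton gx), (off_skeleton gy), phi; split.
- by split; exact: sqi_off.
- by move=> p nO; rewrite /off_skeleton indF// !mul0r.
- exact: tphi.
- split; apply: sqrt_EFin_cvg0; try by move=> n; exact: ip_ge0.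
  + by under eq_fun do rewrite -L2norm_test//.
  + by under eq_fun do rewrite -(L2norm_test gxL (test_dx (tphi _))).
  + by under eq_fun do rewrite -(L2norm_test gyL (test_dy (tphi _))).
- move=> psi tp; have [tx ty] := (test_dx tp, test_dy tp).
  have [txx tyy] := (test_dx tx, test_dy ty).
  have sv := sqi_off fL.
  have mt phi0 : test_function D phi0 -> mfun2 phi0 by move=> /(sqi_test hB0 hL0)[].
  have e1 : ip (off_skeleton gx) (dx psi) = - ip (off_skeleton f) (dx (dx psi)).
    by have [w _] := wg _ tx; rewrite -(ip_off gxL (mt _ tx)) -(ip_off fL (mt _ txx)) w opprK.
  have e2 : ip (off_skeleton gy) (dy psi) = - ip (off_skeleton f) (dy (dy psi)).
    by have [_ w] := wg _ ty; rewrite -(ip_off gyL (mt _ ty)) -(ip_off fL (mt _ tyy)) w opprK.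
  have sxx := sqi_test hB0 hL0 txx; have syy := sqi_test hB0 hL0 tyy.
  have e3 : ip (off_skeleton f) (fun p => - (dx (dx psi) p + dy (dy psi) p)) =
      - (ip (off_skeleton f) (dx (dx psi)) + ip (off_skeleton f) (dy (dy psi))).
    rewrite -ipDr// -mulN1r -ipZr//; last exact: sqiD.
    by apply: eq_ip => p; rewrite mulN1r.
  have m3 : mfun2 (fun p => - (dx (dx psi) p + dy (dy psi) p)).
    rewrite (_ : (fun p => _) = (fun p => (-1) * (dx (dx psi) p + dy (dy psi) p))).
      by have [] := sqiZ (-1) (sqiD sxx syy).
    by apply/funext => p; rewrite mulN1r.
  by rewrite e1 e2 -opprD -e3 -(ip_off fL m3) -(ip_off fL (mt _ tp)) hf.
Qed.

Lemma wingE p : wing B0 L0 p <-> D p /\ 0 < p.1.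
Proof.
split=> [[Dp nr]|[Dp p0]]; split=> //.
  rewrite ltNge; apply/negP => x0; apply: nr.
  case: Dp => /andP[h1 _] /andP[h2]; rewrite /stadium_height x0 => h3.
  by split; rewrite ?h1 ?h2.
by move=> [/andP[_ x0] _]; move: p0; rewrite ltNge x0.
Qed.

Lemma normc_sqr (z : R[i]) : complex.Re `|z| ^+ 2 = complex.Re z ^+ 2 + complex.Im z ^+ 2.
Proof.
by case: z => a b /=; rewrite sqr_sqrtr// addr_ge0 ?sqr_ge0.
Qed.

Section Complex.
Variable u : R * R -> R[i].
Local Notation ua := (fun p => complex.Re (u p)).
Local Notation ub := (fun p => complex.Im (u p)).
Hypotheses (ha : L2 D ua) (hb : L2 D ub).

Lemma cL2norm_stadium : cL2norm D u =
  (Num.sqrt (ip (off_skeleton ua) (off_skeleton ua) + ip (off_skeleton ub) (off_skeleton ub)))%:E.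
Proof.
have sa := sqi_off ha; have sb := sqi_off hb.
have [ma _] := sa; have [mb _] := sb.
have [mfa _] := L2_sqi ha; have [mfb _] := L2_sqi hb.
rewrite /cL2norm (@L2norm_ae D _ (fun p => (ua \_ D) p * (ua \_ D) p + (ub \_ D) p * (ub \_ D) p)
  (fun p => off_skeleton ua p * off_skeleton ua p + off_skeleton ub p * off_skeleton ub p)).
- by rewrite /ip -RintegralD//; exact: sqi_mul.
- move=> p; rewrite !patchE; case: ifPn => _; first by rewrite normc_sqr !expr2.
  by rewrite expr0n !mulr0 addr0.
- by apply: mfun2D; exact: mfun2M.
- by apply: mfun2D; exact: mfun2M.
- by move=> p; rewrite -!expr2 addr_ge0 ?sqr_ge0.
- by apply: intbleD; exact: sqi_mul.
- by move=> p nN; rewrite !off_skeletonE.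
Qed.

Lemma cL2norm_wing : cL2norm (wing B0 L0) u =
  (Num.sqrt (ip (right_part (off_skeleton ua)) (right_part (off_skeleton ua)) +
             ip (right_part (off_skeleton ub)) (right_part (off_skeleton ub))))%:E.
Proof.
have [sa _] := sqi_ind (@meas2_right R) (sqi_off ha).
have [sb _] := sqi_ind (@meas2_right R) (sqi_off hb).
have [ma _] := sa; have [mb _] := sb.
have [mfa _] := L2_sqi ha; have [mfb _] := L2_sqi hb.
have mi := mfun2_ind (@meas2_right R).
pose I := \1_[set p : R * R | 0 < p.1] : R * R -> R.
rewrite /cL2norm (@L2norm_ae (wing B0 L0) _ (fun p => (I p * (ua \_ D) p) * (I p * (ua \_ D) p) +
   (I p * (ub \_ D) p) * (I p * (ub \_ D) p))
  (fun p => right_part (off_skeleton ua) p * right_part (off_skeleton ua) p +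
   right_part (off_skeleton ub) p * right_part (off_skeleton ub) p)).
- by rewrite /ip -RintegralD//; exact: sqi_mul.
- move=> p; rewrite /I !patchE; case: ifPn => [/set_mem/wingE[Dp p0]|nw].
    by rewrite (mem_set Dp) indT// !mul1r normc_sqr !expr2.
  rewrite expr0n; have [p0|p0] := boolP (0 < p.1).
    rewrite memNset ?mulr0 ?mul0r ?addr0// => Dp.
    by move/negP: nw; apply; apply/mem_set/wingE.
  by rewrite indF ?mul0r ?mulr0 ?addr0//; exact/negP.
- by apply: mfun2D; apply: mfun2M; exact: mfun2M.
- by apply: mfun2D; exact: mfun2M.
- by move=> p; rewrite -!expr2 addr_ge0 ?sqr_ge0.
- by apply: intbleD; exact: sqi_mul.
- by move=> p nN; rewrite /right_part !off_skeletonE.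
Qed.

End Complex.

End Conversion.

Lemma sqrt_cube_le {R : realType} (E a : R) : 1 <= E -> 3 / 4 <= a ->
  Num.sqrt (Num.sqrt E ^+ 3) <= E `^ a.
Proof.
move=> E1 ha; have E0 : 0 <= E by exact: le_trans E1.
rewrite -!powR12_sqrt ?powR_ge0 ?exprn_ge0 ?powR_ge0//.
rewrite -powR_mulrn ?powR_ge0// -!powRrM; apply: ler_powR => //.
by apply: le_trans ha; rewrite le_eqVlt; apply/orP; left; apply/eqP; field.
Qed.

Theorem theorem1 (R : realType) (B0 L0 : R) (hB0 : 0 < B0) (hL0 : 0 < L0)
    (eps : R) (heps : 0 <= eps) :
  exists E0 C : R, forall (E : R) (u : R * R -> R[i]),
    dirichlet_eigenfunction (stadium B0 L0) E u ->
    E0 < E ->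
    ((E `^ (- eps))%:E < edist_inf (rectangle_spectrum B0 L0) E)%E ->
    (cL2norm (stadium B0 L0) u
       <= (C * E `^ ((5 + 8 * eps) / 6))%:E * cL2norm (wing B0 L0) u)%E.
Proof.
have [c c0 H] := core_estimate hB0 hL0.
(* This threshold forces both [1 <= s] and [2 / L0 < s]. *)
exists (1 + (2 / L0) ^+ 2), (Num.sqrt c) => E u [Ha Hb ea eb _] E0E _.
have L20 : 0 <= (2 / L0) ^+ 2 by exact: sqr_ge0.
have l0 : 0 <= 2 / L0 by rewrite divr_ge0// ltW.
have E1 : 1 <= E by apply: le_trans (ltW E0E); rewrite lerDl.
have Ep : 0 <= E by exact: le_trans E1.
pose s := Num.sqrt E.
have s2 : s ^+ 2 = E by rewrite sqr_sqrtr.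
have s1 : 1 <= s by rewrite -sqrtr1 ler_wsqrtr.
have sL : 2 / L0 < s.
  rewrite -ltr_sqr ?nnegrE ?sqrtr_ge0// s2.
  by apply: le_lt_trans E0E; rewrite lerDr.
have [ha _] := Ha; have [hb _] := Hb.
have [vx [vy [w wa]]] := weak_solution_exists hB0 hL0 Ha ea.
have [vx' [vy' [w' wb]]] := weak_solution_exists hB0 hL0 Hb eb.
rewrite -s2 in wa wb.
have ka := H _ _ _ _ _ s1 sL wa; have kb := H _ _ _ _ _ s1 sL wb.
rewrite cL2norm_stadium// cL2norm_wing// -EFinM lee_fin.
have s30 : 0 <= s ^+ 3 by rewrite exprn_ge0// sqrtr_ge0.
(* The squared estimates for the real and imaginary parts have the same constant, so they add up to
   one for the modulus. *)
apply: le_trans (ler_wsqrtr (lerD ka kb)) _.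
have cs : 0 <= c * s ^+ 3 by exact: mulr_ge0.
rewrite -mulrDr (sqrtrM _ cs) (sqrtrM _ c0).
apply: ler_wpM2r; first exact: sqrtr_ge0.
apply: ler_wpM2l; first exact: sqrtr_ge0.
apply: sqrt_cube_le => //.
by rewrite ler_pdivlMr//; move: heps; clear; lra.
Qed.
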